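(* Let $(M,g)$ be a globally hyperbolic spacetime with compact Cauchy hypersurfaces, and suppose that it admits a complete timelike conformal Killing vector field $X\in\mathfrak{X}(M)$. Then $(M,g)$ satisfies the no-observer-horizon condition: for every inextendible timelike curve $\gamma$ in $(M,g)$, $$I^{+}(\gamma)=M \quad\text{and}\quad I^{-}(\gamma)=M .$$
   Context: A spacetime is a connected, Hausdorff, second-countable, time-oriented $C^\infty$ Lorentzian manifold $(M^{n+1},g)$ of dimension $n+1\geq 2$ (signature $(-,+,\dots,+)$). A vector field $X\in\mathfrak{X}(M)$ is a timelike conformal Killing vector field if it is timelike everywhere on $M$ and $\mathcal{L}_Xg=2\sigma g$ for some $\sigma\in C^\infty(M)$. It is complete if all its maximal integral curves are defined on all of $\mathbb{R}$. $I^{\pm}(\gamma)$ denotes the chronological future/past of the image of $\gamma$. No assumption is made on the Ricci tensor. *)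

(* Defs.v *)
From HB Require Import structures.
From mathcomp Require Import all_boot all_order all_algebra.
From mathcomp Require Import all_classical all_reals all_analysis.

Set Implicit Arguments.
Unset Strict Implicit.
Unset Printing Implicit Defensive.

Import Order.TTheory GRing.Theory Num.Theory.
Import numFieldNormedType.Exports.

Local Open Scope classical_set_scope.
Local Open Scope ring_scope.

(* Meant for U open in a finite-dimensional V, where the existence and
   continuity on U of all iterated directional derivatives is C^k. *)
Fixpoint Ck_on (R : realType) (V W : normedModType R) (k : nat) (U : set V)
    (f : V -> W) : Prop :=
  (forall x, U x -> {for x, continuous f}) /\
  if k is k'.+1 then
    forall v : V, (forall x, U x -> derivable f x v) /\
                  Ck_on k' U (fun x => 'D_v f x)
  else True.

Definition smooth_on (R : realType) (V W : normedModType R) (U : set V)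
    (f : V -> W) : Prop :=
  forall k, Ck_on k U f.

(* A homeomorphism from the open set [cdom] onto an open subset of R^m; the
   values of [cfun] off [cdom] and of [cinv] off the image are irrelevant. *)
Record chart (R : realType) (m : nat) (M : topologicalType) := Chart {
  cdom : set M;
  cfun :> M -> 'rV[R]_m;
  cinv : 'rV[R]_m -> M;
  cdom_open : open cdom;
  cimg_open : open (cfun @` cdom);
  cfun_continuous : forall p, cdom p -> {for p, continuous cfun};
  cinv_continuous : forall x, (cfun @` cdom) x -> {for x, continuous cinv};
  cfunK : forall p, cdom p -> cinv (cfun p) = p
}.

Definition cimg (R : realType) (m : nat) (M : topologicalType)
    (c : chart R m M) : set 'rV[R]_m := c @` cdom c.

Record manifold (R : realType) (m : nat) := Manifold {
  carrier :> topologicalType;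
  atlas : set (chart R m carrier);
  atlas_cover : forall p : carrier, exists2 c, atlas c & cdom c p;
  atlas_smooth : forall c d, atlas c -> atlas d ->
    smooth_on (c @` (cdom c `&` cdom d)) (d \o cinv c);
  manifold_hausdorff : hausdorff_space carrier;
  manifold_second_countable : @second_countable carrier
}.

Definition smooth_function (R : realType) (m : nat) (M : manifold R m)
    (f : M -> R) : Prop :=
  forall c : chart R m M, atlas c ->
    smooth_on (cimg c) (f \o cinv c : 'rV[R]_m -> R^o).

(* Tangent vectors are given by their components (row vectors) in the charts
   of the atlas; ['J (d \o cinv c) (c p)] acts on them on the right and is the
   differential of the change of coordinates from c to d. *)
Definition transition (R : realType) (m : nat) (M : manifold R m)
    (c d : chart R m M) (p : M) : 'M[R]_m :=
  'J (d \o cinv c) (c p).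

Record vector_field (R : realType) (m : nat) (M : manifold R m) := VectorField {
  vcomp :> chart R m M -> M -> 'rV[R]_m;
  vcomp_smooth : forall c, atlas c -> smooth_on (cimg c) (vcomp c \o cinv c);
  vcomp_change : forall c d p, atlas c -> atlas d -> cdom c p -> cdom d p ->
    vcomp d p = vcomp c p *m transition c d p
}.

Definition minkowski (R : realType) (n : nat) : 'M[R]_n.+1 :=
  diag_mx (\row_i (if i == ord0 then -1 else 1)).

(* [mcomp c p] is the Gram matrix of g at p in the coordinate basis of c;
   [mcomp_lorentz] provides a basis (the rows of P) in which the Gram matrix
   is diag(-1, 1, ..., 1). *)
Record lorentz_metric (R : realType) (n : nat) (M : manifold R n.+1) :=
  LorentzMetric {
  mcomp :> chart R n.+1 M -> M -> 'M[R]_n.+1;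
  mcomp_smooth : forall c, atlas c -> smooth_on (cimg c) (mcomp c \o cinv c);
  mcomp_change : forall c d p, atlas c -> atlas d -> cdom c p -> cdom d p ->
    mcomp c p = transition c d p *m mcomp d p *m (transition c d p)^T;
  mcomp_sym : forall c p, atlas c -> cdom c p -> (mcomp c p)^T = mcomp c p;
  mcomp_lorentz : forall c p, atlas c -> cdom c p ->
    exists2 P : 'M[R]_n.+1, P \in unitmx &
      P *m mcomp c p *m P^T = minkowski R n
}.

(* g_p(v, w), for v and w given by their components in the chart c *)
Definition inner (R : realType) (n : nat) (M : manifold R n.+1)
    (g : lorentz_metric M) (c : chart R n.+1 M) (p : M)
    (v w : 'rV[R]_n.+1) : R :=
  (v *m g c p *m w^T) 0 0.

Definition timelike_field (R : realType) (n : nat) (M : manifold R n.+1)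
    (g : lorentz_metric M) (X : vector_field M) : Prop :=
  forall c p, atlas c -> cdom c p -> inner g c p (X c p) (X c p) < 0.

(* The time orientation is the one for which [torient] is future-directed. *)
Record spacetime (R : realType) (n : nat) := Spacetime {
  stman :> manifold R n.+1;
  metric : lorentz_metric stman;
  torient : vector_field stman;
  torient_timelike : timelike_field metric torient;
  spacetime_connected : connected [set: stman]
}.

Definition timelike_vect (R : realType) (n : nat) (M : spacetime R n)
    (c : chart R n.+1 M) (p : M) (v : 'rV[R]_n.+1) : Prop :=
  inner (metric M) c p v v < 0.

Definition causal_vect (R : realType) (n : nat) (M : spacetime R n)
    (c : chart R n.+1 M) (p : M) (v : 'rV[R]_n.+1) : Prop :=
  v != 0 /\ inner (metric M) c p v v <= 0.

Definition future_vect (R : realType) (n : nat) (M : spacetime R n)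
    (c : chart R n.+1 M) (p : M) (v : 'rV[R]_n.+1) : Prop :=
  inner (metric M) c p v (torient M c p) < 0.

Definition past_vect (R : realType) (n : nat) (M : spacetime R n)
    (c : chart R n.+1 M) (p : M) (v : 'rV[R]_n.+1) : Prop :=
  0 < inner (metric M) c p v (torient M c p).

(* Near t, the restriction of gamma to D coincides in some chart with a smooth
   curve defined on a full neighbourhood of t, whose velocity at t is in K. *)
Definition smooth_germ (R : realType) (m : nat) (M : manifold R m)
    (K : chart R m M -> M -> 'rV[R]_m -> Prop)
    (gamma : R -> M) (D : set R) (t : R) : Prop :=
  exists (c : chart R m M) (beta : R -> 'rV[R]_m) (e : R),
    [/\ atlas c, 0 < e,
        smooth_on (ball t e : set R^o) (beta : R^o -> 'rV[R]_m),
        forall s, D s -> ball t e s ->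
          cdom c (gamma s) /\ c (gamma s) = beta s &
        K c (gamma t) ('D_1 (beta : R^o -> 'rV[R]_m) t)].

(* Piecewise smooth curve on the interval I (of any kind, non-degenerate) with
   one-sided velocities in K: by compactness, being smooth on one-sided
   neighbourhoods (up to the boundary) of every point of I amounts to having a
   locally finite set of breaks. If t is an endpoint of I, the germ on the
   missing side only asks for some vector of K at gamma(t), which exists for
   the cones used below. *)
Definition pw_smooth_curve (R : realType) (m : nat) (M : manifold R m)
    (K : chart R m M -> M -> 'rV[R]_m -> Prop)
    (gamma : R -> M) (I : set R) : Prop :=
  [/\ is_interval I,
      exists s t, [/\ I s, I t & s < t] &
      forall t, I t ->
        smooth_germ K gamma (I `&` [set s | t <= s]) t /\
        smooth_germ K gamma (I `&` [set s | s <= t]) t].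

Definition future_timelike_curve (R : realType) (n : nat) (M : spacetime R n)
    (gamma : R -> M) (I : set R) : Prop :=
  pw_smooth_curve (fun c p v => timelike_vect c p v /\ future_vect c p v)
    gamma I.

Definition past_timelike_curve (R : realType) (n : nat) (M : spacetime R n)
    (gamma : R -> M) (I : set R) : Prop :=
  pw_smooth_curve (fun c p v => timelike_vect c p v /\ past_vect c p v)
    gamma I.

Definition timelike_curve (R : realType) (n : nat) (M : spacetime R n)
    (gamma : R -> M) (I : set R) : Prop :=
  future_timelike_curve gamma I \/ past_timelike_curve gamma I.

Definition future_causal_curve (R : realType) (n : nat) (M : spacetime R n)
    (gamma : R -> M) (I : set R) : Prop :=
  pw_smooth_curve (fun c p v => causal_vect c p v /\ future_vect c p v)
    gamma I.

(* If the upper (lower) bound b of I belongs to I, gamma(b) is an upper (lower)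
   endpoint, so the domain of an inextendible curve is an open interval. *)
Definition upper_endpoint (R : realType) (M : topologicalType)
    (gamma : R -> M) (I : set R) (p : M) : Prop :=
  forall U, nbhs p U ->
    exists2 s, I s & forall t, I t -> s <= t -> U (gamma t).

Definition lower_endpoint (R : realType) (M : topologicalType)
    (gamma : R -> M) (I : set R) (p : M) : Prop :=
  forall U, nbhs p U ->
    exists2 s, I s & forall t, I t -> t <= s -> U (gamma t).

Definition inextendible (R : realType) (M : topologicalType)
    (gamma : R -> M) (I : set R) : Prop :=
  forall p, ~ upper_endpoint gamma I p /\ ~ lower_endpoint gamma I p.

Definition chron (R : realType) (n : nat) (M : spacetime R n) (p q : M) : Prop :=
  exists (gamma : R -> M) (a b : R),
    [/\ a < b, future_timelike_curve gamma `[a, b],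
        gamma a = p & gamma b = q].

Definition strict_causal (R : realType) (n : nat) (M : spacetime R n)
    (p q : M) : Prop :=
  exists (gamma : R -> M) (a b : R),
    [/\ a < b, future_causal_curve gamma `[a, b],
        gamma a = p & gamma b = q].

Definition chron_future (R : realType) (n : nat) (M : spacetime R n)
    (A : set M) : set M :=
  [set q | exists2 p, A p & chron p q].

Definition chron_past (R : realType) (n : nat) (M : spacetime R n)
    (A : set M) : set M :=
  [set p | exists2 q, A q & chron p q].

Definition causal_future (R : realType) (n : nat) (M : spacetime R n)
    (p : M) : set M :=
  [set q | p = q \/ strict_causal p q].

Definition causal_past (R : realType) (n : nat) (M : spacetime R n)
    (q : M) : set M :=
  [set p | p = q \/ strict_causal p q].

Definition causal (R : realType) (n : nat) (M : spacetime R n) : Prop :=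
  forall p : M, ~ strict_causal p p.

Definition globally_hyperbolic (R : realType) (n : nat) (M : spacetime R n)
    : Prop :=
  causal M /\
  forall p q : M, compact (causal_future p `&` causal_past q).

Definition cauchy_hypersurface (R : realType) (n : nat) (M : spacetime R n)
    (S : set M) : Prop :=
  forall (gamma : R -> M) (I : set R),
    timelike_curve gamma I -> inextendible gamma I ->
    exists! t, I t /\ S (gamma t).

(* In coordinates, with x^i on R^(n+1) and row-vector Jacobians,
   (L_X g)_ij = X^k d_k g_ij + (d_i X^k) g_kj + g_ik (d_j X^k). *)
Definition lie_metric (R : realType) (n : nat) (M : manifold R n.+1)
    (X : vector_field M) (g : lorentz_metric M) (c : chart R n.+1 M) (p : M)
    : 'M[R]_n.+1 :=
  let DX := 'J (X c \o cinv c) (c p) in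
  'D_(X c p) (g c \o cinv c) (c p) + DX *m g c p + g c p *m DX^T.

Definition conformal_killing (R : realType) (n : nat) (M : manifold R n.+1)
    (g : lorentz_metric M) (X : vector_field M) : Prop :=
  exists2 sigma : M -> R, smooth_function sigma &
    forall c p, atlas c -> cdom c p ->
      lie_metric X g c p = (2 * sigma p) *: g c p.

Definition integral_curve (R : realType) (m : nat) (M : manifold R m)
    (X : vector_field M) (gamma : R -> M) (I : set R) : Prop :=
  [/\ is_interval I, open I, I !=set0 &
      forall t, I t -> {for t, continuous gamma} /\
        forall c, atlas c -> cdom c (gamma t) ->
          is_derive (t : R^o) 1 (c \o gamma : R^o -> 'rV[R]_m)
            (X c (gamma t))].

Definition maximal_integral_curve (R : realType) (m : nat) (M : manifold R m)
    (X : vector_field M) (gamma : R -> M) (I : set R) : Prop :=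
  integral_curve X gamma I /\
  forall (delta : R -> M) (J : set R),
    integral_curve X delta J -> I `<=` J ->
    (forall t, I t -> delta t = gamma t) -> J `<=` I.

Definition complete_field (R : realType) (m : nat) (M : manifold R m)
    (X : vector_field M) : Prop :=
  forall (gamma : R -> M) (I : set R),
    maximal_integral_curve X gamma I -> I = setT.

Definition no_observer_horizon (R : realType) (n : nat) (M : spacetime R n)
    : Prop :=
  forall (gamma : R -> M) (I : set R),
    timelike_curve gamma I -> inextendible gamma I ->
    chron_future (gamma @` I) = setT /\ chron_past (gamma @` I) = setT.

(* Main.v *)
From HB Require Import structures.
Require Import Defs.
From mathcomp Require Import all_boot all_order all_algebra.
From mathcomp Require Import all_classical all_reals all_analysis.
From mathcomp Require Import ring lra.

(* The flow phi of X preserves the chronological relation <<, and t |-> phi t p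
   is a timelike curve, so (say X is future-directed) p << phi t p for t > 0.
   For fixed p, the set of points x with x << phi t p for some t is then open,
   closed and nonempty, hence all of M; compactness of a Cauchy hypersurface S
   yields, for each point q, a T with q << phi T p for all p in S.  Every orbit
   meets S, so each point of an inextendible timelike curve gamma is
   phi t p with p in S; if t > T for one of them, then q << gamma.  Otherwise
   gamma ultimately stays in a causal diamond, which is compact; the diamonds
   between phi (-e) p and phi e p shrink to p, so gamma would converge to a
   cluster point p, contradicting inextendibility.

   That phi preserves << is obtained without differentiating phi in the initial
   point.  In a chart put v = b - a for two solutions a, b of x' = X x; then
   g_a(v, v) / g_a(X, X) is constant up to O(|v|^3), since by the conformal
   Killing equation numerator and denominator evolve with the same factor.  Hence
   nearby pairs of points with uniformly timelike coordinate difference keep this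
   property along the flow, and a curve all of whose nearby points are
   chronologically related has chronologically related endpoints. *)

Set Implicit Arguments.
Unset Strict Implicit.
Unset Printing Implicit Defensive.

Import Order.TTheory GRing.Theory Num.Theory.
Import numFieldNormedType.Exports.

Local Open Scope classical_set_scope.
Local Open Scope ring_scope.

(** * Calculus of maps with continuous partial derivatives *)

(** Smooth dependence of the flow on its initial point would reduce the preservation of << to a
    computation with differentials. Here solutions come with existence, uniqueness and a short-time
    Lipschitz bound only, so the image of a timelike curve under phi is not known to be smooth.
    Timelikeness of tangent vectors is therefore replaced by that of pairs of nearby points, which
    needs only coordinate differences. A margin k, measuring how far such a difference stays from
    the light cone, absorbs every error of third order in its length, whether it comes from the
    flow, from a change of chart or from the variation of the metric along a segment. The margin may
    shrink at each use, so the radii and times that must survive a continuation argument are fixed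
    before k is. The global part is purely order-theoretic: it rests on the openness of << and on
    the compactness of causal diamonds, with no limit curves. The causal relation is closed only
    inside diamonds, where compactness and the Hausdorff property give it. Orbits must also be shown
    inextendible before the Cauchy hypersurface can be applied to them; this again uses only the
    order and the flow. *)

Section Between.
Variable R : realType.

(** Unordered interval: flows run in both time directions, so estimates from 0 to a time of either
    sign are treated at once. *)
Definition between (a b t : R) := Num.min a b <= t <= Num.max a b.

Lemma between_left a b : between a b a.
Proof. by rewrite /between ge_min lexx le_max lexx. Qed.

Lemma between_right a b : between a b b.
Proof. by rewrite /between ge_min lexx le_max lexx !orbT. Qed.

Lemma between_sub a b c d t :
  between a b c -> between a b d -> between c d t -> between a b t.
Proof.
by rewrite /between; case: (leP a b) => _ /andP[? ?] /andP[? ?];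
  case: (leP c d) => _ /andP[? ?]; apply/andP; split; lra.
Qed.

Lemma between_dist_le a b t : between a b t -> `|t - a| <= `|b - a|.
Proof.
rewrite /between; case: (leP a b) => ab /andP[? ?].
  by rewrite !ger0_norm ?subr_ge0 // lerB.
by rewrite !ler0_norm ?subr_le0 ?lerN2 ?lerB // ltW.
Qed.

Lemma between_dist2_le a b s t : between a b s -> between a b t -> `|t - s| <= `|b - a|.
Proof.
rewrite /between; case: (leP a b) => ab /andP[? ?] /andP[? ?].
  by rewrite [leRHS]ger0_norm ?subr_ge0 // ler_norml; apply/andP; split; lra.
by rewrite [leRHS]ltr0_norm ?subr_lt0 // ler_norml; apply/andP; split; lra.
Qed.

Lemma between0_norm_le b t : between 0 b t -> `|t| <= `|b|.
Proof. by move=> /between_dist_le; rewrite !subr0. Qed.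

End Between.

Section Calculus.
Variable R : realType.

Lemma mx_norm_leP p q (A : 'M[R]_(p, q)) (e : R) : 0 <= e ->
  (`|A| <= e) <-> (forall i j, `|A i j| <= e).
Proof.
move=> e0; rewrite [`|A|]/Num.Def.normr/= mx_normrE; split=> [h i j|h].
  by apply: le_trans h; exact: (le_bigmax _ (fun ij => `|A ij.1 ij.2|) (i, j)).
by apply: bigmax_le => // -[i j] _; exact: h.
Qed.

Lemma mx_entry_le p q (A : 'M[R]_(p, q)) i j : `|A i j| <= `|A|.
Proof. by move: i j; apply/mx_norm_leP. Qed.

Lemma is_derive_mxP (V : normedModType R) p q (f : V -> 'M[R]_(p, q)) x v w :
  is_derive x v f w <->
  forall i j, is_derive x v (fun y => f y i j : R^o) (w i j).
Proof.
split=> [[df <-] i j|h].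
  have dfi := (derivable_mxP f x v).1 df.
  by split; [exact: dfi | rewrite derive_mx // mxE].
have df : derivable f x v by apply/derivable_mxP => i j; case: (h i j).
by split=> //; rewrite derive_mx //; apply/matrixP => i j; rewrite mxE derive_val.
Qed.

(** The norm is the largest entry, so the mean value theorem for each entry, with its own
    intermediate point, loses no constant. *)
Lemma mean_value_le p q (f f' : R -> 'M[R]_(p, q)) (w : 'M[R]_(p, q)) (a b e : R) :
  a <= b -> 0 <= e ->
  (forall t, t \in `[a, b] -> is_derive (t : R^o) 1 (f : R^o -> 'M[R]_(p, q)) (f' t)) ->
  (forall t, t \in `[a, b] -> `|f' t - w| <= e) ->
  `|f b - f a - (b - a) *: w| <= e * (b - a).
Proof.
move=> ab e0 df fw; apply/mx_norm_leP; first by rewrite mulr_ge0 // subr_ge0.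
move=> i j; pose g := (fun t => f t i j).
have dg t : t \in `[a, b] -> is_derive t 1 g (f' t i j).
  by move=> /df /is_derive_mxP; apply.
have dg' x : x \in `]a, b[ -> is_derive x 1 g (f' x i j).
  by move=> xab; apply: dg; exact: subset_itv_oo_cc xab.
have gc : {within `[a, b], continuous g}.
  apply: derivable_within_continuous => x xab.
  by have [] := dg x xab.
have [c cab E] := MVT_segment ab dg' gc.
rewrite !mxE -[f b i j]/(g b) -[f a i j]/(g a) E [(b - a) * _]mulrC -mulrBl normrM.
rewrite [`|b - a|]ger0_norm ?subr_ge0 // ler_wpM2r ?subr_ge0 //.
by apply: le_trans (fw _ cab); move: (mx_entry_le (f' c - w) i j); rewrite !mxE.
Qed.

Lemma mean_value_norm_le p q (f f' : R -> 'M[R]_(p, q)) (w : 'M[R]_(p, q)) (a b e : R) :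
  0 <= e ->
  (forall t, between a b t ->
    is_derive (t : R^o) 1 (f : R^o -> 'M[R]_(p, q)) (f' t) /\ `|f' t - w| <= e) ->
  `|f b - f a - (b - a) *: w| <= e * `|b - a|.
Proof.
rewrite /between => e0; case: (leP a b) => [ab|/ltW ba] h.
  rewrite ger0_norm ?subr_ge0 //.
  by apply: (@mean_value_le _ _ f f') => // t; rewrite in_itv /= => /h [].
rewrite [`|b - a|]ler0_norm ?subr_le0 // opprB -normrN.
have -> : - (f b - f a - (b - a) *: w) = f a - f b - (a - b) *: w.
  by apply/matrixP => i j; rewrite !mxE; ring.
by apply: (@mean_value_le _ _ f f') => // t; rewrite in_itv /= => /h [].
Qed.

Lemma derivable_line (V W : normedModType R) (f : V -> W) (a v : V) (s : R) :
  derivable f (a + s *: v) v ->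
  is_derive (s : R^o) 1 ((fun t => f (a + t *: v)) : R^o -> W) ('D_v f (a + s *: v)).
Proof.
move=> df.
have E : (fun h : R => h^-1 *: (((fun t : R^o => f (a + t *: v)) \o shift s) (h *: 1) -
     f (a + s *: v))) =
   (fun h : R => h^-1 *: ((f \o shift (a + s *: v)) (h *: v) - f (a + s *: v))).
  apply/funext => h /=; congr (_ *: (f _ - _)).
  by rewrite [h *: 1]mulr1 scalerDl addrCA.
by split; [rewrite /derivable E | rewrite /derive E].
Qed.

Lemma differentiable_of_le (V W : normedModType R) (f : V -> W) (L : {linear V -> W}) x :
  continuous L ->
  (forall e, 0 < e -> \forall v \near (0 : V), `|f (x + v) - f x - L v| <= e * `|v|) ->
  differentiable f x /\ 'd f x = L :> (V -> W).
Proof.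
move=> Lc h.
have E : f \o shift x = cst (f x) + L +o_ 0 id.
  apply/eqaddoP => e e0; near=> v.
  rewrite /= /cst/= !fctE opprD addrA [v + x]addrC.
  by near: v; exact: h.
have D := diff_unique Lc E.
split=> //; apply/diff_locallyP; split; first by rewrite D.
by rewrite D.
Unshelve. all: by end_near. Qed.

Lemma continuous_near_le (T : topologicalType) (W : normedModType R) (f : T -> W) x e :
  0 < e -> {for x, continuous f} -> \forall y \near x, `|f y - f x| <= e.
Proof.
move=> e0 /cvgrPdist_le /(_ _ e0); apply: filterS => y.
by rewrite distrC.
Qed.

Lemma Ck_onS (V W : normedModType R) k (U : set V) (f : V -> W) :
  Ck_on k.+1 U f -> Ck_on k U f.
Proof.
elim: k f => [|k IH] f [cf df]; split=> // v.
by have [dfv /IH Cf] := df v; split.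
Qed.

Lemma Ck_on1_differentiable m p q (U : set 'rV[R]_m) (f : 'rV[R]_m -> 'M[R]_(p, q)) x :
  open U -> Ck_on 1 U f -> U x ->
  differentiable f x /\
  forall v, 'D_v f x = \sum_i v 0 i *: 'D_(delta_mx 0 i) f x.
Proof.
move=> Uo [_ Df] Ux.
pose L0 (v : 'rV[R]_m) := \sum_i v 0 i *: 'D_(delta_mx 0 i) f x.
have L0lin : linear L0.
  move=> c u v; rewrite /L0 scaler_sumr -big_split /=; apply: eq_bigr => i _.
  by rewrite !mxE scalerDl scalerA.
pose L0L := GRing.isLinear.Build _ _ _ _ _ L0lin.
pose L : {linear 'rV[R]_m -> 'M[R]_(p, q)} := HB.pack L0 L0L.
have Lc : continuous L0.
  apply: continuous_big => [|i _]; first exact: add_continuous.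
  move=> v.
  have c : (fun w : 'rV[R]_m => w 0 i : R) w @[w --> v] --> (v 0 i : R).
    exact: (@coord_continuous R 1 m 0 i v).
  exact: (@cvgZr_tmp _ _ _ _ _ _ _ ('D_(delta_mx 0 i) f x) c).
suff [dfx E] : differentiable f x /\ 'd f x = L :> (_ -> _).
  by split=> // v; rewrite deriveE // E.
apply: differentiable_of_le => // e e0.
pose e' := e / m.+1%:R.
have e'0 : 0 < e' by rewrite divr_gt0 // ltr0n.
have near_i i : \forall y \near x, `|'D_(delta_mx 0 i) f y - 'D_(delta_mx 0 i) f x| <= e'.
  have [_ [cD _]] := Df (delta_mx 0 i).
  exact: (continuous_near_le e'0 (cD _ Ux)).
have : \forall y \near x, U y /\
    forall i, `|'D_(delta_mx 0 i) f y - 'D_(delta_mx 0 i) f x| <= e'.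
  apply: filterI; first exact: open_nbhs_nbhs.
  exact: filter_forall near_i.
move=> /nbhs_normP[r /= r0 rP].
apply/nbhs_normP; exists r => // v; rewrite /ball_ /= sub0r normrN => vr.
(* [w k] keeps the first k coordinates of v. The resulting broken line stays in the ball, which is a
   cube for this norm. *)
pose w (k : nat) : 'rV[R]_m := \row_i (if (i < k)%N then v 0 i else 0).
have wS (k : 'I_m) : w k.+1 = w k + v 0 k *: delta_mx 0 k.
  apply/rowP => i; rewrite !mxE eqxx /= ltnS leq_eqVlt.
  have [->|ik] := eqVneq i k; first by rewrite eqxx ltnn add0r mulr1.
  by rewrite (negbTE (ik : (i : nat) != k)) mulr0 addr0.
have w0 : w 0%N = 0 by apply/rowP => i; rewrite !mxE.
have wm : w m = v by apply/rowP => i; rewrite !mxE ltn_ord.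
have tel : f (x + v) - f x = \sum_(k < m) (f (x + w k.+1) - f (x + w k)).
  rewrite -(big_mkord xpredT (fun k => f (x + w k.+1) - f (x + w k))).
  by rewrite (telescope_sumr (fun k => f (x + w k))) // w0 wm addr0.
rewrite tel /L /= /L0 -sumrB.
apply: le_trans (ler_norm_sum _ _ _) _.
apply: (@le_trans _ _ (\sum_(k < m) e' * `|v|)); last first.
  rewrite sumr_const card_ord -mulr_natl mulrA ler_wpM2r //.
  rewrite /e' mulrCA -[leRHS]mulr1 ler_wpM2l ?ltW // ltr_pdivrMr ?ltr0n //.
  by rewrite mul1r ltr_nat.
apply: ler_sum => k _.
pose g (s : R) := f (x + w k + s *: delta_mx 0 k).
have g1 : g (v 0 k) = f (x + w k.+1) by rewrite /g wS addrA.
have g0 : g 0 = f (x + w k) by rewrite /g scale0r addr0.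
rewrite -g1 -g0.
have -> : v 0 k *: 'D_(delta_mx 0 k) f x = (v 0 k - 0) *: 'D_(delta_mx 0 k) f x.
  by rewrite subr0.
apply: (@le_trans _ _ (e' * `|v 0 k - 0|)); last first.
  rewrite subr0; apply: ler_wpM2l; [exact: ltW | exact: mx_entry_le].
apply: (@mean_value_norm_le _ _ g
  (fun s => 'D_(delta_mx 0 k) f (x + w k + s *: delta_mx 0 k))); first exact: ltW.
move=> t tv.
have [] : U (x + w k + t *: delta_mx 0 k) /\ forall i,
   `|'D_(delta_mx 0 i) f (x + w k + t *: delta_mx 0 k) - 'D_(delta_mx 0 i) f x| <= e'.
  apply: rP; rewrite /ball_ /= -addrA opprD addNKr normrN.
  apply: le_lt_trans vr; apply/mx_norm_leP => // i j.
  rewrite !mxE; have [jk|] := eqVneq j k.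
    rewrite jk ltnn add0r andbT ord1 eqxx mulr1.
    apply: le_trans (mx_entry_le v 0 k).
    exact: between0_norm_le tv.
  rewrite andbF mulr0 addr0 => _; case: ifP => _; last by rewrite normr0.
  exact: mx_entry_le.
move=> Uy /(_ k) le; split; last exact: le.
apply: derivable_line.
by have [dU _] := Df (delta_mx 0 k); exact: dU.
Qed.

Lemma segment_mean_value_le m p q (f : 'rV[R]_m -> 'M[R]_(p, q)) a b w e : 0 <= e ->
  (forall s, 0 <= s <= 1 -> derivable f (a + s *: (b - a)) (b - a) /\
    `|'D_(b - a) f (a + s *: (b - a)) - w| <= e) ->
  `|f b - f a - w| <= e.
Proof.
move=> e0 h; pose g (s : R) := f (a + s *: (b - a)).
have g1 : g 1 = f b by rewrite /g scale1r addrC subrK.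
have g0 : g 0 = f a by rewrite /g scale0r addr0.
have H t : between 0 1 t ->
    is_derive (t : R^o) 1 (g : R^o -> 'M[R]_(p, q)) ('D_(b - a) f (a + t *: (b - a)))
    /\ `|'D_(b - a) f (a + t *: (b - a)) - w| <= e.
  rewrite /between (min_l ler01) (max_r ler01) => /h [df le]; split; last exact: le.
  exact: derivable_line.
have := mean_value_norm_le e0 H.
by rewrite g1 g0 subr0 scale1r normr1 mulr1.
Qed.

Lemma segment_in_ball (V : normedModType R) (x a b : V) r s :
  `|a - x| < r -> `|b - x| < r -> 0 <= s <= 1 -> `|a + s *: (b - a) - x| < r.
Proof.
move=> ax bx /andP[s0 s1].
have -> : a + s *: (b - a) - x = (1 - s) *: (a - x) + s *: (b - x).
  rewrite scalerBl scale1r -[RHS]addrA -scalerN -scalerDr opprB [x - a + _]addrC.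
  by rewrite [b - x + _]addrA subrK addrAC.
apply: le_lt_trans (ler_normD _ _) _.
rewrite !normrZ (ger0_norm s0) ger0_norm ?subr_ge0 //.
have [-> | sn] := eqVneq s 0; first by rewrite subr0 mul1r mul0r addr0.
have sp : 0 < s by rewrite lt_neqAle eq_sym sn.
have : s * `|b - x| < s * r by rewrite ltr_pM2l.
have : (1 - s) * `|a - x| <= (1 - s) * r by rewrite ler_wpM2l ?subr_ge0 // ltW.
by move=> h1 h2; lra.
Qed.

Lemma Ck_on1_bounds m p q (U : set 'rV[R]_m) (f : 'rV[R]_m -> 'M[R]_(p, q)) x :
  open U -> Ck_on 1 U f -> U x ->
  exists r C, [/\ 0 < r, 0 <= C, forall a, `|a - x| < r -> U a &
   forall a b, `|a - x| < r -> `|b - x| < r ->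
    [/\ `|f a| <= C, forall v, `|'D_v f a| <= C * `|v| &
        `|f b - f a| <= C * `|b - a|]].
Proof.
move=> Uo C1 Ux; have [cf Df] := C1.
have near_i i : \forall y \near x, `|'D_(delta_mx 0 i) f y - 'D_(delta_mx 0 i) f x| <= 1.
  have [_ [cD _]] := Df (delta_mx 0 i).
  exact: (continuous_near_le ltr01 (cD _ Ux)).
have : \forall y \near x, U y /\ (`|f y - f x| <= 1 /\
    forall i, `|'D_(delta_mx 0 i) f y - 'D_(delta_mx 0 i) f x| <= 1).
  apply: filterI; first exact: open_nbhs_nbhs.
  apply: filterI; first exact: (continuous_near_le ltr01 (cf _ Ux)).
  exact: filter_forall near_i.
move=> /nbhs_normP[r /= r0 rP].
pose B i := `|'D_(delta_mx 0 i) f x| + 1.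
have B0 i : 0 <= B i by rewrite addr_ge0.
pose C := \sum_i B i.
have C0 : 0 <= C by apply: sumr_ge0.
have inr y : `|y - x| < r -> [/\ U y, `|f y| <= `|f x| + 1 &
    forall v, `|'D_v f y| <= C * `|v|].
  move=> yr; have [|Uy [fy hy]] := rP y; first by rewrite /ball_ /= distrC.
  split=> //; first by rewrite -lerBlDl; apply: le_trans fy; exact: lerB_dist.
  move=> v; have [_ ->] := Ck_on1_differentiable Uo C1 Uy.
  apply: le_trans (ler_norm_sum _ _ _) _.
  rewrite mulr_suml; apply: ler_sum => i _.
  rewrite normrZ mulrC; apply: ler_pM => //; last exact: mx_entry_le.
  by rewrite -lerBlDl; apply: le_trans (hy i); exact: lerB_dist.
exists r, (C + (`|f x| + 1)); split => //.
- by rewrite !addr_ge0.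
- by move=> a /inr [].
move=> a b ar br; have [Ua fa Da] := inr a ar; split.
- by apply: le_trans fa _; rewrite lerDr.
- by move=> v; apply: le_trans (Da v) _; rewrite ler_wpM2r // lerDl addr_ge0.
apply: (@le_trans _ _ (C * `|b - a|)); last by rewrite ler_wpM2r // lerDl addr_ge0.
rewrite -[f b - f a]subr0; apply: segment_mean_value_le.
  by rewrite mulr_ge0.
move=> s s01; have [Uy _ Dy] := inr _ (segment_in_ball ar br s01).
rewrite subr0; split => //.
by have [dU _] := Df (b - a); exact: dU.
Qed.

(** The last bound is Taylor's formula: the partial derivatives are Lipschitz by [Ck_on1_bounds], so
    along the segment the derivative in direction b - a moves by O(|b - a|^2). *)
Lemma Ck_on2_bounds m p q (U : set 'rV[R]_m) (f : 'rV[R]_m -> 'M[R]_(p, q)) x :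
  open U -> Ck_on 2 U f -> U x ->
  exists r C, [/\ 0 < r, 0 <= C, forall a, `|a - x| < r -> U a &
   forall a b, `|a - x| < r -> `|b - x| < r ->
    [/\ `|f a| <= C, forall v, `|'D_v f a| <= C * `|v|,
        `|f b - f a| <= C * `|b - a| &
        `|f b - f a - 'D_(b - a) f a| <= C * `|b - a| ^+ 2]].
Proof.
move=> Uo C2 Ux.
have [r [C [r0 C0 rU rP]]] := Ck_on1_bounds Uo (Ck_onS C2) Ux.
have near_i i : \forall rC \near (0 : R)^'+, exists D, [/\ 0 <= D & forall a b,
   `|a - x| < rC -> `|b - x| < rC ->
   `|'D_(delta_mx 0 i) f b - 'D_(delta_mx 0 i) f a| <= D * `|b - a|].
  have [_ C1] := C2.2 (delta_mx 0 i).
  have [ri [Ci [ri0 Ci0 _ rPi]]] := Ck_on1_bounds Uo C1 Ux.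
  near=> e; have eri : e < ri by near: e; exact: nbhs_right_lt.
  exists Ci; split=> // a b ax bx.
  by have [||_ _ ->] := rPi a b; rewrite // ?(lt_trans ax) ?(lt_trans bx).
have : \forall e \near (0 : R)^'+, e < r /\ (0 < e /\ forall i, exists D, [/\ 0 <= D & forall a b,
   `|a - x| < e -> `|b - x| < e ->
   `|'D_(delta_mx 0 i) f b - 'D_(delta_mx 0 i) f a| <= D * `|b - a|]).
  apply: filterI; first exact: nbhs_right_lt.
  apply: filterI; first exact: nbhs_right_gt.
  exact: filter_forall near_i.
move=> /filter_ex [e [er [e0 /choice [D DP]]]].
pose S := \sum_i D i.
have S0 : 0 <= S by apply: sumr_ge0 => i _; case: (DP i).
exists e, (C + S); split=> //.
- by rewrite addr_ge0.
- by move=> a ae; apply: rU; exact: lt_trans er.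
move=> a b ae be.
have [||fa Da fab] := rP a b; [exact: lt_trans er|exact: lt_trans er|].
split.
- by apply: le_trans fa _; rewrite lerDl.
- by move=> v; apply: le_trans (Da v) _; rewrite ler_wpM2r // lerDl.
- by apply: le_trans fab _; rewrite ler_wpM2r // lerDl.
apply: (@le_trans _ _ (S * `|b - a| ^+ 2)); last by rewrite ler_wpM2r ?exprn_ge0 // lerDr.
apply: segment_mean_value_le; first by rewrite mulr_ge0 ?exprn_ge0.
move=> s s01; have sE := segment_in_ball ae be s01.
have Uy : U (a + s *: (b - a)) by apply: rU; exact: lt_trans er.
have Ua : U a by apply: rU; exact: lt_trans er.
split; first by have [dU _] := C2.2 (b - a); exact: dU.
have [_ ->] := Ck_on1_differentiable Uo (Ck_onS C2) Uy.
have [_ ->] := Ck_on1_differentiable Uo (Ck_onS C2) Ua.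
rewrite -sumrB; apply: le_trans (ler_norm_sum _ _ _) _.
rewrite /S mulr_suml; apply: ler_sum => i _.
rewrite -scalerBr normrZ expr2 mulrA mulrC; apply: ler_pM => //; last exact: mx_entry_le.
have [D0 DP'] := DP i; apply: le_trans (DP' _ _ ae sE) _.
rewrite ler_wpM2l // addrC addKr normrZ; case/andP: s01 => s0 s1.
by rewrite ger0_norm // ler_piMl.
Unshelve. all: by end_near. Qed.

End Calculus.

(** * Existence of solutions of ordinary differential equations *)

Section Picard.
Variable R : realType.

Lemma is_derive_epsP (W : normedModType R) (f : R -> W) (t : R) (w : W) :
  is_derive (t : R^o) 1 (f : R^o -> W) w <->
  forall e, 0 < e -> \forall h \near (0 : R), `|f (t + h) - f t - h *: w| <= e * `|h|.
Proof.
have E (h : R) : f (h *: (1 : R^o) + t) = f (t + h) by rewrite [_ *: _]mulr1 addrC.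
split=> [[df dE] e e0|H].
  have : (fun h : R => h^-1 *: (f (t + h) - f t)) @ 0^' --> w.
    rewrite -dE; move: df; rewrite /derivable /derive /=.
    by under eq_fun do rewrite E.
  move=> /cvgrPdist_le /(_ _ e0); rewrite near_withinE.
  apply: filterS => h /= H; have [->|h0] := eqVneq h 0.
    by rewrite addr0 subrr sub0r scale0r oppr0 !normr0 mulr0.
  have := H h0; rewrite -(ler_pM2r (_ : 0 < `|h|)) ?normr_gt0 //.
  rewrite mulrC -normrZ scalerBr scalerA divff // scale1r.
  by rewrite -[X in X <= _ -> _]normrN opprB.
have C : (fun h : R => h^-1 *: (f (t + h) - f t)) @ 0^' --> w.
  apply/cvgrPdist_le => e e0; rewrite near_withinE.
  apply: filterS (H _ e0) => h /= He h0.
  rewrite -(ler_pM2r (_ : 0 < `|h|)) ?normr_gt0 //.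
  rewrite mulrC -normrZ scalerBr scalerA divff // scale1r.
  by rewrite -[X in X <= _]normrN opprB.
have C' : (fun h : R => h^-1 *: (((f : R^o -> W) \o shift (t : R^o)) (h *: (1 : R^o)) - f t))
     @ 0^' --> w.
  by under eq_fun do rewrite /= E.
by split; [apply: cvgP C' | apply: cvg_lim C'].
Qed.

Lemma is_derive_quadratic (W : normedModType R) (f : R -> W) (t : R) (w : W) d K :
  0 < d -> (forall h, `|h| < d -> `|f (t + h) - f t - h *: w| <= K * `|h| ^+ 2) ->
  is_derive (t : R^o) 1 (f : R^o -> W) w.
Proof.
move=> d0 H; apply/is_derive_epsP => e e0.
have K1 : 0 < `|K| + 1 by rewrite ltr_wpDl.
apply/nbhs_normP; exists (Num.min d (e / (`|K| + 1))).
  by rewrite /= lt_min d0 divr_gt0.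
move=> h; rewrite /ball_ /= sub0r normrN lt_min => /andP[hd he].
apply: le_trans (H h hd) _; rewrite expr2 mulrA ler_wpM2r //.
apply: (@le_trans _ _ ((`|K| + 1) * `|h|)).
  by rewrite ler_wpM2r // (le_trans (ler_norm K)) // lerDl.
by rewrite mulrC -ler_pdivlMr // ltW.
Qed.

Lemma antiderivative (f : R -> R) (T : R) : 0 < T -> continuous f ->
  exists F : R -> R, F 0 = 0 /\
    forall t : R, `|t| < T -> is_derive (t : R^o) 1 (F : R^o -> R^o) (f t).
Proof.
move=> T0 cf.
(* Integrating from - T and subtracting [F0 0] makes every t with |t| < T an interior point, as the
   fundamental theorem requires. *)
pose F0 x := (\int[@lebesgue_measure R]_(t in [set` Interval (BLeft (- T)) (BRight x)]) f t)%R.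
exists (fun x => F0 x - F0 0); split; first by rewrite subrr.
move=> t; rewrite ltr_norml => /andP[t1 t2].
have fi : (@lebesgue_measure R).-integrable [set` Interval (BLeft (- T)) (BRight T)] (EFin \o f).
  apply: continuous_compact_integrable; first exact: segment_compact.
  exact: continuous_subspaceT.
have := @continuous_FTC1 R f (BLeft (- T)) t T t2 fi.
case=> [||dF FE]. by rewrite lte_fin.
  exact: cf.
rewrite -[f t]subr0.
apply: (@is_deriveB R R^o R^o F0 (cst (F0 0)) t 1 (f t) 0).
by split; [exact: dF | rewrite -FE derive1E].
Qed.

Lemma antiderivative_mx p q (f : R -> 'M[R]_(p, q)) (T : R) : 0 < T -> continuous f ->
  exists F : R -> 'M[R]_(p, q), F 0 = 0 /\
    forall t : R, `|t| < T -> is_derive (t : R^o) 1 (F : R^o -> 'M[R]_(p, q)) (f t).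
Proof.
move=> T0 cf.
have cfi (ij : 'I_p * 'I_q) : continuous (fun t => f t ij.1 ij.2).
  move=> t; apply: (@continuous_comp _ _ _ f (fun A : 'M[R]_(p, q) => A ij.1 ij.2)).
    exact: cf.
  exact: coord_continuous.
have /choice [F FP] := fun ij => antiderivative T0 (cfi ij).
exists (fun t => \matrix_(i, j) F (i, j) t); split.
  by apply/matrixP => i j; rewrite !mxE (FP (i, j)).1.
move=> t tT; apply/is_derive_mxP => i j.
by have := (FP (i, j)).2 t tT; under [X in is_derive _ _ X _ -> _]eq_fun do [];
   under [X in _ -> is_derive _ _ X _]eq_fun do rewrite mxE.
Qed.

Lemma is_derive_continuous (W : normedModType R) (f : R -> W) (t : R) (w : W) :
  is_derive (t : R^o) 1 (f : R^o -> W) w -> {for t, continuous f}.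
Proof.
move=> [df _]; apply: differentiable_continuous.
exact/derivable1_diffP.
Qed.

Section PicardIteration.
Variables (m : nat) (X : 'rV[R]_m -> 'rV[R]_m) (z0 x0 : 'rV[R]_m) (r C tau : R).
Hypotheses (r0 : 0 < r) (C0 : 0 <= C) (tau0 : 0 < tau).
Hypothesis Xc : forall a, `|a - z0| < r -> {for a, continuous X}.
Hypothesis XC : forall a b, `|a - z0| < r -> `|b - z0| < r ->
  `|X a| <= C /\ `|X b - X a| <= C * `|b - a|.
Hypotheses (tauC : tau * C <= r / 2) (tauC2 : tau * C <= 1 / 2).
Hypothesis x0z : `|x0 - z0| < r / 2.

(* The iterates are controlled on [-tau, tau] only; clamping the time makes the
   integrands continuous on the whole line. *)
Let clamp (t : R) := Num.max (- tau) (Num.min tau t).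

Let clamp_le t : `|clamp t| <= tau.
Proof.
rewrite ler_norml /clamp le_max lexx /= ge_max ge_min lexx /= andbT.
by rewrite (le_trans _ (ltW tau0)) // oppr_le0 ltW.
Qed.

Let clamp_id t : `|t| <= tau -> clamp t = t.
Proof.
rewrite ler_norml /clamp => /andP[t1 t2].
by rewrite min_r // max_r.
Qed.

Let clamp_continuous : continuous clamp.
Proof.
move=> t.
have c1 : {for t, continuous ((cst tau : R -> R^o) \min (id : R -> R^o))}.
  by apply: continuous_min; [exact: cst_continuous | exact: cvg_id].
have c2 : {for t, continuous ((cst (- tau) : R -> R^o) \max
    ((cst tau : R -> R^o) \min (id : R -> R^o)))}.
  by apply: continuous_max; [exact: cst_continuous | exact: c1].
exact: c2.
Qed.

Let good (y : R -> 'rV[R]_m) := forall t, `|t| <= tau ->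
  `|y t - z0| < r /\ {for t, continuous y}.

Let near_x0 y : `|y - x0| <= r / 2 -> `|y - z0| < r.
Proof.
move=> h; rewrite -(subrKA x0); apply: le_lt_trans (ler_normD _ _) _.
rewrite [ltRHS]splitr; exact: ler_ltD.
Qed.

Let next_ex (y : {y | good y}) : exists y' : {y | good y}, sval y' 0 = x0 /\
  forall t : R, `|t| < tau + 1 ->
    is_derive (t : R^o) 1 (sval y' : R^o -> _) (X (sval y (clamp t))).
Proof.
case: y => y gy /=.
have cX : continuous (fun t => X (y (clamp t))).
  move=> t; have [yr yc] := gy _ (clamp_le t).
  apply: (@continuous_comp _ _ _ (fun t => y (clamp t)) X); last exact: Xc.
  apply: (@continuous_comp _ _ _ clamp y) => //.
  exact: clamp_continuous.
(* Margin 1: derivatives are needed on the closed interval [-tau, tau], while an antiderivative has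
   them on an open one. *)
have T0 : 0 < tau + 1 by rewrite addr_gt0.
have [F [F0 dF]] := antiderivative_mx T0 cX.
pose y' t := x0 + F t.
have y'0 : y' 0 = x0 by rewrite /y' F0 addr0.
have dy' (t : R) : `|t| < tau + 1 -> is_derive (t : R^o) 1 (y' : R^o -> _) (X (y (clamp t))).
  move=> /dF dFt; rewrite -[X _]add0r.
  by apply: (@is_deriveD R R^o _ (cst x0) F t 1 0).
have gy' : good y'.
  move=> t tt; have tt1 : `|t| < tau + 1 by apply: le_lt_trans tt _; rewrite ltrDl.
  split; last exact: is_derive_continuous (dy' t tt1).
  apply: near_x0.
  have H s : between 0 t s ->
    is_derive (s : R^o) 1 (y' : R^o -> 'rV[R]_m) (X (y (clamp s))) /\
    `|X (y (clamp s)) - 0| <= C.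
    move=> st; split.
      by apply: dy'; apply: le_lt_trans tt1; exact: between0_norm_le.
    have [yr _] := gy _ (clamp_le s); rewrite subr0.
    by have [] := XC yr yr.
  have := mean_value_norm_le C0 H.
  rewrite scaler0 !subr0 y'0 => h; apply: le_trans h _; apply: le_trans tauC.
  by rewrite mulrC ler_wpM2r.
by exists (exist _ y' gy').
Qed.

(** Transparent, since later proofs reduce [Y 0] to the constant x0. *)
Let y_init : {y | good y}.
Proof.
exists (fun=> x0) => t _; split; first by apply: near_x0; rewrite subrr normr0 divr_ge0 // ltW.
exact: cst_continuous.
Defined.

Let next y := sval (cid (next_ex y)).
Let Y k : R -> 'rV[R]_m := sval (iter k next y_init).

Let Y_good k : good (Y k).
Proof. exact: (svalP (iter k next y_init)). Qed.

Let YS0 k : Y k.+1 0 = x0.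
Proof. by have [] := svalP (cid (next_ex (iter k next y_init))). Qed.

Let dYS k (t : R) : `|t| <= tau ->
  is_derive (t : R^o) 1 (Y k.+1 : R^o -> _) (X (Y k t)).
Proof.
move=> tt; have [_ H] := svalP (cid (next_ex (iter k next y_init))).
rewrite -{2}(clamp_id tt); apply: H.
by apply: le_lt_trans tt _; rewrite ltrDl.
Qed.

(** Two points of the ball are less than 2 r apart, and each iteration halves the distance because
    tau * C <= 1 / 2. *)
Let Y_diff k t : `|t| <= tau -> `|Y k.+1 t - Y k t| <= 2 * r / 2 ^+ k.
Proof.
elim: k t => [|k IH] t tt.
  rewrite expr0 divr1 -(subrKA z0); apply: le_trans (ler_normD _ _) _.
  have [h1 _] := Y_good 1 tt; have [h2 _] := Y_good 0 tt.
  rewrite (distrC z0); lra.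
have H s : between 0 t s ->
    is_derive (s : R^o) 1 ((Y k.+2 - Y k.+1) : R^o -> 'rV[R]_m) (X (Y k.+1 s) - X (Y k s)) /\
    `|(X (Y k.+1 s) - X (Y k s)) - 0| <= C * (2 * r / 2 ^+ k).
  move=> /between0_norm_le /le_trans /(_ tt) ss; split.
    by apply: is_deriveB; exact: dYS.
  have [h1 _] := Y_good k.+1 ss; have [h2 _] := Y_good k ss.
  rewrite subr0; have [_ h] := XC h2 h1; apply: le_trans h _.
  by rewrite ler_wpM2l // IH.
have P : 0 <= 2 * r / 2 ^+ k by rewrite divr_ge0 ?exprn_ge0 // mulr_ge0 // ltW.
have := mean_value_norm_le (mulr_ge0 C0 P) H.
rewrite /= !fctE !YS0 subrr !subr0 scaler0 subr0 => h; apply: le_trans h _.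
have -> : 2 * r / 2 ^+ k.+1 = (2 * r / 2 ^+ k) / 2.
  by rewrite exprSr invfM mulrA.
have tC : `|t| * C <= 1 / 2 by apply: le_trans tauC2; rewrite ler_wpM2r.
rewrite mulrAC [C * _]mulrC [leRHS]mulrC -[2^-1]mul1r; exact: ler_wpM2r.
Qed.

(** Sum of the bounds of [Y_diff] from rank k on. *)
Let bnd k := 4 * r / 2 ^+ k.

Let Y_cauchy k i t : `|t| <= tau -> `|Y (k + i) t - Y k t| <= bnd k.
Proof.
move=> tt.
(* The factor turns the bound into the exact partial geometric sum, so that the induction on i
   closes. *)
suff : `|Y (k + i) t - Y k t| <= bnd k * (1 - 2 ^- i).
  move=> h; apply: le_trans h _; rewrite ler_piMr ?gerBl ?invr_ge0 ?exprn_ge0 //.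
  by rewrite divr_ge0 ?exprn_ge0 // mulr_ge0 // ltW.
elim: i => [|i IH].
  by rewrite addn0 subrr normr0 expr0 invr1 subrr mulr0.
rewrite addnS -(subrKA (Y (k + i) t)); apply: le_trans (ler_normD _ _) _.
apply: le_trans (lerD (Y_diff _ tt) IH) _.
rewrite /bnd exprD exprS !invfM.
set a := (2 ^+ k)^-1; set b := (2 ^+ i)^-1.
by rewrite le_eqVlt; apply/orP; left; apply/eqP; field.
Qed.

Let bndS k : bnd k.+1 <= bnd k.
Proof.
have -> : bnd k.+1 = bnd k / 2 by rewrite /bnd exprSr invfM mulrA.
have : 0 <= bnd k by rewrite divr_ge0 ?exprn_ge0 // mulr_ge0 // ltW.
lra.
Qed.

Let bnd_small e : 0 < e -> exists k, bnd k <= e.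
Proof.
move=> e0; have [k hk] : exists k, 4 * r / e < k%:R.
  exists (Num.bound (4 * r / e)); apply: archi_boundP.
  by rewrite divr_ge0 ?mulr_ge0 // ltW.
exists k; rewrite /bnd ler_pdivrMr ?exprn_gt0 // [e * _]mulrC -ler_pdivrMr //.
apply: le_trans (ltW hk) _; rewrite -natrX ler_nat.
by apply: ltnW; exact: ltn_expl.
Qed.

Let limit_ex t : `|t| <= tau -> exists y, forall k, `|y - Y k t| <= bnd k.
Proof.
move=> tt.
have cau : cauchy ((fun k => Y k t) @ \oo).
  apply/cauchy_ballP => e e0.
  have [k hk] := bnd_small (divr_gt0 e0 (ltr0n R 4 : 0 < 4)).
  near_simpl; near=> i j => /=.
  have ki : (k <= i)%N by near: i; exact: nbhs_infty_ge.
  have kj : (k <= j)%N by near: j; exact: nbhs_infty_ge.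
  have hi := Y_cauchy k (i - k) tt; have hj := Y_cauchy k (j - k) tt.
  rewrite !subnKC // in hi hj.
  rewrite -ball_normE /ball_ /= -(subrKA (Y k t)).
  apply: le_lt_trans (ler_normD _ _) _; rewrite (distrC (Y k t)).
  apply: (@le_lt_trans _ _ (e / 4 + e / 4)); last by lra.
  by apply: lerD; [exact: le_trans hk | exact: le_trans hk].
have cv : cvg ((fun k => Y k t) @ \oo) by apply/cauchy_cvgP.
exists (lim ((fun k => Y k t) @ \oo)) => k.
apply/ler_addgt0Pr => e e0.
have /cvgrPdist_le /(_ _ e0) [N _ hN] := cv.
have h1 : `|lim ((fun k => Y k t) @ \oo) - Y (k + N) t| <= e by apply: hN; rewrite /= leq_addl.
rewrite -(subrKA (Y (k + N) t)) addrC; apply: le_trans (ler_normD _ _) _.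
by rewrite lerD // Y_cauchy.
Unshelve. all: by end_near. Qed.

Let norm_between t s u : `|t| <= tau -> `|s| <= tau -> between t s u -> `|u| <= tau.
Proof.
rewrite !ler_norml /between => /andP[? ?] /andP[? ?].
by case: (leP t s) => _ /andP[? ?]; apply/andP; split; lra.
Qed.

Let Y_lip k t s : `|t| <= tau -> `|s| <= tau -> `|Y k s - Y k t| <= C * `|s - t|.
Proof.
move=> tt ss; case: k => [|k]; first by rewrite subrr normr0 mulr_ge0.
have H u : between t s u ->
    is_derive (u : R^o) 1 (Y k.+1 : R^o -> 'rV[R]_m) (X (Y k u)) /\
    `|X (Y k u) - 0| <= C.
  move=> tus; have uu := norm_between tt ss tus.
  split; first exact: dYS.
  have [h _] := Y_good k uu; rewrite subr0.
  by have [] := XC h h.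
by have := mean_value_norm_le C0 H; rewrite scaler0 subr0.
Qed.

(** Uniform in k, so the estimate passes to the limit and gives its derivative through
    [is_derive_quadratic], without exchanging a limit and an integral. *)
Let Y_quad k t s : `|t| <= tau -> `|s| <= tau ->
  `|Y k.+1 s - Y k.+1 t - (s - t) *: X (Y k t)| <= C * C * `|s - t| ^+ 2.
Proof.
move=> tt ss.
have e0 : 0 <= C * (C * `|s - t|) by rewrite !mulr_ge0.
have H u : between t s u ->
    is_derive (u : R^o) 1 (Y k.+1 : R^o -> 'rV[R]_m) (X (Y k u)) /\
    `|X (Y k u) - X (Y k t)| <= C * (C * `|s - t|).
  move=> tus; have uu := norm_between tt ss tus.
  split; first exact: dYS.
  have [h _] := Y_good k uu; have [h' _] := Y_good k tt.
  have [_ le] := XC h' h; apply: le_trans le _.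
  rewrite ler_wpM2l //; apply: le_trans (Y_lip k tt uu) _; rewrite ler_wpM2l //.
  exact: between_dist_le.
have := mean_value_norm_le e0 H => h; apply: le_trans h _.
by rewrite expr2 !mulrA.
Qed.

Lemma picard_solution : exists y : R -> 'rV[R]_m, y 0 = x0 /\
  forall t, `|t| < tau -> `|y t - z0| < r /\
    is_derive (t : R^o) 1 (y : R^o -> 'rV[R]_m) (X (y t)).
Proof.
have ex t : exists y, `|t| <= tau -> forall k, `|y - Y k t| <= bnd k.
  have [tt|tt] := pselect (`|t| <= tau); last by exists 0.
  by have [y hy] := limit_ex tt; exists y.
have [y yP] := choice ex.
have bnd0 (a b : 'rV[R]_m) (K c : R) : 0 <= K -> (forall k, `|a - b| <= K * bnd k + c) -> `|a - b| <= c.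
  move=> K0 H; apply/ler_addgt0Pr => e e0.
  have K1 : 0 < K + 1 by rewrite ltr_wpDl.
  have [k hk] := bnd_small (divr_gt0 e0 K1).
  apply: le_trans (H k) _; rewrite addrC lerD2l.
  apply: le_trans (_ : (K + 1) * (e / (K + 1)) <= _); last by rewrite mulrC divfK ?gt_eqF.
  have b0 : 0 <= bnd k by rewrite divr_ge0 ?exprn_ge0 // mulr_ge0 // ltW.
  by rewrite ler_pM // lerDl.
have y0 : y 0 = x0.
  have t0 : `|0 : R| <= tau by rewrite normr0 ltW.
  apply/eqP; rewrite -subr_eq0 -normr_le0; apply: (bnd0 _ _ 1) => // k.
  rewrite mul1r addr0; have := yP 0 t0 k.+1; rewrite YS0 => h; exact: le_trans h (bndS k).
have yr t : `|t| <= tau -> `|y t - x0| <= r / 2.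
  move=> tt; apply: (bnd0 _ _ 1) => // k; rewrite mul1r -(subrKA (Y k t)).
  apply: le_trans (ler_normD _ _) _; rewrite lerD ?yP //.
  have t0 : `|0 : R| <= tau by rewrite normr0 ltW.
  have := Y_lip k t0 tt; rewrite subr0.
  have -> : Y k 0 = x0 by case: k.
  move=> h; apply: le_trans h _; apply: le_trans tauC.
  by rewrite mulrC ler_wpM2r.
exists y; split=> // t tt; have tt' := ltW tt; split; first exact: near_x0 (yr _ tt').
apply: (@is_derive_quadratic _ _ _ _ (tau - `|t|) (C * C)); first by rewrite subr_gt0.
move=> h hd; have th : `|t + h| <= tau.
  by apply: le_trans (ler_normD _ _) _; lra.
rewrite -[_ - _ - _]subr0; apply: (bnd0 _ _ (2 + `|h| * C)).
  by rewrite addr_ge0 // mulr_ge0.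
move=> k; rewrite subr0.
(* The first three differences compare the limit with an iterate and are bounded by multiples of
   [bnd k], removed at the end by [bnd0]; the last group is [Y_quad]. *)
have E : y (t + h) - y t - h *: X (y t) =
   ((y (t + h) - Y k.+1 (t + h)) - (y t - Y k.+1 t) - h *: (X (y t) - X (Y k t)))
   + (Y k.+1 (t + h) - Y k.+1 t - h *: X (Y k t)).
  by apply/matrixP => i j; rewrite !mxE; ring.
rewrite E; apply: le_trans (ler_normD _ _) _; apply: lerD; last first.
  by have := Y_quad k tt' th; rewrite [t + h - t]addrC addKr.
apply: le_trans (ler_normB _ _) _; rewrite mulrDl; apply: lerD.
  apply: le_trans (ler_normB _ _) _; rewrite mulrDl mul1r.
  by apply: lerD; apply: le_trans (bndS k); exact: yP.
rewrite normrZ -mulrA ler_wpM2l //.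
have [h' _] := Y_good k tt'.
have [_ le] := XC h' (near_x0 (yr _ tt')); apply: le_trans le _.
by rewrite ler_wpM2l // yP.
Qed.

End PicardIteration.

(** The time of existence is uniform in the initial point; the flow boxes rely on this. *)
Lemma picard_lindelof m (U : set 'rV[R]_m) (X : 'rV[R]_m -> 'rV[R]_m) z0 r :
  open U -> Ck_on 1 U X -> U z0 -> 0 < r ->
  exists tau r0, [/\ 0 < tau, 0 < r0 & forall x0, `|x0 - z0| < r0 ->
    exists y : R -> 'rV[R]_m, y 0 = x0 /\
      forall t, `|t| < tau -> `|y t - z0| < r /\
        is_derive (t : R^o) 1 (y : R^o -> 'rV[R]_m) (X (y t))].
Proof.
move=> Uo C1 Uz r0; have [r1 [C [r10 C0 r1U r1P]]] := Ck_on1_bounds Uo C1 Uz.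
pose r' := Num.min r r1; have r'0 : 0 < r' by rewrite lt_min r0 r10.
(* r' / 2 keeps the iterates in the ball and 1 / 2 makes the iteration contract; C + 1 because C may
   be 0. *)
pose tau := Num.min (r' / 2) (1 / 2) / (C + 1).
have C10 : 0 < C + 1 by rewrite ltr_wpDl.
have tau0 : 0 < tau by rewrite divr_gt0 // lt_min !divr_gt0.
have tC : tau * C <= Num.min (r' / 2) (1 / 2).
  rewrite /tau mulrAC ler_pdivrMr // ler_wpM2l //; last by rewrite lerDl.
  by rewrite le_min !divr_ge0 // ltW.
exists tau, (r' / 2); split=> //; first by rewrite divr_gt0.
move=> x0 x0z.
have inr a : `|a - z0| < r' -> `|a - z0| < r1.
  by move=> h; apply: lt_le_trans h _; rewrite ge_min lexx orbT.
have [|||||y [y0 yP]] := @picard_solution m X z0 x0 r' C tau r'0 C0 tau0.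
- by move=> a /inr /r1U Ua; exact: C1.1.
- by move=> a b /inr ha /inr hb; have [h _ ?] := r1P a b ha hb.
- by apply: le_trans tC _; rewrite ge_min lexx.
- by apply: le_trans tC _; rewrite ge_min lexx orbT.
- exact: x0z.
exists y; split=> // t /yP [h1 h2]; split=> //.
by apply: lt_le_trans h1 _; rewrite ge_min lexx.
Qed.

End Picard.

(** * Lorentzian forms *)

Section Lorentz.
Variables (R : realType) (n : nat).

Definition form (G : 'M[R]_n.+1) (v w : 'rV[R]_n.+1) : R := (v *m G *m w^T) 0 0.

Lemma minkowskiE (v w : 'rV[R]_n.+1) :
  form (Defs.minkowski R n) v w =
  - (v 0 ord0 * w 0 ord0) + \sum_(i | i != ord0) v 0 i * w 0 i.
Proof.
rewrite /form /Defs.minkowski mul_mx_diag mxE (bigD1 ord0) //= !mxE eqxx mulrN1 mulNr.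
by congr (_ + _); apply: eq_bigr => i i0; rewrite !mxE (negbTE i0) mulr1.
Qed.

(** Reversed Cauchy-Schwarz. Orthogonality means C = v0 w0, and then the sum of squares of the w0
    v_i - v0 w_i equals w0^2 (A - v0^2) + v0^2 (B - w0^2), which is negative. *)
Lemma minkowski_nonorth (v w : 'rV[R]_n.+1) :
  form (Defs.minkowski R n) v v < 0 -> form (Defs.minkowski R n) w w < 0 ->
  form (Defs.minkowski R n) v w != 0.
Proof.
rewrite !minkowskiE; set v0 := v 0 ord0; set w0 := w 0 ord0.
set A := \sum_(i | _) v 0 i * v 0 i; set B := \sum_(i | _) w 0 i * w 0 i.
set C := \sum_(i | _) v 0 i * w 0 i => vt wt; apply/eqP => o.
have : 0 <= \sum_(i < n.+1 | i != ord0) (w0 * v 0 i - v0 * w 0 i) ^+ 2.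
  by apply: sumr_ge0 => i _; exact: sqr_ge0.
have -> : \sum_(i < n.+1 | i != ord0) (w0 * v 0 i - v0 * w 0 i) ^+ 2 =
    w0 ^+ 2 * A + v0 ^+ 2 * B - 2 * w0 * v0 * C.
  rewrite /A /B /C !mulr_sumr -sumrN -!big_split /=; apply: eq_bigr => i _.
  ring.
have A0 : 0 <= A by apply: sumr_ge0 => i _; rewrite -expr2 sqr_ge0.
have B0 : 0 <= B by apply: sumr_ge0 => i _; rewrite -expr2 sqr_ge0.
have -> : C = v0 * w0 by lra.
have : A < v0 ^+ 2 by rewrite expr2; lra.
have : B < w0 ^+ 2 by rewrite expr2; lra.
move=> h1 h2 h3.
have : w0 ^+ 2 * A < w0 ^+ 2 * v0 ^+ 2 by rewrite ltr_pM2l // (le_lt_trans B0).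
have : v0 ^+ 2 * B < v0 ^+ 2 * w0 ^+ 2 by rewrite ltr_pM2l // (le_lt_trans A0).
move: h3; rewrite !expr2; lra.
Qed.

Lemma form_nonorth (G P : 'M[R]_n.+1) v w : P \in unitmx ->
  P *m G *m P^T = Defs.minkowski R n -> form G v v < 0 -> form G w w < 0 ->
  form G v w != 0.
Proof.
move=> Pu PG.
have E a b : form G a b = form (Defs.minkowski R n) (a *m invmx P) (b *m invmx P).
  rewrite /form -PG trmx_mul trmx_inv !mulmxA.
  rewrite mulmxKV // -[_ *m P^T *m _]mulmxA mulmxV ?unitmx_tr // mulmx1.
  by [].
rewrite !E; exact: minkowski_nonorth.
Qed.

Lemma formE G v w : form G v w = \sum_i \sum_j v 0 i * G i j * w 0 j.
Proof.
rewrite /form mxE exchange_big /=; apply: eq_bigr => j _.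
by rewrite !mxE mulr_suml.
Qed.

Lemma formDl G u v w : form G (u + v) w = form G u w + form G v w.
Proof. by rewrite /form !mulmxDl mxE. Qed.
Lemma formDr G u v w : form G u (v + w) = form G u v + form G u w.
Proof. by rewrite /form linearD mulmxDr mxE. Qed.
Lemma formZl G c v w : form G (c *: v) w = c * form G v w.
Proof. by rewrite /form -!scalemxAl mxE. Qed.
Lemma formZr G c v w : form G v (c *: w) = c * form G v w.
Proof. by rewrite /form linearZ -scalemxAr mxE. Qed.
Lemma form0l G w : form G 0 w = 0.
Proof. by rewrite /form !mul0mx mxE. Qed.
Lemma formNl G v w : form G (- v) w = - form G v w.
Proof. by rewrite -scaleN1r formZl mulN1r. Qed.
Lemma formNr G v w : form G v (- w) = - form G v w.
Proof. by rewrite -scaleN1r formZr mulN1r. Qed.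
Lemma formDG G H v w : form (G + H) v w = form G v w + form H v w.
Proof. by rewrite /form mulmxDr mulmxDl mxE. Qed.
Lemma formZG c G v w : form (c *: G) v w = c * form G v w.
Proof. by rewrite /form -scalemxAr -scalemxAl mxE. Qed.
Lemma formMl A G v w : form (A *m G) v w = form G (v *m A) w.
Proof. by rewrite /form !mulmxA. Qed.
Lemma formMr A G v w : form (G *m A^T) v w = form G v (w *m A).
Proof. by rewrite /form trmx_mul !mulmxA. Qed.

Lemma form_le G v w : `|form G v w| <= (n.+1)%:R ^+ 2 * (`|G| * `|v| * `|w|).
Proof.
rewrite formE; apply: le_trans (ler_norm_sum _ _ _) _.
apply: (@le_trans _ _ (\sum_(i < n.+1) \sum_(j < n.+1) `|G| * `|v| * `|w|)).
  apply: ler_sum => i _; apply: le_trans (ler_norm_sum _ _ _) _.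
  apply: ler_sum => j _; rewrite !normrM [`|v 0 i| * _]mulrC.
  apply: ler_pM; rewrite ?mulr_ge0 ?mx_entry_le //.
  by apply: ler_pM; rewrite ?mx_entry_le.
by rewrite !sumr_const !card_ord -mulrnA -[leLHS]mulr_natl natrM expr2.
Qed.

End Lorentz.

(** * Persistence of signs, and calculus of forms along curves *)

Section Cone.
Variables (R : realType).

(** Meant for f the product of a vector with the time orientation: it cannot vanish while the vector
    is timelike, so future-directedness propagates along continuous timelike families. *)
Lemma sign_persistence (f : R -> R) a b :
  (forall s, between a b s -> {for s, continuous f} /\ f s != 0) ->
  f a < 0 -> f b < 0.
Proof.
move=> H fa; rewrite ltNge; apply/negP => fb.
have [c cab fc] : exists2 c, between a b c & f c = 0.
  have ff : Num.min (f a) (f b) <= 0 <= Num.max (f a) (f b).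
    by rewrite ge_min le_max (ltW fa) fb orbT.
  move: H; rewrite /between; case: (leP a b) => [ab|/ltW ba] H.
    have [c cab fc] : exists2 c, c \in `[a, b] & f c = 0.
      apply: IVT => //; apply: continuous_in_subspaceT => x.
      by rewrite inE /= in_itv /= => /H [].
    by exists c => //; move: cab; rewrite in_itv.
  have [c cab fc] : exists2 c, c \in `[b, a] & f c = 0.
    apply: IVT => //; last by rewrite minC maxC.
    apply: continuous_in_subspaceT => x.
    by rewrite inE /= in_itv /= => /H [].
  by exists c => //; move: cab; rewrite in_itv.
by have [_] := H c cab; rewrite fc eqxx.
Qed.

Lemma mean_value_scalar_le (f f' : R -> R) (a b e : R) :
  0 <= e ->
  (forall t, between a b t ->
    is_derive (t : R^o) 1 (f : R^o -> R^o) (f' t) /\ `|f' t| <= e) ->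
  `|f b - f a| <= e * `|b - a|.
Proof.
move=> e0 H.
have H' t : between a b t ->
    is_derive (t : R^o) 1 ((fun s => const_mx (f s)) : R^o -> 'M[R]_1) (const_mx (f' t))
    /\ `|(const_mx (f' t) : 'M[R]_1) - 0| <= e.
  move=> /H [df le]; split.
    by apply/is_derive_mxP => i j; rewrite mxE; under eq_fun do rewrite mxE.
  by rewrite subr0; apply/mx_norm_leP => // i j; rewrite mxE.
have := mean_value_norm_le e0 H'; rewrite scaler0 subr0.
by move=> h; have := mx_entry_le (const_mx (f b) - const_mx (f a) : 'M[R]_1) 0 0;
  rewrite !mxE => /le_trans; apply.
Qed.

Lemma is_derive_comp (V : normedModType R) p q (f : V -> 'M[R]_(p, q)) (x : R -> V) t w :
  differentiable f (x t) -> is_derive (t : R^o) 1 (x : R^o -> V) w ->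
  is_derive (t : R^o) 1 ((f \o x) : R^o -> 'M[R]_(p, q)) ('D_w f (x t)).
Proof.
move=> df [dx xE].
have dx' : differentiable (x : R^o -> V) (t : R^o) by apply/derivable1_diffP.
have dfx : differentiable (f \o x : R^o -> _) (t : R^o) by exact: differentiable_comp.
split; first exact: diff_derivable.
rewrite (deriveE _ dfx) (deriveE _ df) (diff_comp dx' df) -xE (deriveE _ dx').
by [].
Qed.

Lemma is_derive_form n (G : R -> 'M[R]_n.+1) (u v : R -> 'rV[R]_n.+1) t G' u' v' :
  is_derive (t : R^o) 1 (G : R^o -> 'M[R]_n.+1) G' ->
  is_derive (t : R^o) 1 (u : R^o -> 'rV[R]_n.+1) u' ->
  is_derive (t : R^o) 1 (v : R^o -> 'rV[R]_n.+1) v' ->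
  is_derive (t : R^o) 1 ((fun s => form (G s) (u s) (v s)) : R^o -> R^o)
    (form G' (u t) (v t) + form (G t) u' (v t) + form (G t) (u t) v').
Proof.
move=> /is_derive_mxP dG /is_derive_mxP du /is_derive_mxP dv.
have -> : (fun s => form (G s) (u s) (v s)) =
   \sum_i \sum_j ((fun s => u s 0 i) * (fun s => G s i j) * (fun s => v s 0 j)).
  apply/funext => s; rewrite formE fct_sumE; apply: eq_bigr => i _.
  by rewrite fct_sumE.
have -> : form G' (u t) (v t) + form (G t) u' (v t) + form (G t) (u t) v' =
   \sum_i \sum_j (u t 0 i * G t i j * v' 0 j + v t 0 j * (u t 0 i * G' i j + G t i j * u' 0 i)).
  rewrite !formE -!big_split; apply: eq_bigr => i _ /=.
  by rewrite -!big_split; apply: eq_bigr => j _ /=; ring.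
apply: is_derive_sum => i; apply: is_derive_sum => j.
have d1 : is_derive (t : R^o) 1 (((fun s => u s 0 i) * (fun s => G s i j)) : R^o -> R^o)
    (u t 0 i * G' i j + G t i j * u' 0 i).
  by apply: is_deriveM.
by apply: (@is_deriveM R R^o _ _ t 1 _ _ d1 (dv 0 j)).
Qed.

Lemma form_cvg (T : Type) (F : set_system T) {FF : Filter F} n
    (G : T -> 'M[R]_n.+1) (u v : T -> 'rV[R]_n.+1) G0 u0 v0 :
  G x @[x --> F] --> G0 -> u x @[x --> F] --> u0 -> v x @[x --> F] --> v0 ->
  form (G x) (u x) (v x) @[x --> F] --> form G0 u0 v0.
Proof.
move=> cG cu cv; rewrite formE; under eq_fun do rewrite formE.
have E p q (A : T -> 'M[R]_(p, q)) (A0 : 'M[R]_(p, q)) i j : A x @[x --> F] --> A0 -> A x i j @[x --> F] --> A0 i j.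
  move=> cA; apply: (@cvg_comp _ _ _ A (fun B : 'M[R]_(p, q) => B i j) F (nbhs A0)) => //.
  exact: (@coord_continuous R p q i j A0).
apply: cvg_big => [|i _]; first exact: add_continuous.
apply: cvg_big => [|j _]; first exact: add_continuous.
by apply: cvgM; [apply: cvgM; exact: E | exact: E].
Qed.

Lemma is_derive_ratio (f g : R -> R) (t f' g' : R) : g t != 0 ->
  is_derive (t : R^o) 1 (f : R^o -> R^o) f' -> is_derive (t : R^o) 1 (g : R^o -> R^o) g' ->
  is_derive (t : R^o) 1 ((fun s => f s / g s) : R^o -> R^o) ((f' * g t - f t * g') / g t ^+ 2).
Proof.
move=> gt df [dg gE].
have dgi : is_derive (t : R^o) 1 ((fun s => (g s)^-1) : R^o -> R^o) (- g t ^- 2 * g').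
  split; first exact: derivableV.
  by rewrite deriveV // gE.
apply: (is_derive_eq (is_deriveM df dgi)).
rewrite -![_ *: _]/(_ * _); field.
exact: gt.
Qed.

End Cone.

(** * Evolution of timelike separations under a conformal Killing flow, in a chart *)

Section Evolution.
Variables (R : realType) (n : nat).
Local Notation V := 'rV[R]_n.+1.
Variables (U : set V) (X T : V -> V) (G : V -> 'M[R]_n.+1) (sigma : V -> R) (z0 : V).
Hypotheses (Uo : open U) (Uz0 : U z0).
Hypotheses (X2 : Ck_on 2 U X) (G1 : Ck_on 1 U G) (Tc : forall a, U a -> {for a, continuous T}).
Hypothesis Gsym : forall a, U a -> (G a)^T = G a.
Hypothesis lie : forall a, U a ->
  'D_(X a) G a + 'J X a *m G a + G a *m ('J X a)^T = (2 * sigma a) *: G a.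
Hypothesis Xt : forall a, U a -> form (G a) (X a) (X a) < 0.
Hypothesis Tt : forall a, U a -> form (G a) (T a) (T a) < 0.
Hypothesis nonorth : forall a v w, U a -> form (G a) v v < 0 -> form (G a) w w < 0 ->
  form (G a) v w != 0.

(** Future timelike vectors, uniformly away from the light cone: both conditions are invariant under
    positive scaling of v, and an error O(|v|^3) in g(v, v) costs only part of k once v is short. *)
Definition cone (k : R) (x v : V) :=
  form (G x) v v < - k * `|v| ^+ 2 /\ form (G x) v (T x) < 0.

Definition solution (r : R) (t0 : R) (a : R -> V) := forall s, between 0 t0 s ->
  `|a s - z0| < r /\ is_derive (s : R^o) 1 (a : R^o -> V) (X (a s)).

(* Gronwall's inequality for short times, by evaluating at a maximum of |b - a|. *)
Lemma solution_bounds (r C tau t0 : R) (a b : R -> V) : 0 <= C -> tau * C <= 1 / 2 ->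
  (forall x y, `|x - z0| < r -> `|y - z0| < r -> `|X y - X x| <= C * `|y - x|) ->
  solution r t0 a -> solution r t0 b -> `|t0| <= tau ->
  forall s, between 0 t0 s ->
  `|b s - a s| <= 2 * `|b 0 - a 0| /\ `|b 0 - a 0| <= 2 * `|b s - a s|.
Proof.
move=> C0 tC XC sa sb tt.
have cc s : between 0 t0 s -> {for s, continuous (fun s => `|b s - a s|)}.
  move=> /[dup] /sa [_ da] /sb [_ db].
  apply: (@continuous_comp _ _ _ (fun s => b s - a s) (fun v : V => `|v|)).
    by apply: continuousB; [exact: is_derive_continuous db | exact: is_derive_continuous da].
  exact: norm_continuous.
have [c c0 cmax] : exists2 c, between 0 t0 c & forall s, between 0 t0 s ->
    `|b s - a s| <= `|b c - a c|.
  move: cc; rewrite /between; case: (leP 0 t0) => [t|/ltW t] cc.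
    have [|c c0 cm] := @EVT_max R (fun s => `|b s - a s|) 0 t0 t.
      apply: continuous_in_subspaceT => x; rewrite inE /= in_itv /=; exact: cc.
    exists c; first by move: c0; rewrite in_itv.
    by move=> s s0; apply: cm; rewrite in_itv.
  have [|c c0 cm] := @EVT_max R (fun s => `|b s - a s|) t0 0 t.
    apply: continuous_in_subspaceT => x; rewrite inE /= in_itv /=; exact: cc.
  exists c; first by move: c0; rewrite in_itv.
  by move=> s s0; apply: cm; rewrite in_itv.
set S := `|b c - a c| in cmax.
(* Since |t0| * C <= 1 / 2, the difference b - a moves by at most S / 2, so its norm stays between S
   / 2 and S; both inequalities follow. *)
have key s1 s2 : between 0 t0 s1 -> between 0 t0 s2 ->
    `|(b s2 - a s2) - (b s1 - a s1)| <= S / 2.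
  move=> h1 h2.
  have CS : 0 <= C * S by rewrite mulr_ge0 /S.
  have H s : between s1 s2 s ->
      is_derive (s : R^o) 1 ((b - a) : R^o -> V) (X (b s) - X (a s)) /\
      `|X (b s) - X (a s) - 0| <= C * S.
    move=> hs; have h := between_sub h1 h2 hs.
    have [ra da] := sa s h; have [rb db] := sb s h.
    split; first exact: is_deriveB.
    rewrite subr0; apply: le_trans (XC _ _ ra rb) _.
    by rewrite ler_wpM2l // cmax.
  have := mean_value_norm_le CS H; rewrite scaler0 subr0 /= !fctE => h.
  apply: le_trans h _.
  have S0 : 0 <= S by rewrite /S.
  have d : `|s2 - s1| <= tau.
    by apply: le_trans tt; have := between_dist2_le h1 h2; rewrite subr0.
  have : `|s2 - s1| * C <= 1 / 2 by apply: le_trans tC; rewrite ler_wpM2r.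
  move=> h'; rewrite mulrAC [C * _]mulrC; nra.
have b00 := between_left 0 t0.
have half (x y : V) : `|x - y| <= S / 2 -> `|x| <= `|y| + S / 2.
  by move=> h; rewrite -(subrK y x) addrC; apply: le_trans (ler_normD _ _) _; rewrite lerD2l.
move=> s hs.
have hS s' : between 0 t0 s' -> S <= 2 * `|b s' - a s'|.
  by move=> h; have := half _ _ (key _ _ h c0); rewrite -/S; lra.
by split; [apply: le_trans (cmax s hs) (hS _ b00) | apply: le_trans (cmax 0 b00) (hS _ hs)].
Qed.

(* The conformal factor sigma cancels in the quotient. *)
Lemma ratio_derive (r C D : R) (t : R) (a b : R -> V) :
  0 <= C ->
  (forall x, `|x - z0| < r -> [/\ U x, form (G x) (X x) (X x) <= - D & `|G x| <= C]) ->
  (forall x y, `|x - z0| < r -> `|y - z0| < r ->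
     `|X y - X x - 'D_(y - x) X x| <= C * `|y - x| ^+ 2) -> 0 < D ->
  `|a t - z0| < r -> `|b t - z0| < r ->
  is_derive (t : R^o) 1 (a : R^o -> V) (X (a t)) ->
  is_derive (t : R^o) 1 (b : R^o -> V) (X (b t)) ->
  exists q', is_derive (t : R^o) 1
     ((fun s => form (G (a s)) (b s - a s) (b s - a s) / form (G (a s)) (X (a s)) (X (a s)))
       : R^o -> R^o) q' /\
     `|q'| <= 2 * (n.+1)%:R ^+ 2 * C ^+ 2 / D * `|b t - a t| ^+ 3.
Proof.
move=> C0 HD XQ D0 ra rb da db.
have [Ua ND GC] := HD _ ra.
have [dG _] := Ck_on1_differentiable Uo G1 Ua.
have [dX _] := Ck_on1_differentiable Uo (Ck_onS X2) Ua.
have dGa := is_derive_comp dG da.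
have dXa := is_derive_comp dX da.
have dba : is_derive (t : R^o) 1 ((fun s => b s - a s) : R^o -> V) (X (b t) - X (a t)).
  exact: is_deriveB.
have dQ := is_derive_form dGa dba dba.
have dN := is_derive_form dGa dXa dXa.
have Nn0 : form (G (a t)) (X (a t)) (X (a t)) != 0.
  by rewrite lt_eqF // (le_lt_trans ND) // oppr_lt0.
have dR := is_derive_ratio Nn0 dQ dN.
eexists; split; first exact: dR.
rewrite /=.
set N := form (G (a t)) (X (a t)) (X (a t)) in ND Nn0 *.
set v := b t - a t.
(* v' = D_v X + e: the linear part completes the Lie derivative of the metric and yields the factor
   2 sigma, so only the quadratic remainder e survives in the derivative of the quotient. *)
pose e := X (b t) - X (a t) - 'D_v X (a t).
have Je w : 'D_w X (a t) = w *m 'J X (a t) by exact: deriveEjacobian.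
have fs u w : form (G (a t)) u w = form (G (a t)) w u.
  rewrite /form -[in LHS](trmxK (u *m _ *m _)) mxE !trmx_mul trmxK Gsym //.
  by rewrite mulmxA.
have lieE u w : form ('D_(X (a t)) G (a t)) u w + form (G (a t)) ('D_u X (a t)) w
    + form (G (a t)) u ('D_w X (a t)) = 2 * sigma (a t) * form (G (a t)) u w.
  by rewrite !Je -formMl -formMr -!formDG lie // formZG.
have Xe : X (b t) - X (a t) = 'D_v X (a t) + e by rewrite /e [RHS]addrC subrK.
rewrite Xe (formDl _ ('D_v X (a t))) (formDr _ _ ('D_v X (a t))).
have -> : form ('D_(X (a t)) G (a t)) v v + (form (G (a t)) ('D_v X (a t)) v + form (G (a t)) e v)
   + (form (G (a t)) v ('D_v X (a t)) + form (G (a t)) v e) =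
   2 * sigma (a t) * form (G (a t)) v v + 2 * form (G (a t)) e v.
  by rewrite -(lieE v v) (fs v e); ring.
rewrite lieE -/N.
have -> : ((2 * sigma (a t) * form (G (a t)) v v + 2 * form (G (a t)) e v) * N -
   form (G (a t)) v v * (2 * sigma (a t) * N)) / N ^+ 2 = 2 * form (G (a t)) e v / N.
  by field.
rewrite !normrM normfV ger0_norm //.
have Nneg : N < 0 by apply: le_lt_trans ND _; rewrite oppr_lt0.
have NN : D <= `|N| by rewrite (ltr0_norm Nneg) lerNr.
have N0 : 0 < `|N| by apply: lt_le_trans NN.
rewrite ler_pdivrMr //.
apply: (@le_trans _ _ (2 * ((n.+1)%:R ^+ 2 * (C * (C * `|v| ^+ 2) * `|v|)))).
  rewrite ler_wpM2l //; apply: le_trans (form_le _ _ _) _.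
  rewrite ler_wpM2l ?exprn_ge0 // ler_wpM2r //; apply: ler_pM => //.
  exact: XQ.
have -> : 2 * n.+1%:R ^+ 2 * C ^+ 2 / D * `|v| ^+ 3 * `|N| =
  2 * (n.+1%:R ^+ 2 * (C * (C * `|v| ^+ 2) * `|v|)) * (`|N| / D).
  by field; rewrite gt_eqF.
rewrite ler_peMr ?ler_pdivlMr ?mul1r //.
by rewrite !mulr_ge0 ?exprn_ge0.
Qed.

(** The order of quantifiers matters: r and tau do not depend on k. The flow is continued in small
    steps and each may worsen k, so the length of a step must not depend on it. *)
Lemma cone_evolution : exists r tau, [/\ 0 < r, 0 < tau, forall x, `|x - z0| < r -> U x &
  forall t0 a b, `|t0| <= tau -> solution r t0 a -> solution r t0 b ->
    (forall s, between 0 t0 s ->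
      `|b s - a s| <= 2 * `|b 0 - a 0| /\ `|b 0 - a 0| <= 2 * `|b s - a s|)]
  /\ forall k, 0 < k -> exists k' d, [/\ 0 < k', 0 < d &
    forall t0 a b, `|t0| <= tau -> solution r t0 a -> solution r t0 b ->
      `|b 0 - a 0| < d -> cone k (a 0) (b 0 - a 0) -> cone k' (a t0) (b t0 - a t0)].
Proof.
have [r1 [C1 [r10 C10 r1U XB]]] := Ck_on2_bounds Uo X2 Uz0.
have [r2 [C2 [r20 C20 _ GB]]] := Ck_on1_bounds Uo G1 Uz0.
pose N x := form (G x) (X x) (X x).
(* Half of - N z0, so that N <= - D wherever N differs from N z0 by at most D. *)
pose D := - N z0 / 2.
have D0 : 0 < D by rewrite divr_gt0 // oppr_gt0; exact: Xt.
have : \forall x \near z0, `|N x - N z0| <= D.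
  have cN : {for z0, continuous N}.
    exact: (form_cvg (G1.1 _ Uz0) (X2.1 _ Uz0) (X2.1 _ Uz0)).
  exact: continuous_near_le.
move=> /nbhs_normP [r3 /= r30 ND].
pose r := Num.min r1 (Num.min r2 r3).
have r0 : 0 < r by rewrite !lt_min r10 r20.
have rr x : `|x - z0| < r -> [/\ `|x - z0| < r1, `|x - z0| < r2 & `|x - z0| < r3].
  by rewrite !lt_min => /and3P[].
pose C := C1 + C2 + 1.
have C0 : 0 < C by rewrite ltr_wpDl // addr_ge0.
have CC1 : C1 <= C by rewrite /C -addrA lerDl addr_ge0.
have CC2 : C2 <= C by rewrite /C addrAC lerDr addr_ge0.
have HD x : `|x - z0| < r -> [/\ U x, N x <= - D & `|G x| <= C].
  move=> /rr [x1 x2 x3]; have Ux := r1U _ x1; split=> //.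
    have := ND x; rewrite /ball_ /= distrC => /(_ x3).
    by rewrite ler_norml => /andP[_]; rewrite /D; lra.
  by have [h _ _] := GB _ _ x2 x2; apply: le_trans CC2.
have XL x y : `|x - z0| < r -> `|y - z0| < r -> `|X y - X x| <= C * `|y - x|.
  move=> /rr [x1 _ _] /rr [y1 _ _]; have [_ _ h _] := XB _ _ x1 y1.
  by apply: le_trans h _; rewrite ler_wpM2r.
have XQ x y : `|x - z0| < r -> `|y - z0| < r ->
    `|X y - X x - 'D_(y - x) X x| <= C * `|y - x| ^+ 2.
  move=> /rr [x1 _ _] /rr [y1 _ _]; have [_ _ _ h] := XB _ _ x1 y1.
  by apply: le_trans h _; rewrite ler_wpM2r ?exprn_ge0.
pose n1 := (n.+1)%:R ^+ 2 * (C * C * C).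
have Nn1 x : `|x - z0| < r -> - N x <= n1.
  move=> xr; have [Ux _ Gx] := HD _ xr; have [x1 _ _] := rr _ xr.
  have [Xx _ _ _] := XB _ _ x1 x1.
  apply: le_trans (ler_norm _) _; rewrite normrN; apply: le_trans (form_le _ _ _) _.
  have Xx' : `|X x| <= C by apply: le_trans CC1.
  rewrite ler_wpM2l ?exprn_ge0 //; apply: ler_pM; rewrite ?mulr_ge0 //.
  by apply: ler_pM.
have n10 : 0 < n1 by rewrite mulr_gt0 ?exprn_gt0 ?ltr0n // !mulr_gt0.
pose tau := (2 * C)^-1.
have tau0 : 0 < tau by rewrite invr_gt0 mulr_gt0.
have tC : tau * C <= 1 / 2 by rewrite /tau invfM -mulrA mulVf ?gt_eqF // mulr1 mul1r.
have bnds t0 a b : `|t0| <= tau -> solution r t0 a -> solution r t0 b ->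
    forall s, between 0 t0 s ->
      `|b s - a s| <= 2 * `|b 0 - a 0| /\ `|b 0 - a 0| <= 2 * `|b s - a s|.
  by move=> tt sa sb; exact: (solution_bounds (ltW C0) tC XL sa sb tt).
exists r, tau; split.
  by split=> // x /HD [].
move=> k k0.
(* Drift of the quotient during time tau: the constant of [ratio_derive], with 8 = 2^3 because |b -
   a| at most doubles. *)
pose K := 2 * (n.+1)%:R ^+ 2 * C ^+ 2 / D * 8 * tau.
have K0 : 0 <= K.
  have [C0' D0' tau0'] : [/\ 0 <= C, 0 <= D & 0 <= tau] by split; exact: ltW.
  apply: mulr_ge0 => //; apply: mulr_ge0 => //; apply: divr_ge0 => //.
  by apply: mulr_ge0; [apply: mulr_ge0 => // | ]; exact: exprn_ge0.
(* With c = k / n1 and v = b - a, the quotient starts above c |v 0|^2. For |v 0| < d it drifts by at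
   most half of this, and so stays above c / 2 |v 0|^2. Multiplying by - N >= D and using |v s|^2 <=
   4 |v 0|^2 leaves k' = D c / 8. *)
pose k' := D * k / (8 * n1).
pose d := k / (2 * n1 * (K + 1)).
have K10 : 0 < K + 1 by rewrite ltr_wpDl.
have k'0 : 0 < k' by rewrite divr_gt0 // mulr_gt0.
exists k', d; split=> //.
- by rewrite divr_gt0 // !mulr_gt0.
move=> t0 a b tt sa sb vd [Q0 T0].
pose v s := b s - a s.
pose Q s := form (G (a s)) (v s) (v s).
have b00 := between_left 0 t0.
have v00 : 0 < `|v 0|.
  rewrite normr_gt0; apply: contraTneq T0 => v0.
  by rewrite -/(v 0) v0 form0l ltxx.
have ratio s : between 0 t0 s -> `|Q s / N (a s) - Q 0 / N (a 0)| <= K * `|v 0| ^+ 3.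
  move=> hs.
  have H u : between 0 s u -> exists q',
     is_derive (u : R^o) 1 ((fun s => Q s / N (a s)) : R^o -> R^o) q' /\
     `|q'| <= 2 * (n.+1)%:R ^+ 2 * C ^+ 2 / D * (8 * `|v 0| ^+ 3).
    move=> hu; have h := between_sub b00 hs hu.
    have [ra da] := sa u h; have [rb db] := sb u h.
    have [q' [dq' le]] := ratio_derive (ltW C0) HD XQ D0 ra rb da db.
    exists q'; split=> //; apply: le_trans le _.
    have [h1 _] := bnds t0 a b tt sa sb u h.
    rewrite ler_wpM2l //.
      by rewrite divr_ge0 ?(ltW D0) // !mulr_ge0 ?exprn_ge0 // ltW.
    have -> : 8 * `|v 0| ^+ 3 = (2 * `|v 0|) ^+ 3 by rewrite exprMn; congr (_ * _); ring.
    by rewrite lerXn2r ?nnegrE ?mulr_ge0.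
  have H' : forall u, exists q', between 0 s u ->
     is_derive (u : R^o) 1 ((fun s => Q s / N (a s)) : R^o -> R^o) q' /\
     `|q'| <= 2 * (n.+1)%:R ^+ 2 * C ^+ 2 / D * (8 * `|v 0| ^+ 3).
    move=> u; have [h|nh] := pselect (between 0 s u); last by exists 0.
    by have [q' hq] := H u h; exists q'.
  have [q' hq] := choice H'.
  have E0 : 0 <= 2 * (n.+1)%:R ^+ 2 * C ^+ 2 / D * (8 * `|v 0| ^+ 3).
    by rewrite mulr_ge0 ?mulr_ge0 ?exprn_ge0 // ?invr_ge0 ?ler0n ltW.
  have := mean_value_scalar_le E0 hq; rewrite subr0 => h.
  apply: le_trans h _.
  have ss : `|s| <= tau by apply: le_trans tt; exact: between0_norm_le.
  rewrite /K; have -> : 2 * n.+1%:R ^+ 2 * C ^+ 2 / D * 8 * tau * `|v 0| ^+ 3 =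
     2 * n.+1%:R ^+ 2 * C ^+ 2 / D * (8 * `|v 0| ^+ 3) * tau by ring.
  by rewrite ler_wpM2l.
have Nneg s : between 0 t0 s -> N (a s) <= - D /\ - N (a s) <= n1.
  by move=> /sa [ra _]; have [_ h _] := HD _ ra; split=> //; exact: Nn1.
have Qs s : between 0 t0 s -> Q s < - k' * `|v s| ^+ 2.
  move=> hs; have [h1 h2] := bnds t0 a b tt sa sb s hs.
  have [N1 N2] := Nneg s hs; have [N3 N4] := Nneg 0 b00.
  pose c := k / n1; have c0 : 0 < c by rewrite divr_gt0.
  have W0 : 0 < `|v 0| ^+ 2 by rewrite exprn_gt0.
  have Np0 : 0 < - N (a 0) by rewrite oppr_gt0 (le_lt_trans N3) // oppr_lt0.
  have Nps : 0 < - N (a s) by rewrite oppr_gt0 (le_lt_trans N1) // oppr_lt0.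
  have R0 : c * `|v 0| ^+ 2 < Q 0 / N (a 0).
    rewrite -[Q 0 / _]mulrNN -invrN ltr_pdivlMr //.
    apply: (@le_lt_trans _ _ (k * `|v 0| ^+ 2)); last by rewrite ltrNr -mulNr.
    rewrite mulrAC; apply: ler_wpM2r; first exact: ltW.
    by rewrite /c mulrAC ler_pdivrMr // ler_wpM2l // ltW.
  have small : K * `|v 0| ^+ 3 <= c / 2 * `|v 0| ^+ 2.
    rewrite exprS mulrA; apply: ler_wpM2r; first exact: ltW.
    have : (K + 1) * `|v 0| <= c / 2.
      rewrite mulrC -ler_pdivlMr //; apply: (le_trans (ltW vd)).
      by rewrite /d /c !invfM !mulrA le_eqVlt; apply/orP; left; apply/eqP; ring.
    by move: (K) (`|v 0|) v00 => x y v00' h; rewrite (le_trans _ h) // mulrDl mul1r lerDl ltW.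
  have Rs : c / 2 * `|v 0| ^+ 2 < Q s / N (a s).
    have := ratio s hs; rewrite ler_norml => /andP[h3 _].
    by move: h3 R0 small; set A := Q s / _; set B := Q 0 / _; lra.
  move: Rs; rewrite -[Q s / _]mulrNN -invrN ltr_pdivlMr // => Rs.
  have le2 : `|v s| ^+ 2 <= 4 * `|v 0| ^+ 2.
    have -> : 4 * `|v 0| ^+ 2 = (2 * `|v 0|) ^+ 2 by rewrite exprMn; congr (_ * _); ring.
    by rewrite lerXn2r ?nnegrE ?mulr_ge0.
  have -> : k' = D * c / 8 by rewrite /k' /c invfM; ring.
  have : c / 2 * `|v 0| ^+ 2 * D <= c / 2 * `|v 0| ^+ 2 * - N (a s).
    by apply: ler_wpM2l; [rewrite mulr_ge0 ?divr_ge0 // ltW | lra].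
  have : D * c / 8 * `|v s| ^+ 2 <= D * c / 8 * (4 * `|v 0| ^+ 2).
    by apply: ler_wpM2l => //; rewrite divr_ge0 // mulr_ge0 // ltW.
  move: Rs; set A := `|v s| ^+ 2; set B := `|v 0| ^+ 2.
  by move=> e1 e2 e3; lra.
split; first exact: (Qs _ (between_right 0 t0)).
apply: (sign_persistence (f := fun s => form (G (a s)) (v s) (T (a s))) _ T0) => s hs.
have [ra da] := sa s hs; have [rb db] := sb s hs; have [Ua _ _] := HD _ ra.
have ca := is_derive_continuous da; have cb := is_derive_continuous db.
split.
  apply: form_cvg.
  - by apply: (@continuous_comp _ _ _ a G); [exact: ca | exact: (G1.1 _ Ua)].
  - exact: (continuousB cb ca).
  - by apply: (@continuous_comp _ _ _ a T); [exact: ca | exact: (Tc Ua)].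
apply: nonorth => //; last exact: Tt.
apply: lt_le_trans (Qs s hs) _.
rewrite mulNr oppr_le0; apply: mulr_ge0; [exact: ltW k'0 | exact: exprn_ge0].
Qed.

End Evolution.

(** * Smooth curves *)

Section RealInduction.
Variable R : realType.

(** Let c be the supremum of the x with Q a x: the hypothesis to the left of c gives Q a c, and the
    one to its right forbids c < b. *)
Lemma local_to_global (Q : R -> R -> Prop) (a b : R) :
  (forall x y z, Q x y -> Q y z -> Q x z) -> a < b ->
  (forall s, a <= s < b -> \forall h \near (0 : R)^'+, Q s (s + h)) ->
  (forall s, a < s <= b -> \forall h \near (0 : R)^'+, Q (s - h) s) ->
  Q a b.
Proof.
move=> Qt ab Qr Ql.
pose E := [set x | a < x <= b /\ Q a x].
have step s : a <= s < b -> exists2 x, s < x <= b & Q s x.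
  move=> sab; have sb : 0 < b - s by rewrite subr_gt0; case/andP: sab.
  have : \forall h \near (0 : R)^'+, [/\ Q s (s + h), 0 < h & h < b - s].
    apply: filterS3 (Qr s sab) (nbhs_right_gt 0) (nbhs_right_lt sb).
    by move=> h ? ? ?; split.
  move=> /filter_ex [h [Qh h0 hb]]; exists (s + h) => //.
  by apply/andP; split; lra.
have aab : a <= a < b by rewrite lexx.
have [x0 /andP[x0a x0b] Qx0] := step a aab.
have E0 : E x0 by split=> //; rewrite x0a.
have Eb : has_sup E.
  split; first by exists x0.
  by exists b => x [/andP[]].
pose c := sup E.
have x0c : x0 <= c by apply: ub_le_sup => //; case: Eb.
have cb : c <= b by apply: sup_le_ub; [exists x0 | move=> x [/andP[]]].
have ac : a < c by apply: lt_le_trans x0c.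
have Qac : Q a c.
  have cab : a < c <= b by rewrite ac.
  have /nbhs_normP [d /= d0 dP] : \forall h \near (0 : R), 0 < h -> Q (c - h) c.
    by have := Ql c cab; rewrite /at_right near_withinE.
  have [x [/andP[xa xb] Qx] xc] := sup_adherent d0 Eb.
  have xlec : x <= c by apply: ub_le_sup; [case: Eb | split=> //; rewrite xa].
  have [<- //|xnc] := eqVneq x c.
  have xltc : x < c by rewrite lt_neqAle xnc.
  apply: Qt Qx _; have -> : x = c - (c - x) by ring.
  apply: dP; last by rewrite subr_gt0.
  by rewrite /ball_ /= sub0r normrN ger0_norm ?subr_ge0 // -/c; move: xc; rewrite -/c; lra.
have [cb'|] := ltP c b; last first.
  by move=> bc; have <- : c = b by apply/eqP; rewrite eq_le cb.
have cab : a <= c < b by rewrite ltW.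
have [x /andP[xc xb] Qx] := step c cab.
have : x <= c.
  apply: ub_le_sup; first by case: Eb.
  by split; [rewrite xb (lt_trans ac) | exact: Qt Qx].
by rewrite leNgt xc.
Qed.

End RealInduction.

Section SmoothCurves.
Variable R : realType.

Lemma Ck_on_sub (V W : normedModType R) k (U U' : set V) (f : V -> W) :
  U' `<=` U -> Ck_on k U f -> Ck_on k U' f.
Proof.
move=> UU; elim: k f => [|k IH] f [cf df]; split=> //; try by move=> x /UU /cf.
by move=> v; have [dv /IH Cv] := df v; split=> // x /UU; exact: dv.
Qed.

Lemma Ck_on_cst (V W : normedModType R) k (U : set V) (w : W) : Ck_on k U (cst w : V -> W).
Proof.
elim: k w => [|k IH] w; split=> //; try by move=> x _; exact: cst_continuous.
move=> v; split=> [x _|]; first exact: derivable_cst.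
have -> : 'D_v (cst w : V -> W) = cst 0 by apply/funext => x; exact: derive_cst.
exact: IH.
Qed.

Lemma is_derive_affine (V : normedModType R) (a v : V) (t u : R) :
  is_derive (t : R^o) (u : R^o) ((fun s => a + s *: v) : R^o -> V) (u *: v).
Proof.
have E : (fun h : R => h^-1 *: ((((fun s => a + s *: v) : R^o -> V) \o shift (t : R^o))
    (h *: (u : R^o)) - (a + t *: v))) @ 0^' --> u *: v.
  apply: cvg_near_cst; rewrite near_withinE; apply: nearW => h h0 /=.
  rewrite scalerDl opprD addrACA subrr add0r addrK -[h *: (u : R^o)]/(h * u).
  by rewrite scalerA mulrA mulVf // mul1r.
by split; [exact: cvgP E | exact: cvg_lim E].
Qed.

Lemma smooth_on_affine (V : normedModType R) (a v : V) (U : set R^o) :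
  smooth_on U ((fun s => a + s *: v) : R^o -> V).
Proof.
case=> [|k]; split=> //.
- by move=> x _; apply: (@is_derive_continuous _ _ _ x (1 *: v)); exact: is_derive_affine.
- by move=> x _; apply: (@is_derive_continuous _ _ _ x (1 *: v)); exact: is_derive_affine.
move=> u; split=> [x _|]; first by have [] := is_derive_affine a v x u.
have -> : 'D_u ((fun s => a + s *: v) : R^o -> V) = cst (u *: v).
  by apply/funext => x; have [_ ] := is_derive_affine a v x u.
exact: Ck_on_cst.
Qed.

Lemma smooth_on_shift (V : normedModType R) (f : R -> V) (U : set R^o) (c : R) :
  smooth_on U (f : R^o -> V) ->
  smooth_on [set s : R^o | U (s + c)] ((fun s => f (s + c)) : R^o -> V).
Proof.
move=> Uf k; elim: k f {Uf}(Uf k) => [|k IH] f [cf df].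
  split=> // x Ux.
  apply: (@continuous_comp _ _ _ (fun s : R => s + c) f); last exact: cf.
  by apply: continuousD; [exact: cvg_id | exact: cst_continuous].
have E v x : (fun h : R => h^-1 *: (((fun s => f (s + c) : V) \o shift (x : R^o)) (h *: (v : R^o))
   - f (x + c))) = (fun h : R => h^-1 *: (((f : R^o -> V) \o shift ((x + c) : R^o)) (h *: (v : R^o))
   - f (x + c))).
  by apply/funext => h /=; rewrite addrA.
split=> [x Ux|v].
  apply: (@continuous_comp _ _ _ (fun s : R => s + c) f); last exact: cf.
  by apply: continuousD; [exact: cvg_id | exact: cst_continuous].
have [dv Cv] := df v; split=> [x Ux|].
  by rewrite /derivable E; exact: dv.
have -> : 'D_v ((fun s => f (s + c)) : R^o -> V) = (fun s => ('D_v (f : R^o -> V)) (s + c)).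
  by apply/funext => x; rewrite /derive E.
exact: (IH ('D_v (f : R^o -> V)) Cv).
Qed.

End SmoothCurves.

Section Germs.
Variables (R : realType) (m : nat) (M : manifold R m).
Variable K : chart R m M -> M -> 'rV[R]_m -> Prop.

Lemma smooth_germ_congr (gamma gamma' : R -> M) (D D' : set R) t d :
  0 < d -> gamma' t = gamma t ->
  (forall s, D' s -> `|s - t| < d -> D s /\ gamma' s = gamma s) ->
  smooth_germ K gamma D t -> smooth_germ K gamma' D' t.
Proof.
move=> d0 gt H [c [beta [e [ac e0 sb bP Kt]]]].
exists c, beta, (Num.min e d); split; [exact: ac | by rewrite lt_min e0 | | | by rewrite gt].
- move=> k; apply: Ck_on_sub (sb k) => s.
  by rewrite -!ball_normE /ball_ /= lt_min => /andP[].
- move=> s D's; rewrite -ball_normE /ball_ /= lt_min distrC => /andP[se sd].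
  have [Ds ->] := H s D's sd; apply: bP => //.
  by rewrite -ball_normE /ball_ /= distrC.
Qed.

Lemma smooth_germ_shift (gamma : R -> M) (D : set R) t c :
  smooth_germ K gamma D (t + c) ->
  smooth_germ K (fun s => gamma (s + c)) [set s | D (s + c)] t.
Proof.
move=> [d [beta [e [ad e0 sb bP Kt]]]].
exists d, (fun s => beta (s + c)), e; split; [exact: ad | exact: e0 | | |].
- move=> k; apply: Ck_on_sub (smooth_on_shift c sb k) => s.
  by rewrite /= -!ball_normE /ball_ /= opprD addrACA subrr addr0.
- move=> s Ds sb'; apply: bP => //.
  by move: sb'; rewrite -!ball_normE /ball_ /= opprD addrACA subrr addr0.
have -> : 'D_1 ((fun s => beta (s + c)) : R^o -> 'rV[R]_m) t = 'D_1 (beta : R^o -> _) (t + c).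
  rewrite /derive; have -> : (fun h : R => h^-1 *: (((fun s => beta (s + c)) \o shift (t : R^o))
     (h *: (1 : R^o)) - beta (t + c))) = (fun h : R => h^-1 *: (((beta : R^o -> _) \o
     shift ((t + c) : R^o)) (h *: (1 : R^o)) - beta (t + c))).
    by apply/funext => h /=; rewrite addrA.
  by [].
exact: Kt.
Qed.

(** A corner at the junction is allowed: germs are one-sided, and at b the left one comes from g1
    and the right one from g2, translated in time. *)
Lemma pw_smooth_curve_cat (g1 g2 : R -> M) a b c d : a < b -> c < d ->
  pw_smooth_curve K g1 `[a, b] -> pw_smooth_curve K g2 `[c, d] -> g1 b = g2 c ->
  exists g e, [/\ a < e, pw_smooth_curve K g `[a, e], g a = g1 a & g e = g2 d].
Proof.
move=> ab cd [_ _ H1] [_ _ H2] gbc.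
pose g s := if s <= b then g1 s else g2 (s + (c - b)).
exists g, (b + (d - c)).
have gR s : b <= s -> g s = g2 (s + (c - b)).
  rewrite le_eqVlt /g => /orP[/eqP <-|bs]; last by rewrite leNgt bs.
  by rewrite lexx gbc addrC subrK.
have gL s : s <= b -> g s = g1 s by rewrite /g => ->.
have abd : a < b + (d - c) by lra.
split=> //; last 2 first.
- by rewrite gL // ltW.
- by rewrite gR; [congr g2; ring | lra].
split; first exact: interval_is_interval.
  by exists a, (b + (d - c)); split=> //; rewrite /= in_itv /= ?lexx ltW.
move=> t; rewrite /= in_itv /= => /andP[ta td].
have S2 (D : set R) : smooth_germ K g2 D (t + (c - b)) ->
  smooth_germ K (fun s => g2 (s + (c - b))) [set s | D (s + (c - b))] t.
  exact: smooth_germ_shift.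
split.
- have [tb|bt] := ltP t b.
    have tab : t \in `[a, b] by rewrite in_itv /= ta ltW.
    have [h _] := H1 t tab; move: h; apply: (@smooth_germ_congr _ _ _ _ _ (b - t)).
    + by rewrite subr_gt0.
    + by rewrite gL // ltW.
    move=> s [/=]; rewrite !in_itv /= => /andP[sa sd] ts; rewrite ger0_norm ?subr_ge0 // => sb.
    have sb' : s <= b by lra.
    by rewrite gL // sa sb'.
  have tc : (t + (c - b)) \in `[c, d] by rewrite in_itv /=; apply/andP; split; lra.
  have [h _] := H2 _ tc; have := S2 _ h.
  apply: (@smooth_germ_congr _ _ _ _ _ 1) => //; first by rewrite gR.
  move=> s [/=]; rewrite !in_itv /= => /andP[sa sd] ts _.
  rewrite gR ?(le_trans bt) //; split=> //; split; last by rewrite lerD2r.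
  by apply/andP; split; lra.
- have [bt|tb] := ltP b t.
    have tc : (t + (c - b)) \in `[c, d] by rewrite in_itv /=; apply/andP; split; lra.
    have [_ h] := H2 _ tc; have := S2 _ h.
    apply: (@smooth_germ_congr _ _ _ _ _ (t - b)) => //.
    + by rewrite subr_gt0.
    + by rewrite gR // ltW.
    move=> s [/=]; rewrite !in_itv /= => /andP[sa sd] st; rewrite ler0_norm ?subr_le0 // => sb.
    have sb' : b <= s by lra.
    rewrite gR //; split=> //; split; last by rewrite lerD2r.
    by apply/andP; split; lra.
  have tab : t \in `[a, b] by rewrite in_itv /= ta.
  have [_ h] := H1 t tab; move: h.
  apply: (@smooth_germ_congr _ _ _ _ _ 1) => //; first by rewrite gL.
  move=> s [/=]; rewrite !in_itv /= => /andP[sa sd] st _.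
  have sb : s <= b by exact: le_trans st tb.
  by rewrite gL // sa sb.
Qed.

End Germs.

Section LocallyConstant.
Variable R : realType.

(** Connectedness of an interval, for predicates that are locally constant along it; serves for the
    uniqueness of integral curves and for transport along the flow. *)
Lemma locally_constant_iff (P : R -> Prop) (a b : R) :
  (forall s, between a b s -> \forall t \near s, P s <-> P t) -> (P a <-> P b).
Proof.
wlog ab : a b / a <= b.
  move=> W H; have [|/ltW ba] := leP a b; first by move=> ?; exact: W.
  by apply: iff_sym; apply: W => // s; rewrite /between minC maxC; exact: H.
rewrite /between min_l // max_r // => H.
have [->//|anb] := eqVneq a b.
have nearr (s : R) (A : set R) : (\forall t \near s, A t) ->
    (\forall h \near (0 : R)^'+, A (s + h)) /\ (\forall h \near (0 : R)^'+, A (s - h)).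
  move=> /nbhs_normP [d /= d0 dA]; split; near=> h; apply: dA;
    have h0 : 0 < h by [near: h; exact: nbhs_right_gt];
    have hd : h < d by [near: h; exact: nbhs_right_lt].
  - by rewrite /ball_ /= opprD addrA subrr sub0r normrN gtr0_norm.
  - by rewrite /ball_ /= opprB addrC subrK gtr0_norm.
apply: (@local_to_global R (fun s t => P s <-> P t)).
- by move=> x y z h1 h2; apply: iff_trans h1 h2.
- by rewrite lt_neqAle anb.
- move=> s /andP[s1 s2]; have [|h _] := nearr s _ (H s _); last exact: h.
  by rewrite s1 ltW.
- move=> s /andP[s1 s2]; have [|_] := nearr s _ (H s _); first by rewrite s2 ltW.
  by apply: filterS => h; exact: iff_sym.
Unshelve. all: by end_near. Qed.

End LocallyConstant.

(** * Coordinate changes and points near a chart point *)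

Section Charts.
Variables (R : realType) (n : nat) (M : manifold R n.+1).
Local Notation V := 'rV[R]_n.+1.

Lemma cimg_cinv (c : chart R n.+1 M) (x : V) : cimg c x ->
  cdom c (cinv c x) /\ c (cinv c x) = x.
Proof. by move=> [p cp <-]; rewrite cfunK. Qed.

Lemma cimg_cfun (c : chart R n.+1 M) p : cdom c p -> cimg c (c p).
Proof. by move=> cp; exists p. Qed.

Lemma overlap_open (c d : chart R n.+1 M) : open (c @` (cdom c `&` cdom d)).
Proof.
rewrite openE => x [p [cp dp] <-]; rewrite /interior.
have cx : cimg c (c p) by exact: cimg_cfun.
have n1 : nbhs (c p) (cimg c) by apply: open_nbhs_nbhs; split=> //; exact: cimg_open.
have n2 : nbhs (c p) (cinv c @^-1` cdom d).
  apply: (cinv_continuous cx); rewrite cfunK //.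
  by apply: open_nbhs_nbhs; split=> //; exact: cdom_open.
apply: filterS2 n1 n2 => y /cimg_cinv [yc yE] yd.
by exists (cinv c y).
Qed.

Lemma transition_differentiable (c d : chart R n.+1 M) p :
  atlas c -> atlas d -> cdom c p -> cdom d p -> differentiable (d \o cinv c : V -> V) (c p).
Proof.
move=> ac ad cp dp.
by have [] := Ck_on1_differentiable (overlap_open (c := c) (d := d)) (atlas_smooth ac ad 1)
  (ex_intro2 _ _ p (conj cp dp) erefl).
Qed.

Lemma near_chart (c : chart R n.+1 M) (gamma : R -> M) t r : 0 < r ->
  cdom c (gamma t) -> {for t, continuous gamma} ->
  \forall s \near t, cdom c (gamma s) /\ `|c (gamma s) - c (gamma t)| < r.
Proof.
move=> r0 ct ctn; apply: filterI.
  by apply: ctn; apply: open_nbhs_nbhs; split=> //; exact: cdom_open.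
have cc : {for t, continuous (c \o gamma)}.
  by apply: continuous_comp => //; exact: cfun_continuous.
move/cvgrPdist_lt : cc => /(_ _ r0); apply: filterS => s.
by rewrite distrC.
Qed.

End Charts.

(** * Integral curves and the flow of a complete vector field *)

Section IntegralCurves.
Variables (R : realType) (n : nat) (M : manifold R n.+1) (X : vector_field M).
Local Notation V := 'rV[R]_n.+1.

Lemma is_derive_translate (W : normedModType R) (f : R -> W) (t s : R) w :
  is_derive ((t + s) : R^o) 1 (f : R^o -> W) w ->
  is_derive (s : R^o) 1 ((fun u => f (t + u)) : R^o -> W) w.
Proof.
move=> /is_derive_epsP H; apply/is_derive_epsP => e /H.
by apply: filterS => h; rewrite addrA.
Qed.

(** An equivalence, so that agreement is a locally constant predicate: disagreement is open by the
    Hausdorff property, and agreement is open by [solution_bounds] with zero initial difference. *)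
Lemma integral_curve_local_uniqueness (g1 g2 : R -> M) (I J : set R) s :
  integral_curve X g1 I -> integral_curve X g2 J -> I s -> J s ->
  \forall t \near s, g1 s = g2 s <-> g1 t = g2 t.
Proof.
move=> [_ Io _ H1] [_ Jo _ H2] Is Js.
have [c1 _] := H1 s Is; have [c2 _] := H2 s Js.
have nI : \forall t \near s, I t by apply: open_nbhs_nbhs.
have nJ : \forall t \near s, J t by apply: open_nbhs_nbhs.
have [g12|ng12] := pselect (g1 s = g2 s); last first.
  have [A [B [nA nB AB]]] : exists A B : set M, [/\ nbhs (g1 s) A, nbhs (g2 s) B & A `&` B = set0].
    apply: contrapT => nAB; apply: ng12; apply: (@manifold_hausdorff _ _ M).
    move=> A B nA nB; apply/set0P/eqP => AB.
    by apply: nAB; exists A, B.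
  have e1 : \forall t \near s, A (g1 t) by exact: c1.
  have e2 : \forall t \near s, B (g2 t) by exact: c2.
  apply: filterS2 e1 e2 => t At Bt; split=> // g12.
  by have : (A `&` B) (g1 t) by [split=> //; rewrite g12]; rewrite AB.
have [c ac cp] := atlas_cover (g1 s).
have Xs := vcomp_smooth X ac.
have [r [C [r0 C0 rU XB]]] := Ck_on1_bounds (@cimg_open _ _ _ c) (Xs 1) (cimg_cfun cp).
have cp2 : cdom c (g2 s) by rewrite -g12.
have : \forall u \near s, (I u /\ J u) /\
    ((cdom c (g1 u) /\ `|c (g1 u) - c (g1 s)| < r) /\
     (cdom c (g2 u) /\ `|c (g2 u) - c (g2 s)| < r)).
  apply: filterI; first exact: filterI.
  by apply: filterI; exact: near_chart.
move=> /nbhs_normP [d /= d0 dP].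
apply/nbhs_normP.
pose tau := Num.min d ((2 * (C + 1))^-1).
have C10 : 0 < C + 1 by rewrite ltr_wpDl.
exists tau; first by rewrite /= lt_min d0 invr_gt0 mulr_gt0.
move=> t; rewrite /ball_ /= distrC lt_min => /andP[td tC].
split=> // _.
pose a u := c (g1 (s + u)); pose b u := c (g2 (s + u)).
have sol u : `|u| < d -> [/\ cdom c (g1 (s + u)) /\ cdom c (g2 (s + u)),
   `|a u - c (g1 s)| < r /\ is_derive (u : R^o) 1 (a : R^o -> V) ((X c \o cinv c) (a u)) &
   `|b u - c (g1 s)| < r /\ is_derive (u : R^o) 1 (b : R^o -> V) ((X c \o cinv c) (b u))].
  move=> ud; have [|[Iu Ju] [[d1 r1] [d2 r2]]] := dP (s + u).
    by rewrite /ball_ /= opprD addrA subrr sub0r normrN.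
  split=> //.
    split=> //; rewrite /a /= cfunK //.
    have [_ h] := H1 _ Iu.
    exact: (@is_derive_translate _ (c \o g1) s u _ (h c ac d1)).
  split; first by rewrite g12.
  rewrite /b /= cfunK //.
  have [_ h] := H2 _ Ju.
  exact: (@is_derive_translate _ (c \o g2) s u _ (h c ac d2)).
have btw u : between 0 (t - s) u -> `|u| < d.
  by move=> /between0_norm_le h; exact: le_lt_trans td.
have tC' : (2 * (C + 1))^-1 * C <= 1 / 2.
  rewrite invfM -mulrA mul1r; apply: ler_piMr; first by rewrite invr_ge0.
  by rewrite mulrC ler_pdivrMr // mul1r lerDl.
have sa : solution (X c \o cinv c) (c (g1 s)) r (t - s) a by move=> u /btw /sol [].
have sb : solution (X c \o cinv c) (c (g1 s)) r (t - s) b by move=> u /btw /sol [].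
have bt := between_right 0 (t - s).
have [|h _] := solution_bounds C0 tC' _ sa sb (ltW tC) bt.
  by move=> x y xr yr; have [_ _] := XB _ _ xr yr.
have ab0 : b 0 - a 0 = 0 by rewrite /a /b addr0 g12 subrr.
move: h; rewrite ab0 normr0 mulr0 normr_le0 subr_eq0 /a /b addrC subrK => /eqP E.
have [[k1 k2] _ _] := sol _ td.
move: k1 k2; rewrite addrC subrK => k1 k2.
by rewrite -(cfunK k1) -(cfunK k2) E.
Qed.

Lemma integral_curve_unique (g1 g2 : R -> M) (I J : set R) s t :
  integral_curve X g1 I -> integral_curve X g2 J -> I s -> J s -> I t -> J t ->
  g1 s = g2 s -> g1 t = g2 t.
Proof.
move=> i1 i2 Is Js It Jt; apply: (locally_constant_iff (P := fun u => g1 u = g2 u) _).1 => u su.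
have btw (K : set R) : is_interval K -> K s -> K t -> K u.
  move=> iK Ks Kt; move: su; rewrite /between; case: (leP s t) => _ h.
    exact: (iK s t).
  exact: (iK t s).
have [[ii1 _ _ _] [ii2 _ _ _]] := (i1, i2).
by apply: (integral_curve_local_uniqueness i1 i2); apply: btw.
Qed.

Lemma integral_curve_of_chart (c : chart R n.+1 M) (y : R -> V) (tau : R) : atlas c -> 0 < tau ->
  (forall t : R, `|t| < tau -> cimg c (y t) /\
     is_derive (t : R^o) 1 (y : R^o -> V) ((X c \o cinv c) (y t))) ->
  integral_curve X (cinv c \o y) [set t | `|t| < tau].
Proof.
move=> ac tau0 H; split.
- move=> x z /= xt zt u /andP[xu uz]; move: xt zt; rewrite !ltr_norml => /andP[? ?] /andP[? ?].
  by apply/andP; split; lra.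
- have -> : [set t : R | `|t| < tau] = ball 0 tau.
    by apply/seteqP; split => t; rewrite -ball_normE /ball_ /= sub0r normrN.
  exact: ball_open.
- by exists 0; rewrite /= normr0.
move=> t tt; have [yt dy] := H t tt; split.
  apply: continuous_comp; first exact: is_derive_continuous dy.
  exact: cinv_continuous.
move=> d ad dt; have [ct E] := cimg_cinv yt; rewrite /= in dt *.
have df := transition_differentiable ac ad ct dt; rewrite E in df.
have := is_derive_comp df dy.
rewrite (deriveEjacobian _ df) (vcomp_change X ac ad ct dt) /transition E.
by apply.
Qed.

Lemma integral_curve_chart_ball (c : chart R n.+1 M) (z0 : V) (r : R) :
  atlas c -> cimg c z0 -> 0 < r ->
  exists r0 tau, [/\ 0 < r0, 0 < tau & forall p, cdom c p -> `|c p - z0| < r0 ->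
    exists g, [/\ integral_curve X g [set t | `|t| < tau], g 0 = p &
      forall t, `|t| < tau -> cdom c (g t) /\ `|c (g t) - z0| < r]].
Proof.
move=> ac cz r0.
have nz : \forall z \near z0, cimg c z.
  by apply: open_nbhs_nbhs; split=> //; exact: cimg_open.
have /nbhs_normP [r1 /= r10 r1P] := nz.
have m0 : 0 < Num.min r r1 by rewrite lt_min r0.
have [tau [rho [tau0 rho0 H]]] :=
  picard_lindelof (@cimg_open _ _ _ c) (vcomp_smooth X ac 1) cz m0.
exists rho, tau; split=> // p cp /H [y [y0 yP]].
have yc t : `|t| < tau -> cimg c (y t).
  by move=> /yP [yr _]; apply: r1P; rewrite /ball_ /= distrC; move: yr; rewrite lt_min => /andP[].
exists (cinv c \o y); split.
- by apply: integral_curve_of_chart => // t tt; split; [exact: yc | have [] := yP t tt].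
- by rewrite /= y0 cfunK.
move=> t tt; have [h1 h2] := cimg_cinv (yc t tt); rewrite /= h2; split=> //.
by have [+ _] := yP t tt; rewrite lt_min => /andP[].
Qed.

Lemma integral_curve_congr (g g' : R -> M) (I J : set R) :
  integral_curve X g I -> is_interval J -> open J -> J !=set0 -> J `<=` I ->
  (forall t, J t -> g' t = g t) -> integral_curve X g' J.
Proof.
move=> [_ _ _ H] iJ oJ nJ JI E; split=> // t Jt; have [cg dg] := H t (JI t Jt).
have nE : \forall s \near t, g s = g' s.
  have : \forall s \near t, J s by exact: open_nbhs_nbhs.
  by apply: filterS => s /E.
split.
  rewrite /prop_for/= /continuous_at E //.
  by apply: cvg_trans cg; apply: near_eq_cvg.
move=> c ac; rewrite E // => cgt.
apply: (@near_eq_is_derive _ _ _ (c \o g : R^o -> V)); last exact: dg.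
by apply: filterS nE => s /= ->.
Qed.

(** Completeness speaks of maximal curves, so one has to be produced: the union of all integral
    curves through p at time 0, coherent by uniqueness. *)
Lemma maximal_integral_curve_exists p :
  exists g I, [/\ maximal_integral_curve X g I, I 0 & g 0 = p].
Proof.
pose W t (gJ : (R -> M) * set R) := [/\ integral_curve X gJ.1 gJ.2, gJ.2 0, gJ.1 0 = p & gJ.2 t].
pose I := [set t | exists gJ, W t gJ].
have [c ac cp] := atlas_cover p.
have [r0 [tau [r00 tau0 H]]] := integral_curve_chart_ball ac (cimg_cfun cp) ltr01.
have [g0 [ig0 g00 _]] := H p cp (eq_ind _ (fun x => x < r0) r00 _ (esym (eq_trans (congr1 _ (subrr _)) (normr0 _)))).
have W0 : W 0 (g0, [set t | `|t| < tau]) by split=> //=; rewrite normr0.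
(* Outside I the pair is arbitrary. *)
have ex t : exists gJ, I t -> W t gJ.
  by have [[gJ h]|nt] := pselect (I t); [exists gJ | exists (g0, setT)].
have [w wP] := choice ex.
pose g t := (w t).1 t.
have gE gJ t : W t gJ -> g t = gJ.1 t.
  move=> h; have [i1 z1 p1 t1] := wP t (ex_intro _ gJ h); have [i2 z2 p2 t2] := h.
  by apply: (integral_curve_unique i1 i2 z1 z2) => //; rewrite p1 p2.
have I0 : I 0 by exists (g0, [set t | `|t| < tau]).
have WI t u gJ : W t gJ -> gJ.2 u -> W u gJ by move=> [? ? ? ?] ?; split.
have Io : open I.
  rewrite openE => t [gJ h]; have [[_ oJ _ _] _ _ Jt] := h.
  have : nbhs t gJ.2 by exact: open_nbhs_nbhs.
  by apply: filterS => u Ju; exists gJ; exact: (WI t).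
have Ii : is_interval I.
  move=> x z Ix Iz y /andP[xy yz]; have [y0|/ltW y0] := leP 0 y.
    have [gJ h] := Iz; have [[iJ _ _ _] J0 _ Jz] := h.
    by exists gJ; apply: (WI z) => //; apply: (iJ 0 z) => //; rewrite y0.
  have [gJ h] := Ix; have [[iJ _ _ _] J0 _ Jx] := h.
  by exists gJ; apply: (WI x) => //; apply: (iJ x 0) => //; rewrite xy.
have g0p : g 0 = p by rewrite (gE _ _ W0).
have ig : integral_curve X g I.
  split=> //; first by exists 0.
  move=> t [gJ h]; have [iJ J0 Jp Jt] := h; have [iiJ oJ nJ _] := iJ.
  have [_ _ _ H'] := integral_curve_congr iJ iiJ oJ nJ (@subset_refl _ _)
    (fun u Ju => gE gJ u (WI t u gJ h Ju)).
  exact: H'.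
exists g, I; split=> //; split=> // d J iJ IJ dE t Jt.
by exists (d, J); split=> //=; [exact: IJ | rewrite dE].
Qed.

Lemma complete_flow : complete_field X -> exists phi : R -> M -> M,
  (forall p, phi 0 p = p) /\ forall p, integral_curve X (phi^~ p) setT.
Proof.
move=> Xc.
have ex p : exists g : R -> M, g 0 = p /\ integral_curve X g setT.
  have [g [I [mg I0 g0]]] := maximal_integral_curve_exists p.
  by exists g; split=> //; rewrite -(Xc _ _ mg); case: mg.
have [f fP] := choice ex.
by exists (fun t p => f p t); split=> p; have [] := fP p.
Qed.

Lemma integral_curve_translate (g : R -> M) s :
  integral_curve X g setT -> integral_curve X (fun t => g (s + t)) setT.
Proof.
move=> [h1 h2 h3 H]; split=> // t _; have [cg dg] := H (s + t) I; split.
  apply: (@continuous_comp _ _ _ (fun u : R => s + u) g) => //.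
  by apply: continuousD; [exact: cst_continuous | exact: cvg_id].
by move=> c ac ct; exact: (@is_derive_translate _ (c \o g) s t _ (dg c ac ct)).
Qed.

Lemma flow_add (phi : R -> M -> M) s t p : (forall p, phi 0 p = p) ->
  (forall p, integral_curve X (phi^~ p) setT) -> phi (s + t) p = phi t (phi s p).
Proof.
move=> p0 ip.
apply: (integral_curve_unique (s := 0) (integral_curve_translate s (ip p)) (ip (phi s p))) => //.
by rewrite addr0 p0.
Qed.

Lemma flow_chart_ball (phi : R -> M -> M) (c : chart R n.+1 M) (z0 : V) (r : R) :
  (forall p, phi 0 p = p) -> (forall p, integral_curve X (phi^~ p) setT) ->
  atlas c -> cimg c z0 -> 0 < r ->
  exists r0 tau, [/\ 0 < r0, 0 < tau & forall p, cdom c p -> `|c p - z0| < r0 ->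
    forall t, `|t| < tau -> cdom c (phi t p) /\ `|c (phi t p) - z0| < r].
Proof.
move=> p0 ip ac cz r0; have [r1 [tau [r10 tau0 H]]] := integral_curve_chart_ball ac cz r0.
exists r1, tau; split=> // p cp pr t tt; have [g [ig g0 gP]] := H p cp pr.
have -> : phi t p = g t.
  apply: (integral_curve_unique (s := 0) (ip p) ig) => //=; first by rewrite normr0.
  by rewrite p0 g0.
exact: gP.
Qed.

End IntegralCurves.

(** * The chronological relation *)

Section Chronology.
Variables (R : realType) (n : nat) (M : spacetime R n).
Local Notation V := 'rV[R]_n.+1.
Implicit Types (c d : chart R n.+1 M) (p q : M).

Definition Gc c : V -> 'M[R]_n.+1 := metric M c \o cinv c.
Definition Tc c : V -> V := torient M c \o cinv c.

Lemma Gc_nonorth c x v w : atlas c -> cimg c x ->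
  form (Gc c x) v v < 0 -> form (Gc c x) w w < 0 -> form (Gc c x) v w != 0.
Proof.
move=> ac /cimg_cinv [cx _].
have [P Pu PG] := mcomp_lorentz (metric M) ac cx.
exact: form_nonorth Pu PG.
Qed.

Lemma Tc_timelike c x : atlas c -> cimg c x -> form (Gc c x) (Tc c x) (Tc c x) < 0.
Proof. by move=> ac /cimg_cinv [cx _]; exact: (torient_timelike ac cx). Qed.

Lemma Gc_smooth c : atlas c -> smooth_on (cimg c) (Gc c).
Proof. exact: mcomp_smooth. Qed.

Lemma Tc_smooth c : atlas c -> smooth_on (cimg c) (Tc c).
Proof. exact: vcomp_smooth. Qed.

Definition tcone c k p q := cone (Tc c) (Gc c) k (c p) (c q - c p).

Lemma chron_trans : forall p q r : M, chron p q -> chron q r -> chron p r.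
Proof.
move=> p q r [g1 [a [b [ab c1 <- <-]]]] [g2 [c [d [cd c2 E <-]]]].
have [g [e [ae cg ga ge]]] := pw_smooth_curve_cat ab cd c1 c2 (esym E).
by exists g, a, e.
Qed.

Lemma cone_neq0 c k x v : cone (Tc c) (Gc c) k x v -> 0 < `|v|.
Proof.
move=> [_ h]; rewrite normr_gt0; apply: contraTneq h => ->.
by rewrite form0l ltxx.
Qed.

Lemma cone_segment c z0 k : atlas c -> cimg c z0 -> 0 < k ->
  exists r, [/\ 0 < r, forall x, `|x - z0| < r -> cimg c x &
   forall a b, `|a - z0| < r -> `|b - z0| < r -> cone (Tc c) (Gc c) k a (b - a) ->
   forall s, 0 <= s <= 1 ->
     form (Gc c (a + s *: (b - a))) (b - a) (b - a) < 0 /\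
     form (Gc c (a + s *: (b - a))) (b - a) (Tc c (a + s *: (b - a))) < 0].
Proof.
move=> ac cz k0.
have G1 := Gc_smooth ac 1.
have [r1 [C [r10 C0 r1U B]]] := Ck_on1_bounds (@cimg_open _ _ _ c) G1 cz.
pose N : R := (n.+1)%:R ^+ 2.
have N0 : 0 < N by rewrite exprn_gt0 // ltr0n.
have C10 : 0 < C + 1 by rewrite ltr_wpDl.
(* Then N C |v| <= k whenever |v| < 2 r, so the change of the metric along the segment does not use
   up the margin k |v|^2 available at a. *)
pose r := Num.min r1 (k / (2 * N * (C + 1))).
have r0 : 0 < r by rewrite lt_min r10 divr_gt0 // !mulr_gt0.
have rr1 x : `|x - z0| < r -> `|x - z0| < r1 by rewrite lt_min => /andP[].
exists r; split=> //; first by move=> x /rr1 /r1U.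
move=> a b ar br cab.
have v0 := cone_neq0 cab; case: cab => Q0 T0.
set v := b - a in v0 Q0 T0 *.
have vr : `|v| < 2 * r.
  have -> : v = (b - z0) - (a - z0) by rewrite opprB addrA subrK.
  by apply: le_lt_trans (ler_normB _ _) _; lra.
have Q s : 0 <= s <= 1 -> form (Gc c (a + s *: v)) v v < 0.
  move=> s01; have xr := segment_in_ball ar br s01.
  have [_ _ L] := B _ _ (rr1 _ ar) (rr1 _ xr).
  have E : form (Gc c (a + s *: v)) v v = form (Gc c a) v v +
      form (Gc c (a + s *: v) - Gc c a) v v by rewrite -formDG [Gc c a + _]addrC subrK.
  have F : form (Gc c (a + s *: v) - Gc c a) v v <= N * (C * `|v| * `|v| * `|v|).
    apply: le_trans (ler_norm _) _; apply: le_trans (form_le _ _ _) _.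
    rewrite ler_wpM2l ?(ltW N0) //; apply: ler_wpM2r => //; apply: ler_wpM2r => //.
    apply: le_trans L _; rewrite ler_wpM2l // addrC addKr normrZ.
    by case/andP: s01 => s0 s1; rewrite ger0_norm // ler_piMl.
  have k2 : 2 * N * (C + 1) * r <= k.
    rewrite mulrC -ler_pdivlMr ?mulr_gt0 //.
    by rewrite /r ge_min lexx orbT.
  have h : N * C * `|v| <= k.
    apply: le_trans k2; have : N * (C + 1) * `|v| <= N * (C + 1) * (2 * r).
      by apply: ler_wpM2l; [rewrite mulr_ge0 ?ltW | exact: ltW].
    have : N * C * `|v| <= N * (C + 1) * `|v|.
      by apply: ler_wpM2r => //; apply: ler_wpM2l; [exact: ltW | rewrite lerDl].
    lra.
  have : N * (C * `|v| * `|v| * `|v|) <= k * `|v| ^+ 2.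
    have -> : N * (C * `|v| * `|v| * `|v|) = N * C * `|v| * `|v| ^+ 2 by ring.
    by rewrite ler_wpM2r ?exprn_ge0.
  rewrite E; move: Q0 F; rewrite mulNr; lra.
move=> s s01; split; first exact: Q.
have x0 : a = a + 0 *: v by rewrite scale0r addr0.
rewrite {1 2}x0 in T0.
apply: (sign_persistence (f := fun s => form (Gc c (a + s *: v)) v (Tc c (a + s *: v))) _ T0) => u su.
have u01 : 0 <= u <= 1.
  case/andP: s01 => s0 s1; move: su; rewrite /between min_l // max_r // => /andP[u0 us].
  by rewrite u0 (le_trans us).
have cx : cimg c (a + u *: v) by apply/r1U/rr1; exact: segment_in_ball.
have cl : {for u, continuous (fun s : R => a + s *: v)}.
  exact: is_derive_continuous (is_derive_affine a v u 1).
split.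
  apply: form_cvg; last 2 first.
  - exact: cvg_cst.
  - by apply: (@continuous_comp _ _ _ (fun s : R => a + s *: v) (Tc c)); [exact: cl | exact: ((Tc_smooth ac 0).1 _ cx)].
  - by apply: (@continuous_comp _ _ _ (fun s : R => a + s *: v) (Gc c)); [exact: cl | exact: (G1.1 _ cx)].
by apply: Gc_nonorth => //; [exact: Q | exact: Tc_timelike].
Qed.

(** The coordinate segment from a to b is itself a future timelike curve, provided both points are
    close enough to p, in terms of k. *)
Lemma cone_chron c p k : atlas c -> cdom c p -> 0 < k ->
  \forall a \near p & b \near p, tcone c k a b -> chron a b.
Proof.
move=> ac cp k0.
have [r [r0 rU H]] := cone_segment ac (cimg_cfun cp) k0.
have nW : \forall a \near p, cdom c a /\ `|c a - c p| < r.
  apply: filterI; first by apply: open_nbhs_nbhs; split=> //; exact: cdom_open.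
  have /cvgrPdist_lt /(_ _ r0) := cfun_continuous cp.
  by apply: filterS => a; rewrite distrC.
exists ([set a | cdom c a /\ `|c a - c p| < r], [set a | cdom c a /\ `|c a - c p| < r]) => //.
move=> [a b] /= [[ca ar] [cb br]] cab.
have P := H _ _ ar br cab.
pose v := c b - c a.
exists (fun s => cinv c (c a + s *: v)), 0, 1; split=> //; last 2 first.
- by rewrite scale0r addr0 cfunK.
- by rewrite scale1r addrC subrK cfunK.
split; first exact: interval_is_interval.
  by exists 0, 1; split=> //=; rewrite in_itv /= ?lexx ?ler01.
move=> t; rewrite /= in_itv /= => t01.
have G (D : set R) : (forall s, D s -> 0 <= s <= 1) -> smooth_germ
    (fun c p v => timelike_vect c p v /\ future_vect c p v) (fun s => cinv c (c a + s *: v)) D t.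
  move=> D01; exists c, (fun s => c a + s *: v), 1; split=> //.
  - exact: smooth_on_affine.
  - move=> s /D01 s01 _; apply: cimg_cinv; apply: rU; exact: segment_in_ball.
  have [_ ->] := is_derive_affine (c a) v t 1; rewrite scale1r.
  exact: P.
by split; apply: G => s [/=]; rewrite in_itv.
Qed.

(* The pairs (f h).1, (f h).2 collapse to p as h tends to 0+, and their
   difference in c is future timelike, uniformly away from the light cone. *)
Definition timelike_pair c (f : R -> M * M) p := [/\ cdom c p,
  (f h).1 @[h --> 0^'+] --> p, (f h).2 @[h --> 0^'+] --> p &
  exists2 k, 0 < k & \forall h \near 0^'+, tcone c k (f h).1 (f h).2].

Lemma timelike_pair_chron c f p : atlas c -> timelike_pair c f p ->
  \forall h \near 0^'+, chron (f h).1 (f h).2.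
Proof.
move=> ac [cp f1 f2 [k k0 fk]].
have [[A B] /= [nA nB] AB] := cone_chron ac cp k0.
have h1 : \forall h \near 0^'+, A (f h).1 by exact: f1.
have h2 : \forall h \near 0^'+, B (f h).2 by exact: f2.
apply: filterS3 h1 h2 fk => h hA hB; exact: (AB ((f h).1, (f h).2)).
Qed.

Lemma near_cdom c p r : cdom c p -> 0 < r ->
  \forall q \near p, cdom c q /\ `|c q - c p| < r.
Proof.
move=> cp r0; apply: filterI; first by apply: open_nbhs_nbhs; split=> //; exact: cdom_open.
have /cvgrPdist_lt /(_ _ r0) := cfun_continuous cp.
by apply: filterS => a; rewrite distrC.
Qed.

(** The difference in d is J v + O(|v|^2), with J the Jacobian at the first point. J v has the same
    products as v by the transformation law of the metric, so g(v, v) changes by O(|v|^3); the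
    orientation follows by deforming J v into the true difference. *)
Lemma timelike_pair_change c d f p : atlas c -> atlas d -> cdom d p ->
  timelike_pair c f p -> timelike_pair d f p.
Proof.
move=> ac ad dp [cp f1 f2 [k k0 fk]].
split=> //.
have C2 := atlas_smooth ac ad 2.
have W0 : (c @` (cdom c `&` cdom d)) (c p) by exists p.
have [r [C [r0 C0 _ B]]] := Ck_on2_bounds (overlap_open (c := c) (d := d)) C2 W0.
have [r' [C' [r'0 C'0 _ B']]] := Ck_on1_bounds (@cimg_open _ _ _ d) (Gc_smooth ad 1) (cimg_cfun dp).
pose N : R := (n.+1)%:R ^+ 2.
have N0 : 0 < N by rewrite exprn_gt0 // ltr0n.
(* Three error terms, g(j, e), g(e, j) and g(e, e), each at most N C' C^2 |v|^3 when |v| < 1; the 1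
   keeps L positive. With |v| < del they cost at most half of k, and |j + e| <= C |v| converts the
   rest into k'. *)
pose L := N * C' * C ^+ 2 * 3 + 1.
have L0 : 0 < L by rewrite ltr_wpDl // !mulr_ge0 ?exprn_ge0 // ltW.
pose del := Num.min 1 (k / (2 * L)).
have del0 : 0 < del by rewrite lt_min ltr01 divr_gt0 // mulr_gt0.
pose k' := k / (4 * (C ^+ 2 + 1)).
have CC0 : 0 < C ^+ 2 + 1 by rewrite ltr_wpDl // exprn_ge0.
have k'0 : 0 < k' by rewrite divr_gt0 // mulr_gt0.
exists k' => //.
have m0 : 0 < Num.min r (del / 2) by rewrite lt_min r0 divr_gt0.
have near_pt : \forall q \near p, (cdom c q /\ `|c q - c p| < Num.min r (del / 2)) /\
    (cdom d q /\ `|d q - d p| < r').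
  by apply: filterI; exact: near_cdom.
have h1 : \forall h \near 0^'+, _ := f1 _ near_pt.
have h2 : \forall h \near 0^'+, _ := f2 _ near_pt.
apply: filterS3 h1 h2 fk => h; set A := (f h).1; set Bp := (f h).2.
rewrite /= => -[[cA]]; rewrite lt_min => /andP[rA delA] [dA r'A].
move=> [[cB]]; rewrite lt_min => /andP[rB delB] [dB r'B] kAB.
have v0 := cone_neq0 kAB; case: kAB; rewrite /Gc /Tc /= cfunK // => Q0 T0.
set v := c Bp - c A in v0 Q0 T0.
have [_ DA LAB QAB] := B _ _ rA rB.
have [GA _ _] := B' _ _ r'A r'A.
move: GA LAB QAB; rewrite /Gc /= !cfunK // => GA LAB QAB.
have Dv := DA v.
have dfA := transition_differentiable ac ad cA dA.
have J : 'D_v (d \o cinv c) (c A) = v *m transition c d A by exact: deriveEjacobian.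
set e := d Bp - d A - _ in QAB.
set j := 'D_v _ _ in J Dv e QAB.
have we : d Bp - d A = j + e by rewrite /e [RHS]addrC subrK.
clearbody e; clearbody j.
have vdel : `|v| < del.
  have -> : v = (c Bp - c p) - (c A - c p) by rewrite opprB addrA subrK.
  by apply: le_lt_trans (ler_normB _ _) _; lra.
have v1 : `|v| < 1 by move: vdel; rewrite lt_min => /andP[].
have vL : L * `|v| < k / 2.
  rewrite mulrC -ltr_pdivlMr //; move: vdel; rewrite lt_min => /andP[_] h1'.
  by rewrite -mulrA -invfM.
pose g := metric M d A.
have Qj : form g j j = form (metric M c A) v v.
  by rewrite J (mcomp_change (metric M) ac ad cA dA) formMr formMl.
have Tj : form g j (torient M d A) = form (metric M c A) v (torient M c A).
  by rewrite J (vcomp_change (torient M) ac ad cA dA) (mcomp_change (metric M) ac ad cA dA)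
    formMr formMl.
have fb x y a b : `|x| <= a -> `|y| <= b -> `|form g x y| <= N * (C' * a * b).
  move=> xa yb; apply: le_trans (form_le _ _ _) _; rewrite ler_wpM2l ?(ltW N0) //.
  by apply: ler_pM; rewrite ?mulr_ge0 //; apply: ler_pM.
have e1 := fb _ _ _ _ Dv QAB; have e2 := fb _ _ _ _ QAB Dv; have e3 := fb _ _ _ _ QAB QAB.
have Qs s : 0 <= s <= 1 -> form g (j + s *: e) (j + s *: e) < - (k / 2) * `|v| ^+ 2.
  move=> /andP[s0 s1].
  have -> : form g (j + s *: e) (j + s *: e) =
     form g j j + s * (form g j e + form g e j) + s * s * form g e e.
    by rewrite !formDl !formDr !formZl !formZr; ring.
  have b1 : s * (form g j e + form g e j) <= 2 * (N * (C' * (C * `|v|) * (C * `|v| ^+ 2))).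
    apply: le_trans (ler_norm _) _; rewrite normrM (ger0_norm s0).
    apply: (@le_trans _ _ (1 * `|form g j e + form g e j|)); first by rewrite ler_wpM2r.
    rewrite mul1r; apply: le_trans (ler_normD _ _) _.
    apply: le_trans (lerD e1 e2) _; rewrite le_eqVlt; apply/orP; left; apply/eqP; ring.
  have b2 : s * s * form g e e <= N * (C' * (C * `|v| ^+ 2) * (C * `|v| ^+ 2)).
    apply: le_trans (ler_norm _) _; rewrite normrM ger0_norm ?mulr_ge0 //.
    apply: le_trans e3; rewrite ler_piMl //.
    by rewrite -[leRHS]mulr1; apply: ler_pM.
  have b3 : N * (C' * (C * `|v| ^+ 2) * (C * `|v| ^+ 2)) <= N * (C' * (C * `|v|) * (C * `|v| ^+ 2)).
    rewrite ler_wpM2l ?(ltW N0) //; apply: ler_wpM2r; first by rewrite mulr_ge0 ?exprn_ge0.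
    apply: ler_wpM2l => //; apply: ler_wpM2l => //.
    by rewrite expr2 ler_piMl // ltW.
  have b4 : L * `|v| * `|v| ^+ 2 <= k / 2 * `|v| ^+ 2 by rewrite ler_wpM2r ?exprn_ge0 // ltW.
  have b5 : 3 * (N * (C' * (C * `|v|) * (C * `|v| ^+ 2))) <= L * `|v| * `|v| ^+ 2.
    have -> : L * `|v| * `|v| ^+ 2 = 3 * (N * (C' * (C * `|v|) * (C * `|v| ^+ 2))) + `|v| ^+ 3.
      by rewrite /L; ring.
    by rewrite lerDl exprn_ge0.
  rewrite Qj; move: b1 b2 b3 b4 b5 Q0; rewrite !mulNr.
  set X1 := s * _; set X2 := s * s * _; set X3 := N * _; set X4 := N * _; set X5 := L * _ * _.
  set W := `|v| ^+ 2; set Z := form _ v v.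
  clearbody X1 X2 X3 X4 X5 W Z; lra.
split.
  rewrite /Gc /Tc /= cfunK // we.
  have := Qs 1; rewrite scale1r lexx ler01 => /(_ isT) h1'.
  apply: lt_le_trans h1' _; rewrite !mulNr lerN2 -we.
  have w2 : `|d Bp - d A| ^+ 2 <= C ^+ 2 * `|v| ^+ 2.
    by rewrite -exprMn lerXn2r ?nnegrE ?mulr_ge0.
  apply: (@le_trans _ _ (k' * (C ^+ 2 * `|v| ^+ 2))); first by rewrite ler_wpM2l // ltW.
  rewrite mulrA ler_wpM2r ?exprn_ge0 // /k'.
  rewrite mulrAC ler_pdivrMr ?mulr_gt0 // -[k / 2 * _]mulrA ler_wpM2l ?(ltW k0) //.
  have : 0 <= C ^+ 2 by rewrite exprn_ge0.
  by move: (C ^+ 2) => Y Y0; lra.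
rewrite /Gc /Tc /= cfunK // we -[e]scale1r -/g.
have T0' : form g (j + 0 *: e) (torient M d A) < 0 by rewrite scale0r addr0 Tj.
apply: (sign_persistence (f := fun s => form g (j + s *: e) (torient M d A)) _ T0') => s.
rewrite /between min_l // max_r // => s01; split.
  apply: form_cvg; [exact: cvg_cst | | exact: cvg_cst].
  exact: is_derive_continuous (is_derive_affine j e s 1).
have dx : cimg d (d A) by exact: cimg_cfun.
have E : g = Gc d (d A) by rewrite /Gc /= cfunK.
have E' : torient M d A = Tc d (d A) by rewrite /Tc /= cfunK.
rewrite E E'; apply: Gc_nonorth => //; last exact: Tc_timelike.
rewrite -E; apply: lt_le_trans (Qs s s01) _.
by rewrite mulNr oppr_le0 mulr_ge0 ?exprn_ge0 // divr_ge0 // ltW.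
Qed.

End Chronology.

(** * Timelike pairs from one-sided velocities *)

Section Pairs.
Variables (R : realType) (n : nat) (M : spacetime R n).
Local Notation V := 'rV[R]_n.+1.
Implicit Types (c d : chart R n.+1 M) (p q : M).

Lemma cone_near (T : Type) (F : set_system T) {FF : Filter F} c k a0 v0 (a v : T -> V) :
  atlas c -> cimg c a0 -> a x @[x --> F] --> a0 -> v x @[x --> F] --> v0 ->
  cone (Tc c) (Gc c) k a0 v0 -> \forall x \near F, cone (Tc c) (Gc c) k (a x) (v x).
Proof.
move=> ac ca aF vF [Q0 T0].
have cG : Gc c (a x) @[x --> F] --> Gc c a0.
  by apply: (@cvg_comp _ _ _ a (Gc c) F (nbhs a0)) => //; exact: ((Gc_smooth ac 0).1 _ ca).
have cT : Tc c (a x) @[x --> F] --> Tc c a0.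
  by apply: (@cvg_comp _ _ _ a (Tc c) F (nbhs a0)) => //; exact: ((Tc_smooth ac 0).1 _ ca).
have neg (f : T -> R) l : f x @[x --> F] --> l -> l < 0 -> \forall x \near F, f x < 0.
  by move=> fl l0; apply: (cvgr_lt l fl).
have h1 := neg _ _ (form_cvg cG vF cT) T0.
have cn : (form (Gc c (a x)) (v x) (v x) + k * (`|v x| * `|v x|)) @[x --> F] -->
    form (Gc c a0) v0 v0 + k * (`|v0| * `|v0|).
  apply: cvgD; first exact: form_cvg.
  apply: cvgM; first exact: cvg_cst.
  by apply: cvgM; exact: cvg_norm.
have h2 : \forall x \near F, form (Gc c (a x)) (v x) (v x) + k * (`|v x| * `|v x|) < 0.
  by apply: (neg _ _ cn); move: Q0; rewrite mulNr -expr2; lra.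
near=> x; split; last by near: x; exact: h1.
have : form (Gc c (a x)) (v x) (v x) + k * (`|v x| * `|v x|) < 0 by near: x; exact: h2.
by rewrite mulNr -expr2; lra.
Unshelve. all: by end_near. Qed.

Lemma cone_scale c k a v h : 0 < h -> cone (Tc c) (Gc c) k a v ->
  cone (Tc c) (Gc c) k a (h *: v).
Proof.
move=> h0 [Q0 T0]; split.
  have -> : form (Gc c a) (h *: v) (h *: v) = h ^+ 2 * form (Gc c a) v v.
    by rewrite formZl formZr expr2 mulrA.
  have -> : - k * `|h *: v| ^+ 2 = h ^+ 2 * (- k * `|v| ^+ 2).
    by rewrite normrZ (gtr0_norm h0) exprMn mulrCA.
  by rewrite ltr_pM2l ?exprn_gt0.
by rewrite formZl pmulr_rlt0.
Qed.

(** The quotient (be h - al h) / h tends to wb - wa; the cone is open, which gives the claim for the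
    quotient, and invariant under scaling, which gives it for the difference. *)
Lemma derive_timelike_pair c p (f : R -> M * M) (al be : R -> V) wa wb :
  atlas c -> cdom c p ->
  (\forall h \near 0^'+, [/\ cdom c (f h).1, cdom c (f h).2, c (f h).1 = al h & c (f h).2 = be h]) ->
  al 0 = c p -> be 0 = c p ->
  is_derive (0 : R^o) 1 (al : R^o -> V) wa -> is_derive (0 : R^o) 1 (be : R^o -> V) wb ->
  form (metric M c p) (wb - wa) (wb - wa) < 0 ->
  form (metric M c p) (wb - wa) (torient M c p) < 0 ->
  timelike_pair c f p.
Proof.
move=> ac cp fE al0 be0 dal dbe Q0 T0.
have cx : cimg c (c p) by exact: cimg_cfun.
have cvg_right (y : R -> V) w : y 0 = c p -> is_derive (0 : R^o) 1 (y : R^o -> V) w ->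
    y h @[h --> 0^'+] --> c p.
  move=> <- dy; apply: cvg_at_right_filter; exact: is_derive_continuous dy.
have cvg_pt (y : R -> V) w (g : R -> M) : y 0 = c p -> is_derive (0 : R^o) 1 (y : R^o -> V) w ->
    (\forall h \near 0^'+, cdom c (g h) /\ c (g h) = y h) -> g h @[h --> 0^'+] --> p.
  move=> y0 dy gE.
  have : cinv c (y h) @[h --> 0^'+] --> cinv c (c p).
    apply: (@cvg_comp _ _ _ y (cinv c) _ (nbhs (c p))); first exact: cvg_right dy.
    exact: cinv_continuous.
  rewrite cfunK //; apply: cvg_trans; apply: near_eq_cvg.
  by apply: filterS gE => h [cg E]; rewrite -E cfunK.
split=> //.
- by apply: cvg_pt dal _ => //; apply: filterS fE => h [].
- by apply: cvg_pt dbe _ => //; apply: filterS fE => h [].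
set w := wb - wa in Q0 T0.
(* Chosen so that k |w|^2 is less than half of - g(w, w). *)
pose k := - form (metric M c p) w w / (2 * (`|w| ^+ 2 + 1)).
have w1 : 0 < `|w| ^+ 2 + 1 by rewrite ltr_wpDl // exprn_ge0.
have k0 : 0 < k by rewrite divr_gt0 ?oppr_gt0 // mulr_gt0.
exists k => //.
have cw : cone (Tc c) (Gc c) k (c p) w.
  split; rewrite /Gc /Tc /= cfunK //.
  have E : k * (2 * (`|w| ^+ 2 + 1)) = - form (metric M c p) w w.
    by rewrite /k divfK // gt_eqF // mulr_gt0.
  have : 0 <= k * `|w| ^+ 2 by rewrite mulr_ge0 ?exprn_ge0 // ltW.
  by move: E Q0 k0; rewrite mulNr; move: (form _ _ _) (`|w| ^+ 2) => x y; nra.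
have cu : (fun h : R => h^-1 *: (be h - al h)) h @[h --> 0^'+] --> w.
  apply/cvgrPdist_le => e e0.
  have dd : is_derive (0 : R^o) 1 ((fun s => be s - al s) : R^o -> V) w by exact: is_deriveB.
  have /nbhs_normP [r /= r0 rP] := (is_derive_epsP _ _ _).1 dd e e0.
  near=> h.
  have h0 : 0 < h by near: h; exact: nbhs_right_gt.
  have hr : h < r by near: h; exact: nbhs_right_lt.
  have := rP h; rewrite /ball_ /= sub0r normrN gtr0_norm // => /(_ hr).
  rewrite add0r al0 be0 subrr subr0 => le.
  have -> : w - h^-1 *: (be h - al h) = - h^-1 *: (be h - al h - h *: w).
    rewrite [RHS]scalerBr [- h^-1 *: (h *: w)]scalerA mulNr mulVf ?gt_eqF //.
    by rewrite scaleN1r opprK scaleNr addrC.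
  by rewrite normrZ normrN gtr0_norm ?invr_gt0 // mulrC ler_pdivrMr.
have near1 : \forall h \near (0 : R)^'+, cone (Tc c) (Gc c) k (al h) (h^-1 *: (be h - al h)).
  exact: (cone_near ac cx (cvg_right _ _ al0 dal) cu cw).
have h0 : \forall h \near (0 : R)^'+, 0 < h by exact: nbhs_right_gt.
apply: filterS3 near1 fE h0 => h ch [_ _ E1 E2] hp.
rewrite /tcone E1 E2.
have -> : be h - al h = h *: (h^-1 *: (be h - al h)) by rewrite scalerA mulfV ?gt_eqF // scale1r.
exact: cone_scale.
Unshelve. all: by end_near. Qed.

(** By [timelike_pair_change] the condition is the same in every chart of the atlas around p. *)
Definition timelike_at (f : R -> M * M) p := exists2 c, atlas c & timelike_pair c f p.

Lemma timelike_at_chron f p : timelike_at f p -> \forall h \near 0^'+, chron (f h).1 (f h).2.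
Proof. by move=> [c ac]; exact: timelike_pair_chron. Qed.

Lemma is_derive_reparam (be : R -> V) (t sg : R) w :
  is_derive (t : R^o) 1 (be : R^o -> V) w ->
  is_derive (0 : R^o) 1 ((fun h => be (t + h * sg)) : R^o -> V) (sg *: w).
Proof.
move=> [db dE].
have db' : differentiable (be : R^o -> V) (t : R^o) by exact/derivable1_diffP.
have aff := is_derive_affine (t : R^o) (sg : R^o) 0 1.
have db'' : differentiable (be : R^o -> V) ((t + 0 *: (sg : R^o)) : R^o).
  by rewrite scale0r addr0.
have := @is_derive_comp R R^o 1 n.+1 be (fun s : R => t + s *: (sg : R^o)) 0 _ db'' aff.
rewrite scale0r addr0 scale1r.
have -> : 'D_sg (be : R^o -> V) t = sg *: w.
  rewrite deriveE // -dE deriveE // -linearZ.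
  by congr ('d _ _ _); rewrite [RHS]mulr1.
by apply.
Qed.

(** With [sg] equal to 1 or -1, right and left germs are both parametrised by h tending to 0+. *)
Lemma smooth_germ_in_chart K (gamma : R -> M) (D : set R) t (sg : R) :
  smooth_germ K gamma D t -> D t -> (\forall h \near (0 : R)^'+, D (t + h * sg)) ->
  exists c (be : R -> V) w, [/\ atlas c /\ K c (gamma t) w,
    cdom c (gamma t) /\ c (gamma t) = be t,
    \forall h \near (0 : R)^'+, cdom c (gamma (t + h * sg)) /\
      c (gamma (t + h * sg)) = be (t + h * sg) &
    is_derive (0 : R^o) 1 ((fun h => be (t + h * sg)) : R^o -> V) (sg *: w)].
Proof.
move=> [c [be [e [ac e0 sb bP Kt]]]] Dt Dn.
exists c, be, ('D_1 (be : R^o -> V) t); split=> //.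
- by apply: bP => //; exact: ballxx.
- have cth : {for (0 : R), continuous (fun h : R => t + h * sg)}.
    exact: is_derive_continuous (is_derive_affine (t : R^o) (sg : R^o) 0 1).
  have nb : \forall h \near (0 : R)^'+, ball t e (t + h * sg).
    have : \forall h \near (0 : R), ball t e (t + h * sg).
      by apply: cth; rewrite mul0r addr0; exact: nbhsx_ballx.
    exact: cvg_within.
  by apply: filterS2 Dn nb => h; exact: bP.
apply: is_derive_reparam; apply: derivableP.
by have [_ /(_ 1) [+ _]] := sb 1%N; apply; exact: ballxx.
Qed.

Lemma germ_timelike_fwd K (gamma : R -> M) (D : set R) t (sg : R) :
  smooth_germ K gamma D t -> D t -> (\forall h \near (0 : R)^'+, D (t + h * sg)) ->
  (forall c w, K c (gamma t) w -> form (metric M c (gamma t)) (sg *: w) (sg *: w) < 0 /\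
     form (metric M c (gamma t)) (sg *: w) (torient M c (gamma t)) < 0) ->
  timelike_at (fun h => (gamma t, gamma (t + h * sg))) (gamma t).
Proof.
move=> gg Dt Dn KP.
have [c [be [w [[ac Kw] [ct cE] nE dbe]]]] := smooth_germ_in_chart gg Dt Dn.
have [Q0 T0] := KP _ _ Kw.
exists c => //.
apply: (@derive_timelike_pair c _ _ (fun=> be t) (fun h => be (t + h * sg)) 0 (sg *: w)) => //.
- by apply: filterS nE => h [ch chE].
- by rewrite mul0r addr0.
- by rewrite subr0.
- by rewrite subr0.
Qed.

Lemma germ_timelike_bwd K (gamma : R -> M) (D : set R) t (sg : R) :
  smooth_germ K gamma D t -> D t -> (\forall h \near (0 : R)^'+, D (t + h * sg)) ->
  (forall c w, K c (gamma t) w -> form (metric M c (gamma t)) (- sg *: w) (- sg *: w) < 0 /\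
     form (metric M c (gamma t)) (- sg *: w) (torient M c (gamma t)) < 0) ->
  timelike_at (fun h => (gamma (t + h * sg), gamma t)) (gamma t).
Proof.
move=> gg Dt Dn KP.
have [c [be [w [[ac Kw] [ct cE] nE dbe]]]] := smooth_germ_in_chart gg Dt Dn.
have [Q0 T0] := KP _ _ Kw.
exists c => //.
apply: (@derive_timelike_pair c _ _ (fun h => be (t + h * sg)) (fun=> be t) (sg *: w) 0) => //.
- by apply: filterS nE => h [ch chE].
- by rewrite mul0r addr0.
- by rewrite sub0r -scaleNr.
- by rewrite sub0r -scaleNr.
Qed.

End Pairs.

(** * Chronological order along curves, and openness of chronological futures and pasts *)

Section ChronologyRelation.
Variables (R : realType) (n : nat) (M : spacetime R n).
Local Notation V := 'rV[R]_n.+1.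
Implicit Types (c d : chart R n.+1 M) (p q : M).

Lemma near_right_itv (I : set R) (a b t : R) : is_interval I -> I a -> I b ->
  a <= t < b -> \forall h \near (0 : R)^'+, I (t + h * 1).
Proof.
move=> iI Ia Ib /andP[at_ tb]; have tb0 : 0 < b - t by rewrite subr_gt0.
near=> h; rewrite mulr1; apply: (iI a b) => //.
have h0 : 0 < h by near: h; exact: nbhs_right_gt.
have hb : h < b - t by near: h; exact: nbhs_right_lt.
by apply/andP; split; lra.
Unshelve. all: by end_near. Qed.

Lemma near_left_itv (I : set R) (a b t : R) : is_interval I -> I a -> I b ->
  a < t <= b -> \forall h \near (0 : R)^'+, I (t + h * -1).
Proof.
move=> iI Ia Ib /andP[at_ tb]; have tb0 : 0 < t - a by rewrite subr_gt0.
near=> h; rewrite mulrN1; apply: (iI a b) => //.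
have h0 : 0 < h by near: h; exact: nbhs_right_gt.
have hb : h < t - a by near: h; exact: nbhs_right_lt.
by apply/andP; split; lra.
Unshelve. all: by end_near. Qed.

Lemma near_opp_le (t : R) (I : set R) : (\forall h \near (0 : R)^'+, I (t + h * -1)) ->
  \forall h \near (0 : R)^'+, (I `&` [set s | s <= t]) (t + h * -1).
Proof.
move=> H; have h0 : \forall h \near (0 : R)^'+, 0 < h by exact: nbhs_right_gt.
by apply: filterS2 H h0 => h Ih hp; split=> //=; rewrite mulrN1 gerBl ltW.
Qed.

Lemma near_add_ge (t : R) (I : set R) : (\forall h \near (0 : R)^'+, I (t + h * 1)) ->
  \forall h \near (0 : R)^'+, (I `&` [set s | t <= s]) (t + h * 1).
Proof.
move=> H; have h0 : \forall h \near (0 : R)^'+, 0 < h by exact: nbhs_right_gt.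
by apply: filterS2 H h0 => h Ih hp; split=> //=; rewrite mulr1 lerDl ltW.
Qed.

Lemma future_curve_pairs (gamma : R -> M) (I : set R) a b t :
  future_timelike_curve gamma I -> I a -> I b -> a <= t <= b ->
  (t < b -> timelike_at (fun h => (gamma t, gamma (t + h * 1))) (gamma t)) /\
  (a < t -> timelike_at (fun h => (gamma (t + h * -1), gamma t)) (gamma t)).
Proof.
move=> [iI _ H] Ia Ib /andP[at_ tb].
have It : I t by apply: (iI a b) => //; rewrite at_.
have [gr gl] := H t It; split=> [tb'|at'].
  apply: (germ_timelike_fwd gr); first by split=> /=.
    by apply: near_add_ge; apply: near_right_itv iI Ia Ib _; rewrite at_.
  by move=> c w; rewrite scale1r.
apply: (germ_timelike_bwd gl); first by split=> /=.
  by apply: near_opp_le; apply: near_left_itv iI Ia Ib _; rewrite at'.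
by move=> c w; rewrite opprK scale1r.
Qed.

Lemma past_curve_pairs (gamma : R -> M) (I : set R) a b t :
  past_timelike_curve gamma I -> I a -> I b -> a <= t <= b ->
  (t < b -> timelike_at (fun h => (gamma (t + h * 1), gamma t)) (gamma t)) /\
  (a < t -> timelike_at (fun h => (gamma t, gamma (t + h * -1))) (gamma t)).
Proof.
move=> [iI _ H] Ia Ib /andP[at_ tb].
have It : I t by apply: (iI a b) => //; rewrite at_.
have flip c w : timelike_vect c (gamma t) w /\ past_vect c (gamma t) w ->
    form (metric M c (gamma t)) (- 1 *: w) (- 1 *: w) < 0 /\
    form (metric M c (gamma t)) (- 1 *: w) (torient M c (gamma t)) < 0.
  by move=> [tw pw]; rewrite scaleN1r !formNl formNr opprK oppr_lt0.
have [gr gl] := H t It; split=> [tb'|at'].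
  apply: (germ_timelike_bwd gr); first by split=> /=.
    by apply: near_add_ge; apply: near_right_itv iI Ia Ib _; rewrite at_.
  exact: flip.
apply: (germ_timelike_fwd gl); first by split=> /=.
  by apply: near_opp_le; apply: near_left_itv iI Ia Ib _; rewrite at'.
exact: flip.
Qed.

(** No smoothness of f is assumed, so this applies to the image of a timelike curve under the flow.
    The timelike curve obtained from f a to f b need not follow f. *)
Lemma chron_of_pairs (f : R -> M) a b : a < b ->
  (forall t, a <= t <= b ->
    (t < b -> timelike_at (fun h => (f t, f (t + h * 1))) (f t)) /\
    (a < t -> timelike_at (fun h => (f (t + h * -1), f t)) (f t))) ->
  chron (f a) (f b).
Proof.
move=> ab H; apply: (@local_to_global R (fun s t => chron (f s) (f t)) a b) => //.
- by move=> x y z; exact: chron_trans.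
- move=> s /andP[s1 s2]; have [|+ _] := H s; first by rewrite s1 ltW.
  by move=> /(_ s2) /timelike_at_chron; apply: filterS => h /=; rewrite mulr1.
- move=> s /andP[s1 s2]; have [|_] := H s; first by rewrite s2 ltW.
  by move=> /(_ s1) /timelike_at_chron; apply: filterS => h /=; rewrite mulrN1.
Qed.

Lemma future_curve_chron (gamma : R -> M) (I : set R) a b :
  future_timelike_curve gamma I -> I a -> I b -> a < b -> chron (gamma a) (gamma b).
Proof.
by move=> cg Ia Ib ab; apply: chron_of_pairs => // t; exact: future_curve_pairs cg Ia Ib.
Qed.

Lemma past_curve_chron (gamma : R -> M) (I : set R) a b :
  past_timelike_curve gamma I -> I a -> I b -> a < b -> chron (gamma b) (gamma a).
Proof.
move=> cg Ia Ib ab.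
apply: (@local_to_global R (fun s t => chron (gamma t) (gamma s)) a b) => //.
- by move=> x y z h1 h2; exact: chron_trans h2 h1.
- move=> s /andP[s1 s2]; have [|+ _] := past_curve_pairs cg Ia Ib (t := s).
    by rewrite s1 ltW.
  by move=> /(_ s2) /timelike_at_chron; apply: filterS => h /=; rewrite mulr1.
- move=> s /andP[s1 s2]; have [|_] := past_curve_pairs cg Ia Ib (t := s).
    by rewrite s2 ltW.
  by move=> /(_ s1) /timelike_at_chron; apply: filterS => h /=; rewrite mulrN1.
Qed.

(** Cut the curve at a point x shortly before q: the cone relation from x is open in its other end,
    and [cone_chron] turns it back into <<. *)
Lemma chron_near_right p q : chron p q -> \forall q' \near q, chron p q'.
Proof.
move=> [g [a [b [ab cg <- <-]]]].
have Ia : `[a, b]%classic a by rewrite /= in_itv /= lexx ltW.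
have Ib : `[a, b]%classic b by rewrite /= in_itv /= lexx ltW.
have [|_ /(_ ab) [c ac [cq f1 f2 [k k0 fk]]]] := future_curve_pairs cg Ia Ib (t := b).
  by rewrite lexx ltW.
have [[A B] /= [nA nB] AB] := cone_chron ac cq k0.
have ba : 0 < b - a by rewrite subr_gt0.
have h1 : \forall h \near (0 : R)^'+, A (g (b + h * -1)) by exact: f1.
have h1' : \forall h \near (0 : R)^'+, cdom c (g (b + h * -1)).
  by apply: f1; apply: open_nbhs_nbhs; split=> //; exact: cdom_open.
have h2 : \forall h \near (0 : R)^'+, 0 < h < b - a.
  near=> h; apply/andP; split; near: h; [exact: nbhs_right_gt | exact: nbhs_right_lt].
have [h [Ah ch kh /andP[h0 hb]]] : exists h, [/\ A (g (b + h * -1)), cdom c (g (b + h * -1)),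
    tcone c k (g (b + h * -1)) (g b) & 0 < h < b - a].
  by apply: (@filter_ex _ ((0 : R)^'+)); apply: filterS2 (filterI h1 h1') (filterI fk h2) => h [? ?] [? ?].
set x := g (b + h * -1) in Ah ch kh.
have px : chron (g a) x.
  apply: (future_curve_chron cg Ia) => //=; last by lra.
  by rewrite in_itv /=; apply/andP; split; lra.
have near_k : \forall q' \near g b, tcone c k x q'.
  have cx : cimg c (c x) by exact: cimg_cfun.
  apply: (cone_near ac cx _ _ kh); first exact: cvg_cst.
  by apply: cvgB; [exact: cfun_continuous | exact: cvg_cst].
apply: filterS2 nB near_k => q' Bq' kq'.
by apply: chron_trans px _; apply: (AB (x, q')).
Unshelve. all: by end_near. Qed.

Lemma chron_near_left p q : chron p q -> \forall p' \near p, chron p' q.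
Proof.
move=> [g [a [b [ab cg <- <-]]]].
have Ia : `[a, b]%classic a by rewrite /= in_itv /= lexx ltW.
have Ib : `[a, b]%classic b by rewrite /= in_itv /= lexx ltW.
have [|/(_ ab) [c ac [cp f1 f2 [k k0 fk]]] _] := future_curve_pairs cg Ia Ib (t := a).
  by rewrite lexx ltW.
have [[A B] /= [nA nB] AB] := cone_chron ac cp k0.
have ba : 0 < b - a by rewrite subr_gt0.
have h1 : \forall h \near (0 : R)^'+, B (g (a + h * 1)) by exact: f2.
have h2 : \forall h \near (0 : R)^'+, 0 < h < b - a.
  near=> h; apply/andP; split; near: h; [exact: nbhs_right_gt | exact: nbhs_right_lt].
have [h [Bh kh /andP[h0 hb]]] : exists h, [/\ B (g (a + h * 1)),
    tcone c k (g a) (g (a + h * 1)) & 0 < h < b - a].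
  by apply: (@filter_ex _ ((0 : R)^'+)); apply: filterS3 h1 fk h2 => h.
set x := g (a + h * 1) in Bh kh.
have xq : chron x (g b).
  apply: (future_curve_chron cg _ Ib); last by lra.
  by rewrite /= in_itv /=; apply/andP; split; lra.
have near_k : \forall p' \near g a, tcone c k p' x.
  have cx : cimg c (c (g a)) by exact: cimg_cfun.
  apply: (cone_near ac cx _ _ kh); first exact: cfun_continuous.
  by apply: cvgB; [exact: cvg_cst | exact: cfun_continuous].
apply: filterS2 nA near_k => p' Ap' kp'.
by apply: chron_trans xq; apply: (AB (p', x)).
Unshelve. all: by end_near. Qed.

Lemma chron_strict_causal p q : chron p q -> strict_causal p q.
Proof.
move=> [g [a [b [ab [iI ne H] ga gb]]]]; exists g, a, b; split=> //; split=> // t It.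
have W (D : set R) : smooth_germ (fun c p v => timelike_vect c p v /\ future_vect c p v) g D t ->
   smooth_germ (fun c p v => causal_vect c p v /\ future_vect c p v) g D t.
  move=> [c [be [e [ac e0 sb bP [tv fv]]]]]; exists c, be, e; split=> //; split=> //.
  split; last exact: ltW.
  apply: contraTneq fv => ->; rewrite /future_vect -[inner _ _ _ _ _]/(form _ _ _).
  by rewrite form0l ltxx.
by have [h1 h2] := H t It; split; exact: W.
Qed.

Lemma strict_causal_trans p q r : strict_causal p q -> strict_causal q r -> strict_causal p r.
Proof.
move=> [g1 [a [b [ab c1 <- <-]]]] [g2 [c [d [cd c2 E <-]]]].
have [g [e [ae cg ga ge]]] := pw_smooth_curve_cat ab cd c1 c2 (esym E).
by exists g, a, e.
Qed.

End ChronologyRelation.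

(** * The conformal flow preserves the chronological relation *)

Section ConformalFlow.
Variables (R : realType) (n : nat) (M : spacetime R n) (X : vector_field M).
Variable phi : R -> M -> M.
Local Notation V := 'rV[R]_n.+1.
Implicit Types (c d : chart R n.+1 M) (p q : M).
Hypothesis Xt : timelike_field (metric M) X.
Hypothesis Xconf : conformal_killing (metric M) X.
Hypothesis phi0 : forall p, phi 0 p = p.
Hypothesis phiX : forall p, integral_curve X (phi^~ p) setT.

Lemma phi_add s t p : phi (s + t) p = phi t (phi s p).
Proof. exact: (flow_add _ _ _ phi0 phiX). Qed.

(** [cone_evolution] along flow lines. The time tau and the radius r0 are valid for all pairs f,
    whatever their margin. *)
Lemma timelike_pair_flow c p0 : atlas c -> cdom c p0 ->
  exists r0 tau, [/\ 0 < r0, 0 < tau & forall q s f, cdom c q -> `|c q - c p0| < r0 ->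
    `|s| < tau -> timelike_pair c f q ->
    timelike_pair c (fun h => (phi s (f h).1, phi s (f h).2)) (phi s q)].
Proof.
move=> ac cp0; have [sigma _ lieX] := Xconf.
have cz : cimg c (c p0) by exact: cimg_cfun.
have [|||||r [tau [[r0 tau0 rU bnds] evol]]] := @cone_evolution R n (cimg c) (X c \o cinv c) (Tc c) (Gc c)
  (sigma \o cinv c) (c p0) (@cimg_open _ _ _ c) cz (vcomp_smooth X ac 2) (Gc_smooth ac 1)
  (Tc_smooth ac 0).1.
- by move=> a /cimg_cinv [ca _]; exact: mcomp_sym.
- move=> a /cimg_cinv [ca aE] /=; have := lieX c _ ac ca.
  by rewrite /lie_metric aE.
- by move=> a /cimg_cinv [ca _]; exact: (Xt ac ca).
- by move=> a ca; exact: Tc_timelike.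
- by move=> a v w ca; exact: Gc_nonorth.
have [r1 [tau1 [r10 tau10 ball1]]] := flow_chart_ball phi0 phiX ac cz r0.
exists r1, (Num.min tau tau1); split=> //; first by rewrite lt_min tau0.
move=> q s f cq qr; rewrite lt_min => /andP[st st1] [_ f1 f2 [k k0 fk]].
have sol a : cdom c a -> `|c a - c p0| < r1 ->
    solution (X c \o cinv c) (c p0) r s (fun u => c (phi u a)).
  move=> ca ar u us.
  have ut1 : `|u| < tau1 by apply: le_lt_trans st1; exact: between0_norm_le.
  have [cu cr] := ball1 a ca ar u ut1; split=> //.
  have [_ _ _ H] := phiX a; have [_ d] := H u I.
  by have := d c ac cu; rewrite /= cfunK.
have bss := between_right 0 s.
have near_q : \forall a \near q, cdom c a /\ `|c a - c p0| < r1.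
  have e0 : 0 < r1 - `|c q - c p0| by rewrite subr_gt0.
  apply: filterS (near_cdom cq e0) => a [ca ha]; split=> //.
  rewrite -(subrKA (c q)); apply: le_lt_trans (ler_normD _ _) _; lra.
have [csq _] := ball1 q cq qr s st1.
(* The transported pairs must collapse to [phi s q]; this spatial continuity comes from the
   Lipschitz bound in the chart. *)
have cts : phi s a @[a --> q] --> phi s q.
  have cc : c (phi s a) @[a --> q] --> c (phi s q).
    apply/cvgrPdist_lt => e e0; have e20 : 0 < e / 2 by rewrite divr_gt0.
    apply: filterS2 near_q (near_cdom cq e20) => a [ca ar] [_ ae].
    have [h _] := bnds s _ _ (ltW st) (sol a ca ar) (sol q cq qr) s bss.
    rewrite !phi0 in h; apply: le_lt_trans h _.
    by rewrite distrC mulrC -ltr_pdivlMr.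
  have : cinv c (c (phi s a)) @[a --> q] --> cinv c (c (phi s q)).
    apply: (@cvg_comp _ _ _ (fun a => c (phi s a)) (cinv c) _ (nbhs (c (phi s q)))) => //.
    by apply: cinv_continuous; exact: cimg_cfun.
  rewrite cfunK //; apply: cvg_trans; apply: near_eq_cvg.
  apply: filterS near_q => a [ca ar].
  by have [h _] := ball1 a ca ar s st1; rewrite cfunK.
have [k' [del [k'0 del0 ev]]] := evol k k0.
split=> //.
- exact: (@cvg_comp _ _ _ (fun h => (f h).1) (phi s) _ (nbhs q)).
- exact: (@cvg_comp _ _ _ (fun h => (f h).2) (phi s) _ (nbhs q)).
exists k' => //.
have del20 : 0 < del / 2 by rewrite divr_gt0.
have near2 : \forall a \near q, (cdom c a /\ `|c a - c p0| < r1) /\ `|c a - c q| < del / 2.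
  by apply: filterS2 near_q (near_cdom cq del20) => a ? [].
have h1 : \forall h \near (0 : R)^'+, _ := f1 _ near2.
have h2 : \forall h \near (0 : R)^'+, _ := f2 _ near2.
apply: filterS3 h1 h2 fk => h [[cA rA] dA] [[cB rB] dB] kAB.
have := ev s _ _ (ltW st) (sol _ cA rA) (sol _ cB rB); rewrite !phi0; apply; last exact: kAB.
have -> : c (f h).2 - c (f h).1 = (c (f h).2 - c q) - (c (f h).1 - c q) by rewrite opprB addrA subrK.
by apply: le_lt_trans (ler_normB _ _) _; rewrite [ltRHS]splitr ltrD.
Qed.

(** Being timelike at time s is locally constant in s: one flow box around [phi s p] carries pairs
    from s to u and, run backwards, from u to s. *)
Lemma timelike_at_flow f p t : timelike_at f p ->
  timelike_at (fun h => (phi t (f h).1, phi t (f h).2)) (phi t p).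
Proof.
pose P t := timelike_at (fun h => (phi t (f h).1, phi t (f h).2)) (phi t p).
move=> H0; suff : P 0 <-> P t.
  move=> [+ _]; apply; rewrite /P phi0; move: H0; congr (timelike_at _ _).
  by apply/funext => h; rewrite !phi0; case: (f h).
apply: locally_constant_iff => s _.
have [c ac cp] := atlas_cover (phi s p).
have [r0 [tau [r00 tau0 F]]] := timelike_pair_flow ac cp.
have [_ _ _ HI] := phiX p; have [cs _] := HI s I.
have nt : \forall u \near s, `|u - s| < tau.
  by apply/nbhs_normP; exists tau => // u; rewrite /ball_ /= distrC.
apply: filterS2 (near_chart r00 cp cs) nt => u [cu ru] us.
split=> -[d ad Pd].
  exists c => //; have Pc := timelike_pair_change ad ac cp Pd.
  have := F (phi s p) (u - s) _ cp _ us Pc.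
  rewrite subrr normr0 => /(_ r00) /=.
  by rewrite -phi_add [s + _]addrC subrK; congr (timelike_pair _ _ _);
    apply/funext => h; rewrite -!phi_add [s + _]addrC subrK.
exists c => //; have Pc := timelike_pair_change ad ac cu Pd.
have us' : `|s - u| < tau by rewrite distrC.
have := F (phi u p) (s - u) _ cu ru us' Pc => /=.
by rewrite -phi_add [u + _]addrC subrK; congr (timelike_pair _ _ _);
  apply/funext => h; rewrite -!phi_add [u + _]addrC subrK.
Qed.

Lemma chron_flow p q t : chron p q -> chron (phi t p) (phi t q).
Proof.
move=> [g [a [b [ab cg <- <-]]]].
have Ia : `[a, b]%classic a by rewrite /= in_itv /= lexx ltW.
have Ib : `[a, b]%classic b by rewrite /= in_itv /= lexx ltW.
apply: (@chron_of_pairs _ _ _ (fun s => phi t (g s))) => // s sab.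
have [h1 h2] := future_curve_pairs cg Ia Ib sab.
by split=> [/h1|/h2] /(timelike_at_flow t).
Qed.

End ConformalFlow.

(** * Smoothness and time orientation of the orbits *)

Section SmoothSolutions.
Variable R : realType.

Lemma Ck_on_congr (V W : normedModType R) k (U : set V) (f g : V -> W) : open U ->
  (forall x, U x -> f x = g x) -> Ck_on k U f -> Ck_on k U g.
Proof.
move=> Uo; elim: k f g => [|k IH] f g E [cf df].
  have nE x : U x -> \forall y \near x, f y = g y.
    move=> Ux; have : \forall y \near x, U y by exact: open_nbhs_nbhs.
    by apply: filterS => y /E.
  split=> // x Ux; rewrite /prop_for /continuous_at -E //.
  by apply: cvg_trans (cf x Ux); apply: near_eq_cvg; exact: nE.
have nE x : U x -> \forall y \near x, f y = g y.
  move=> Ux; have : \forall y \near x, U y by exact: open_nbhs_nbhs.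
  by apply: filterS => y /E.
split=> [x Ux|v].
  rewrite /prop_for /continuous_at -E //.
  by apply: cvg_trans (cf x Ux); apply: near_eq_cvg; exact: nE.
have [dv Cv] := df v; split=> [x Ux|].
  by apply: near_eq_derivable (dv x Ux); exact: nE.
apply: IH Cv => x Ux; apply: near_eq_derive; exact: nE.
Qed.

Lemma Ck_onD (V W : normedModType R) k (U : set V) (f g : V -> W) : open U ->
  Ck_on k U f -> Ck_on k U g -> Ck_on k U (f + g).
Proof.
move=> Uo; elim: k f g => [|k IH] f g [cf df] [cg dg].
  by split=> // x Ux; apply: continuousD; [exact: cf | exact: cg].
split=> [x Ux|v]; first by apply: continuousD; [exact: cf | exact: cg].
have [dfv Cf] := df v; have [dgv Cg] := dg v; split=> [x Ux|].
  by apply: derivableD; [exact: dfv | exact: dgv].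
apply: Ck_on_congr (IH _ _ Cf Cg) => // x Ux.
by rewrite /= !fctE deriveD //; [exact: dfv | exact: dgv].
Qed.

Lemma Ck_on_sum (V W : normedModType R) k (U : set V) m (F : 'I_m -> V -> W) : open U ->
  (forall i, Ck_on k U (F i)) -> Ck_on k U (\sum_i F i).
Proof.
move=> Uo H; apply: big_ind => //; first exact: Ck_on_cst.
by move=> f g; exact: Ck_onD.
Qed.

Lemma Ck_on_entry (V : normedModType R) p q k (U : set V) (f : V -> 'M[R]_(p, q)) i j : open U ->
  Ck_on k U f -> Ck_on k U ((fun x => f x i j) : V -> R^o).
Proof.
move=> Uo; elim: k f => [|k IH] f [cf df].
  split=> // x Ux; apply: (@continuous_comp _ _ _ f (fun A : 'M[R]_(p, q) => A i j : R^o)).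
    exact: cf.
  exact: coord_continuous.
split=> [x Ux|v].
  apply: (@continuous_comp _ _ _ f (fun A : 'M[R]_(p, q) => A i j : R^o)).
    exact: cf.
  exact: coord_continuous.
have [dfv Cf] := df v; split=> [x Ux|].
  by have /is_derive_mxP /(_ i j) [] := derivableP (dfv x Ux).
apply: Ck_on_congr (IH _ Cf) => // x Ux.
by have /is_derive_mxP /(_ i j) [_ ->] := derivableP (dfv x Ux).
Qed.

Lemma is_derive_scale (V : normedModType R) p q (u : V -> R^o) (f : V -> 'M[R]_(p, q)) x v du df :
  is_derive x v u du -> is_derive x v f df ->
  is_derive x v (fun y => u y *: f y) (u x *: df + du *: f x).
Proof.
move=> dux /is_derive_mxP dfx; apply/is_derive_mxP => i j.
have -> : (fun y => (u y *: f y) i j : R^o) = u * (fun y => f y i j : R^o).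
  by apply/funext => y; rewrite mxE.
apply: (is_derive_eq (is_deriveM dux (dfx i j))).
by rewrite !mxE -![_ *: _]/(_ * _) [du * _]mulrC.
Qed.

Lemma Ck_onZ (V : normedModType R) p q k (U : set V) (u : V -> R^o) (f : V -> 'M[R]_(p, q)) :
  open U -> Ck_on k U u -> Ck_on k U f -> Ck_on k U (fun x => u x *: f x).
Proof.
have cZ (l : nat) w (g : V -> 'M[R]_(p, q)) : Ck_on l U w -> Ck_on l U g ->
    forall x, U x -> {for x, continuous (fun y => (w y : R^o) *: g y)}.
  by move=> Cw Cg x Ux; apply: cvgZ; [case: l Cw {Cg} => [|l] [+ _]; exact |
    case: l Cg {Cw} => [|l] [+ _]; exact].
move=> Uo; elim: k u f => [|k IH] u f Cu Cf; first by split; [exact: cZ Cu Cf |].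
split; first exact: cZ Cu Cf.
move=> v.
have [duv Cuv] := Cu.2 v; have [dfv Cfv] := Cf.2 v.
have D x : U x -> is_derive x v (fun y => u y *: f y) (u x *: 'D_v f x + 'D_v u x *: f x).
  move=> Ux; apply: is_derive_scale; apply: derivableP; [exact: duv | exact: dfv].
split=> [x /D []//|].
have H1 := IH _ _ (Ck_onS Cu) Cfv; have H2 := IH _ _ Cuv (Ck_onS Cf).
apply: Ck_on_congr (Ck_onD Uo H1 H2) => // x /D [_ ->].
by rewrite /= !fctE.
Qed.

Lemma derive1_scale (W : normedModType R) (g : R -> W) (s v : R) w :
  is_derive (s : R^o) 1 (g : R^o -> W) w -> is_derive (s : R^o) (v : R^o) (g : R^o -> W) (v *: w).
Proof.
move=> [dg dE].
have dg' : differentiable (g : R^o -> W) (s : R^o) by exact/derivable1_diffP.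
split; first exact: diff_derivable.
rewrite deriveE // -dE deriveE // -linearZ.
by congr ('d _ _ _); rewrite [RHS]mulr1.
Qed.

(** Bootstrap, run on compositions f o y for all smooth f at once: the derivative of f o y along y
    is again of this form, with the derivative of f along X in place of f. Taking f = id gives y. *)
Lemma smooth_on_solution m (U : set 'rV[R]_m) (X : 'rV[R]_m -> 'rV[R]_m) (J : set R^o) (y : R -> 'rV[R]_m) :
  open U -> open J -> smooth_on U X ->
  (forall s, J s -> U (y s) /\ is_derive (s : R^o) 1 (y : R^o -> 'rV[R]_m) (X (y s))) ->
  smooth_on J (y : R^o -> 'rV[R]_m).
Proof.
move=> Uo Jo sX H.
have cy s : J s -> {for s, continuous y}.
  by move=> /H [_]; exact: is_derive_continuous.
have comp k p q (f : 'rV[R]_m -> 'M[R]_(p, q)) : smooth_on U f -> Ck_on k J ((f \o y) : R^o -> 'M[R]_(p, q)).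
  elim: k p q f => [|k IH] p q f sf.
    split; last by [].
    move=> s Js; have [Us _] := H s Js.
    by apply: (@continuous_comp _ _ _ y f); [exact: cy | exact: ((sf 0).1 _ Us)].
  have D s v : J s -> is_derive (s : R^o) (v : R^o) ((f \o y) : R^o -> 'M[R]_(p, q))
      (v *: 'D_(X (y s)) f (y s)).
    move=> Js; have [Us dy] := H s Js; apply: derive1_scale.
    by apply: is_derive_comp dy; have [] := Ck_on1_differentiable Uo (sf 1) Us.
  split=> [s Js|v].
    have [Us _] := H s Js.
    by apply: (@continuous_comp _ _ _ y f); [exact: cy | exact: ((sf 0).1 _ Us)].
  split=> [s /(D s v) []//|].
  pose F : 'rV[R]_m -> 'M[R]_(p, q) :=
    \sum_i (fun x => (v * X x 0 i) *: 'D_(delta_mx 0 i) f x).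
  have sF : smooth_on U F.
    move=> l; apply: Ck_on_sum => // i.
    apply: (Ck_onZ (u := fun x => v * X x 0 i)) => //.
      have cX := Ck_on_entry 0 i Uo (sX l).
      (* [Ck_onZ] multiplies matrices by scalar functions, so the constant v is passed as a matrix
         of size 1. *)
      have cv : Ck_on l U ((fun=> v%:M) : 'rV[R]_m -> 'M[R]_1) by exact: Ck_on_cst.
      have := Ck_on_entry 0 0 Uo (Ck_onZ Uo cX cv).
      by apply: Ck_on_congr => // x _; rewrite !mxE eqxx mulr1n mulrC.
    by have [_ +] := (sf l.+1).2 (delta_mx 0 i).
  apply: Ck_on_congr (IH _ _ F sF) => // s Js; have [_ ->] := D s v Js.
  have [Us _] := H s Js.
  have [_ ->] := Ck_on1_differentiable Uo (sf 1) Us.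
  rewrite /= /F fct_sumE scaler_sumr; apply: eq_bigr => i _.
  by rewrite scalerA.
move=> k; have := comp k _ _ id.
apply; case=> [|l]; first by split=> // x _; exact: cvg_id.
split=> [x _|v]; first exact: cvg_id.
split=> [x _|]; first exact: derivable_id.
have -> : 'D_v (id : 'rV[R]_m -> 'rV[R]_m) = cst v by apply/funext => x; exact: derive_id.
exact: Ck_on_cst.
Qed.

End SmoothSolutions.

(** * Orbits of a timelike field and their time orientation *)

Section Orbits.
Variables (R : realType) (n : nat) (M : spacetime R n) (X : vector_field M).
Local Notation V := 'rV[R]_n.+1.
Implicit Types (c d : chart R n.+1 M) (p q : M).
Hypothesis Xt : timelike_field (metric M) X.

Lemma integral_curve_smooth_germ (K : chart R n.+1 M -> M -> V -> Prop) (g : R -> M) t :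
  integral_curve X g setT ->
  (forall c, atlas c -> cdom c (g t) -> K c (g t) (X c (g t))) ->
  forall D, smooth_germ K g D t.
Proof.
move=> [_ _ _ H] KX D; have [c ac cp] := atlas_cover (g t).
have [cg dg] := H t I.
have /nbhs_normP [e /= e0 eP] := near_chart ltr01 cp cg.
have sol s : ball t e s -> cimg c (c (g s)) /\
    is_derive (s : R^o) 1 ((c \o g) : R^o -> V) ((X c \o cinv c) (c (g s))).
  rewrite -ball_normE => /eP [cs _]; split; first exact: cimg_cfun.
  by have [_ ds] := H s I; rewrite /= cfunK //; exact: ds.
exists c, (c \o g), e; split=> //.
- apply: (smooth_on_solution (@cimg_open _ _ _ c) _ (vcomp_smooth X ac) sol).
  exact: ball_open.
- by move=> s _; rewrite -ball_normE => /eP [cs _].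
by have [_ ->] := dg c ac cp; exact: KX.
Qed.

Lemma XT_change c d p : atlas c -> atlas d -> cdom c p -> cdom d p ->
  form (metric M c p) (X c p) (torient M c p) = form (metric M d p) (X d p) (torient M d p).
Proof.
move=> ac ad cp dp.
by rewrite (vcomp_change X ac ad cp dp) (vcomp_change (torient M) ac ad cp dp)
  (mcomp_change (metric M) ac ad cp dp) formMr formMl.
Qed.

(** The product of two timelike vectors never vanishes and its sign does not depend on the chart, so
    M splits into two open sets, one of which is empty by connectedness. *)
Lemma timelike_field_orientation :
  (forall c p, atlas c -> cdom c p -> form (metric M c p) (X c p) (torient M c p) < 0) \/
  (forall c p, atlas c -> cdom c p -> 0 < form (metric M c p) (X c p) (torient M c p)).
Proof.
pose XT c p := form (metric M c p) (X c p) (torient M c p).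
have nz c p : atlas c -> cdom c p -> XT c p != 0.
  move=> ac cp; have [P Pu PG] := mcomp_lorentz (metric M) ac cp.
  by apply: form_nonorth Pu PG _ _; [exact: (Xt ac cp) | exact: (torient_timelike ac cp)].
have cX c p : atlas c -> cdom c p -> XT c q @[q --> p] --> XT c p.
  move=> ac cp; have cx : cimg c (c p) by exact: cimg_cfun.
  have E : \forall q \near p, form (Gc c (c q)) ((X c \o cinv c) (c q)) (Tc c (c q)) = XT c q.
    have : \forall q \near p, cdom c q by apply: open_nbhs_nbhs; split=> //; exact: cdom_open.
    by apply: filterS => q cq; rewrite /Gc /Tc /= cfunK.
  have : form (Gc c (c q)) ((X c \o cinv c) (c q)) (Tc c (c q)) @[q --> p] -->
      form (Gc c (c p)) ((X c \o cinv c) (c p)) (Tc c (c p)).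
    have cc := cfun_continuous cp.
    apply: form_cvg.
    - by apply: (@cvg_comp _ _ _ c (Gc c) _ (nbhs (c p))); [exact: cc | exact: ((Gc_smooth ac 0).1 _ cx)].
    - by apply: (@cvg_comp _ _ _ c (X c \o cinv c) _ (nbhs (c p))); [exact: cc | exact: ((vcomp_smooth X ac 0).1 _ cx)].
    - by apply: (@cvg_comp _ _ _ c (Tc c) _ (nbhs (c p))); [exact: cc | exact: ((Tc_smooth ac 0).1 _ cx)].
  rewrite /Gc /Tc /= cfunK // -/(XT c p); apply: cvg_trans; apply: near_eq_cvg.
  by apply: filterS E => q; rewrite /Gc /Tc.
pose A := [set p : M | exists2 c, atlas c & cdom c p /\ XT c p < 0].
pose B := [set p : M | exists2 c, atlas c & cdom c p /\ 0 < XT c p].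
have Ao : open A.
  rewrite openE => p [c ac [cp lt0]]; rewrite /interior.
  have h1 : \forall q \near p, cdom c q by apply: open_nbhs_nbhs; split=> //; exact: cdom_open.
  have h2 : \forall q \near p, XT c q < 0 by exact: (cvgr_lt _ (cX c p ac cp)).
  by apply: filterS2 h1 h2 => q cq q0; exists c.
have Bo : open B.
  rewrite openE => p [c ac [cp gt0]]; rewrite /interior.
  have h1 : \forall q \near p, cdom c q by apply: open_nbhs_nbhs; split=> //; exact: cdom_open.
  have h2 : \forall q \near p, 0 < XT c q by exact: (cvgr_gt _ (cX c p ac cp)).
  by apply: filterS2 h1 h2 => q cq q0; exists c.
have AB : A = ~` B.
  apply/seteqP; split=> p.
    move=> [c ac [cp lt0]] [d ad [dp]].
    by rewrite /XT -(XT_change ac ad cp dp) ltNge (ltW lt0).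
  move=> nB; have [c ac cp] := atlas_cover p; exists c => //; split=> //.
  have := nz c p ac cp; rewrite neq_lt => /orP[//|gt0].
  by case: nB; exists c.
have [[p Ap]|nA] := pselect (A !=set0).
  left=> c q ac cq.
  have AT : A = [set: M].
    apply: (spacetime_connected (s := M)); first by exists p.
      by exists A => //; rewrite setTI.
    by exists A; rewrite ?setTI // AB; exact: open_closedC.
  have [d ad [dq lt0]] : A q by rewrite AT.
  by rewrite (XT_change ac ad cq dq).
right=> c q ac cq; have := nz c q ac cq; rewrite neq_lt => /orP[lt0|//].
by case: nA; exists q, c.
Qed.

Lemma integral_curve_timelike (g : R -> M) : integral_curve X g setT ->
  (forall c p, atlas c -> cdom c p -> form (metric M c p) (X c p) (torient M c p) < 0) ->
  future_timelike_curve g setT.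
Proof.
move=> ig fX; split; first by move=> x z _ _ y.
  by exists 0, 1; rewrite ltr01.
move=> t _; split; apply: integral_curve_smooth_germ => // c ac cp;
  by split; [exact: (Xt ac cp) | exact: fX].
Qed.

Lemma integral_curve_timelike_past (g : R -> M) : integral_curve X g setT ->
  (forall c p, atlas c -> cdom c p -> 0 < form (metric M c p) (X c p) (torient M c p)) ->
  past_timelike_curve g setT.
Proof.
move=> ig fX; split; first by move=> x z _ _ y.
  by exists 0, 1; rewrite ltr01.
move=> t _; split; apply: integral_curve_smooth_germ => // c ac cp;
  by split; [exact: (Xt ac cp) | exact: fX].
Qed.

End Orbits.

(** * Causal order with a chronological flow *)

(** All that the global argument uses. The list is stable under time reversal ([causal_flow_dual]),
    so statements on pasts follow from those on futures. Continuity of phi is required in time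
    only. *)
Record causal_flow (R : realType) (M : topologicalType) (ll J : M -> M -> Prop)
    (phi : R -> M -> M) : Prop := CausalFlow {
  cf_trans : forall x y z, ll x y -> ll y z -> ll x z;
  cf_irrefl : forall x, ~ ll x x;
  cf_open_left : forall x y, ll x y -> \forall x' \near x, ll x' y;
  cf_open_right : forall x y, ll x y -> \forall y' \near y, ll x y';
  cf_refl : forall x, J x x;
  cf_J_trans : forall x y z, J x y -> J y z -> J x z;
  cf_anti : forall x y, J x y -> J y x -> x = y;
  cf_ll_J : forall x y, ll x y -> J x y;
  cf_compact : forall x y, compact [set z | J x z /\ J z y];
  cf_phi0 : forall x, phi 0 x = x;
  cf_phiD : forall s t x, phi (s + t) x = phi t (phi s x);
  cf_continuous : forall x, {for 0, continuous (phi^~ x)};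
  cf_phi_ll : forall t x y, ll x y -> ll (phi t x) (phi t y);
  cf_ll_phi : forall x (t : R), 0 < t -> ll x (phi t x)
}.

Lemma causal_flow_dual (R : realType) (M : topologicalType) (ll J : M -> M -> Prop)
    (phi : R -> M -> M) : causal_flow ll J phi ->
  causal_flow (fun x y => ll y x) (fun x y => J y x) (fun t => phi (- t)).
Proof.
move=> H; split.
- by move=> x y z h1 h2; exact: cf_trans H _ _ _ h2 h1.
- exact: cf_irrefl H.
- by move=> x y; exact: cf_open_right H _ _.
- by move=> x y; exact: cf_open_left H _ _.
- exact: cf_refl H.
- by move=> x y z h1 h2; exact: cf_J_trans H _ _ _ h2 h1.
- by move=> x y h1 h2; exact: cf_anti H _ _ h2 h1.
- by move=> x y; exact: cf_ll_J H _ _.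
- move=> x y; have -> : [set z | J z x /\ J y z] = [set z | J y z /\ J z x].
    by apply/seteqP; split=> z [].
  exact: cf_compact H _ _.
- by move=> x; rewrite oppr0; exact: cf_phi0 H _.
- by move=> s t x; rewrite opprD; exact: cf_phiD H _ _ _.
- move=> x; apply: (@continuous_comp _ _ _ (fun t : R => - t) (phi^~ x)).
    exact: opp_continuous.
  by rewrite oppr0; exact: cf_continuous H _.
- by move=> t x y; exact: cf_phi_ll H _ _ _.
- move=> x t t0; have := cf_ll_phi H (phi (- t) x) t0.
  by rewrite -(cf_phiD H) addNr (cf_phi0 H).
Qed.

Section CausalOrder.
Variables (R : realType) (M : topologicalType).
Variables (ll J : M -> M -> Prop) (phi : R -> M -> M).
Hypothesis M_hausdorff : hausdorff_space M.
Hypothesis M_connected : connected [set: M].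
Hypothesis H : causal_flow ll J phi.

Let ll_trans := cf_trans H.
Let ll_irrefl := cf_irrefl H.
Let ll_open_left := cf_open_left H.
Let ll_open_right := cf_open_right H.
Let J_refl := cf_refl H.
Let J_trans := cf_J_trans H.
Let J_anti := cf_anti H.
Let ll_J := cf_ll_J H.
Let diamond_compact := cf_compact H.
Let phi0 := cf_phi0 H.
Let phiD := cf_phiD H.
Let phi_continuous := cf_continuous H.
Let phi_ll := cf_phi_ll H.
Let ll_phi := cf_ll_phi H.

Lemma phi_lt x s t : s < t -> ll (phi s x) (phi t x).
Proof.
move=> st; rewrite -[t](subrK s) [t - s + s]addrC phiD.
by apply: ll_phi; rewrite subr_gt0.
Qed.

Lemma phi_le_J x s t : s <= t -> J (phi s x) (phi t x).
Proof.
rewrite le_eqVlt => /orP[/eqP->//|st]; exact/ll_J/phi_lt.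
Qed.

Lemma ll_phi_le q x s t : s <= t -> ll q (phi s x) -> ll q (phi t x).
Proof.
rewrite le_eqVlt => /orP[/eqP->//|st] h; exact: ll_trans h (phi_lt _ st).
Qed.

(** If no index served all of S, directedness would make the failure sets a filter base on S; at a
    cluster point x, the index that is valid near x gives a contradiction. *)
Lemma compact_uniform (I : Type) (i0 : I) (P : I -> M -> Prop) (S : set M) :
  (forall i j, exists k, forall x, (P i x -> P k x) /\ (P j x -> P k x)) ->
  compact S -> (forall x, S x -> exists i, \forall y \near x, P i y) ->
  exists i, forall x, S x -> P i x.
Proof.
move=> dir cS loc; apply: contrapT => nP.
have nP' i : exists2 x, S x & ~ P i x.
  apply: contrapT => h; apply: nP; exists i => x Sx.
  by apply: contrapT => nPx; apply: h; exists x.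
pose F : set_system M := [set U | exists i, forall x, S x -> ~ P i x -> U x].
have FF : ProperFilter F.
  split; first by move=> [i h]; have [x Sx nPx] := nP' i; exact: (h x).
  split; first by exists i0.
    move=> U W [i hU] [j hW]; have [k hk] := dir i j; exists k => x Sx nPx; split.
      by apply: hU => // Pi; apply: nPx; case: (hk x) => h _; exact: h.
    by apply: hW => // Pj; apply: nPx; case: (hk x) => _ h; exact: h.
  by move=> U W UW [i hU]; exists i => x Sx nPx; apply: UW; exact: hU.
have [x [Sx cx]] := cS F FF (ex_intro _ i0 (fun x Sx _ => Sx)).
have [i Pi] := loc x Sx.
have [y [nPy Py]] := cx [set y | ~ P i y] _ (ex_intro _ i (fun y _ h => h)) Pi.
exact: nPy.
Qed.

Lemma orbit_chronological_past p x : exists t, ll x (phi t p).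
Proof.
pose A := [set x | exists t, ll x (phi t p)].
suff : A = [set: M] by move=> AT; have : A x by rewrite AT.
apply: M_connected.
- by exists p, 1; exact: ll_phi.
- exists A; last by rewrite setTI.
  by rewrite openE => y [t yt]; rewrite /interior; apply: filterS (ll_open_left yt) => z zt; exists t.
exists A; last by rewrite setTI.
move=> y cy.
(* For y in the closure, openness puts some a of A after phi (-1) y; applying phi 1 to phi (-1) y <<
   a << phi t p gives y << phi (t + 1) p. *)
have : ll (phi (- 1) y) y by rewrite -{2}(phi0 y) -(addNr 1) phiD; exact: ll_phi.
move=> /ll_open_right /cy [a [[t at_] ya]].
exists (t + 1); rewrite phiD -[y]phi0 -(addNr 1) phiD.
by apply: phi_ll; exact: ll_trans ya at_.
Qed.

Lemma compact_phi_bound (S : set M) q : compact S -> exists T, forall p, S p -> ll q (phi T p).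
Proof.
move=> cS; apply: (@compact_uniform R 0 (fun t p => ll q (phi t p))) => //.
  move=> s t; exists (Num.max s t) => x.
  by split; apply: ll_phi_le; rewrite le_max lexx ?orbT.
move=> p _; have [t qt] := orbit_chronological_past p q; exists t.
(* q is moved back by t, so that the open condition bears on p itself; spatial continuity of phi t
   is thereby avoided. *)
have : ll (phi (- t) q) p by rewrite -[p]phi0 -(addrN t) phiD; exact: phi_ll.
move=> /ll_open_right; apply: filterS => y h.
by rewrite -[q]phi0 -(addNr t) phiD; exact: phi_ll.
Qed.

Lemma compact_chronological_bound (S : set M) b : compact S ->
  exists t, forall p, S p -> ll p (phi t b).
Proof.
move=> cS; apply: (@compact_uniform R 0 (fun t p => ll p (phi t b))) => //.
  move=> s t; exists (Num.max s t) => x.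
  by split; apply: ll_phi_le; rewrite le_max lexx ?orbT.
move=> p _; have [t pt] := orbit_chronological_past b p; exists t.
exact: ll_open_left.
Qed.

Let diamond p (e : R) := [set z | J (phi (- e) p) z /\ J z (phi e p)].

Lemma diamond_closed x y : closed [set z | J x z /\ J z y].
Proof. exact: compact_closed. Qed.

(** J is closed only inside diamonds, hence the auxiliary bounds [phi 1 p] and [phi (- 1) p]:
    letting e tend to 0 gives J z p and J p z. *)
Lemma diamond_inter p z : (forall e, 0 < e -> diamond p e z) -> z = p.
Proof.
move=> hz; apply: J_anti.
- have : closed [set x | J z x /\ J x (phi 1 p)] by exact: diamond_closed.
  move=> cl; have [] // : [set x | J z x /\ J x (phi 1 p)] p.
  apply: cl => U Up; rewrite -[p]phi0 in Up.
  have /nbhs_normP [d /= d0 dP] := phi_continuous Up.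
  pose e := Num.min 1 (d / 2).
  have e0 : 0 < e by rewrite lt_min ltr01 divr_gt0.
  have ed : e < d by rewrite /e gt_min; apply/orP; right; lra.
  exists (phi e p); split; last by apply: dP; rewrite /ball_ /= sub0r normrN gtr0_norm.
  split; first by have [] := hz e e0.
  by apply: phi_le_J; rewrite /e ge_min lexx.
- have : closed [set x | J (phi (- 1) p) x /\ J x z] by exact: diamond_closed.
  move=> cl; have [] // : [set x | J (phi (- 1) p) x /\ J x z] p.
  apply: cl => U Up; rewrite -[p]phi0 in Up.
  have /nbhs_normP [d /= d0 dP] := phi_continuous Up.
  pose e := Num.min 1 (d / 2).
  have e0 : 0 < e by rewrite lt_min ltr01 divr_gt0.
  have ed : e < d by rewrite /e gt_min; apply/orP; right; lra.
  exists (phi (- e) p); split; last by apply: dP; rewrite /ball_ /= sub0r !normrN gtr0_norm.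
  split; last by have [] := hz e e0.
  by apply: phi_le_J; rewrite lerN2 /e ge_min lexx.
Qed.

Lemma diamond_mono p e e' : e <= e' -> diamond p e `<=` diamond p e'.
Proof.
move=> ee z [h1 h2]; split.
  by apply: J_trans h1; apply: phi_le_J; rewrite lerN2.
by apply: J_trans h2 _; exact: phi_le_J.
Qed.

Lemma diamond_shrink p (W : set M) : nbhs p W -> exists2 e, 0 < e & diamond p e `<=` W.
Proof.
move=> nW; have cC : compact (diamond p 1 `&` ~` W^°).
  apply: (subclosed_compact _ (@diamond_compact (phi (- 1) p) (phi 1 p))); last by move=> z [].
  by apply: closedI; [exact: diamond_closed | apply: open_closedC; exact: open_interior].
(* Indices range over R, so positivity is part of the predicate, which fails for nonpositive e. Of
   two positive indices the smaller one works, as its diamond is the smaller. *)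
have [||e Pe] := @compact_uniform R 1 (fun e z => 0 < e /\ ~ diamond p e z) _ _ cC.
- move=> i j; exists (if j <= 0 then i else if i <= 0 then j else Num.min i j) => x.
  have mn (a b : R) : Num.min a b <= a /\ Num.min a b <= b by split; rewrite ge_min lexx ?orbT.
  case: (leP j 0) => j0; first by split=> // -[].
  case: (leP i 0) => i0; first by split=> // -[].
  have [m1 m2] := mn i j.
  by split=> -[_ nd]; split; rewrite ?lt_min ?i0 // => /diamond_mono h; apply: nd; exact: h.
- move=> z [_ nWz].
  have [e [e0 nd]] : exists e, 0 < e /\ ~ diamond p e z.
    apply: contrapT => h; apply: nWz; rewrite (@diamond_inter p z) //.
    by move=> e e0; apply: contrapT => nd; apply: h; exists e.
  exists e; have : open (~` diamond p e) by apply: closed_openC; exact: diamond_closed.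
  move=> o; have : nbhs z (~` diamond p e) by exact: open_nbhs_nbhs.
  by apply: filterS => y.
have pd : W^° p by [].
have e1 : forall z, diamond p (Num.min 1 e) z -> diamond p 1 z /\ diamond p e z.
  by move=> z h; split; apply: diamond_mono h; rewrite ge_min lexx ?orbT.
have [e0|ne0] := ltP 0 e.
  exists (Num.min 1 e); first by rewrite lt_min ltr01.
  move=> z /e1 [h1 he]; apply: interior_subset; apply: contrapT => nWz.
  by have [_] := Pe z (conj h1 nWz); apply.
(* For e <= 0 the predicate is nowhere true, so the compact set is empty and [diamond p 1] already
   lies in W. *)
exists 1 => // z h1; apply: interior_subset; apply: contrapT => nWz.
by have [] := Pe z (conj h1 nWz); rewrite ltNge ne0.
Qed.

(** Monotonicity turns a cluster point into a limit: gamma is often before phi e p, hence always,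
    and at some time after phi (-e) p, hence ever after. *)
Lemma imprisoned_curve_endpoint (gamma : R -> M) (I : set R) s0 x y :
  (forall s t, I s -> I t -> s < t -> ll (gamma s) (gamma t)) -> I s0 ->
  (forall s, I s -> s0 <= s -> J x (gamma s) /\ J (gamma s) y) ->
  exists p, upper_endpoint gamma I p.
Proof.
move=> inc Is0 bd.
pose F : set_system M := [set U | exists2 s, I s & forall t, I t -> s <= t -> U (gamma t)].
have FF : ProperFilter F.
  split; first by move=> [s Is /(_ s Is)]; exact.
  split; first by exists s0.
    move=> U W [s Is hU] [t It hW]; exists (Num.max s t).
      by case: (leP s t).
    by move=> u Iu; rewrite ge_max => /andP[su tu]; split; [exact: hU | exact: hW].
  by move=> U W UW [s Is hU]; exists s => // t It st; apply: UW; exact: hU.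
have [p [_ cp]] := diamond_compact FF (ex_intro2 _ _ s0 Is0 bd).
exists p => W nW.
have [e e0 eW] := diamond_shrink nW.
have lt_after t : I t -> ll (gamma t) (phi e p).
  move=> It.
  have Ft : F (gamma @` [set u | I u /\ t <= u]) by exists t => // u Iu tu; exists u.
  have [z [[u [Iu tu] <-] uz]] := cp _ _ Ft (ll_open_left (ll_phi p e0)).
  move: tu; rewrite le_eqVlt => /orP[/eqP->//|tu].
  exact: ll_trans (inc _ _ It Iu tu) uz.
have pe : ll (phi (- e) p) p.
  by rewrite -{2}(phi0 p) -(addNr e) phiD; exact: ll_phi.
have Fs : F (gamma @` I) by exists s0 => // u Iu _; exists u.
have [z [[s Is <-] sz]] := cp _ _ Fs (ll_open_right pe).
exists s => // t It; rewrite le_eqVlt => /orP[/eqP<-|st]; apply: eW.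
  by split; apply: ll_J => //; exact: lt_after.
split; apply: ll_J; last exact: lt_after.
exact: ll_trans sz (inc _ _ Is It st).
Qed.

Lemma inextendible_curve_absorbs (S : set M) (gamma : R -> M) (I : set R) q :
  compact S -> (forall x, exists t, S (phi t x)) -> I !=set0 ->
  (forall s t, I s -> I t -> s < t -> ll (gamma s) (gamma t)) ->
  (forall p, ~ upper_endpoint gamma I p) ->
  exists2 s, I s & ll q (gamma s).
Proof.
move=> cS hitS [s0 Is0] inc noend; apply: contrapT => nq.
have [T HT] := compact_phi_bound q cS.
have [b Hb] := compact_chronological_bound (gamma s0) cS.
(* The upper corner: if gamma s = phi u p with p in S and u <= T, then gamma s precedes or equals
   phi T p, and p << phi b (gamma s0) gives phi T p << phi T (phi b (gamma s0)). *)
have [|p /noend //] := @imprisoned_curve_endpoint gamma I s0 (gamma s0) (phi T (phi b (gamma s0))) inc Is0.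
move=> s Is ss; split.
  move: ss; rewrite le_eqVlt => /orP[/eqP->//|ss].
  by apply: ll_J; exact: inc.
have [t St] := hitS (gamma s).
have E : gamma s = phi (- t) (phi t (gamma s)) by rewrite -phiD addrN phi0.
have [tT|Tt] := leP (- t) T; last first.
  case: nq; exists s => //; rewrite E.
  by apply: ll_trans (HT _ St) _; exact: phi_lt.
rewrite E; apply: J_trans (phi_le_J _ tT) _.
by apply/ll_J/phi_ll/Hb.
Qed.

(** An endpoint p would trap the orbit between phi (-1) p and phi 1 p. Shifting one of these
    relations by 2 lets the orbit leave the trap at a time when the other still holds it, and <<
    would have a cycle. *)
Lemma orbit_inextendible x : inextendible (phi^~ x) [set: R].
Proof.
move=> p.
have n1 : nbhs p [set z | ll z (phi 1 p)] by apply: ll_open_left; exact: ll_phi.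
have n2 : nbhs p [set z | ll (phi (- 1) p) z].
  by apply: ll_open_right; rewrite -{2}(phi0 p) -(addNr 1) phiD; exact: ll_phi.
split=> [up|lo].
- have [s _ hs] := up _ n1; have [t _ ht] := up _ n2.
  pose u := Num.max s t.
  have h1 : ll (phi (u + 3) x) (phi 1 p).
    by apply: hs => //; apply: (@le_trans _ _ u); rewrite ?le_max ?lexx // lerDl.
  have h2 : ll (phi 1 p) (phi (u + 2) x).
    have : ll (phi (- 1) p) (phi u x) by apply: ht => //; rewrite le_max lexx orbT.
    move=> /(phi_ll 2); rewrite -!phiD; have -> // : (- 1 + 2 : R) = 1 by ring.
  have h3 : ll (phi (u + 2) x) (phi (u + 3) x) by apply: phi_lt; lra.
  exact: ll_irrefl (ll_trans h2 (ll_trans h3 h1)).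
- have [s _ hs] := lo _ n1; have [t _ ht] := lo _ n2.
  pose u := Num.min s t.
  have h1 : ll (phi (u - 2) x) (phi (- 1) p).
    have : ll (phi u x) (phi 1 p) by apply: hs => //; rewrite ge_min lexx.
    move=> /(phi_ll (- 2)); rewrite -!phiD; have -> // : (1 - 2 : R) = - 1 by ring.
  have h2 : ll (phi (- 1) p) (phi (u - 3) x).
    by apply: ht => //; apply: (@le_trans _ _ u); rewrite ?ge_min ?lexx ?orbT // gerBl.
  have h3 : ll (phi (u - 3) x) (phi (u - 2) x) by apply: phi_lt; lra.
  exact: ll_irrefl (ll_trans h1 (ll_trans h2 h3)).
Qed.

End CausalOrder.

Lemma opp_upper_endpoint (R : realType) (M : topologicalType) (gamma : R -> M) (I : set R) p :
  upper_endpoint (gamma \o -%R) [set s | I (- s)] p -> lower_endpoint gamma I p.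
Proof.
move=> up U /up [s Is hs]; exists (- s) => // t It ts.
by have := hs (- t); rewrite /= opprK lerNr; apply.
Qed.

(** Reversing the parameter of gamma, reversing the order, or both, reduces the four cases to
    [inextendible_curve_absorbs]. *)
Lemma inextendible_absorbs (R : realType) (M : topologicalType) (ll J : M -> M -> Prop)
    (phi : R -> M -> M) (S : set M) (gamma : R -> M) (I : set R) q :
  hausdorff_space M -> connected [set: M] -> causal_flow ll J phi ->
  compact S -> (forall x, exists t, S (phi t x)) -> I !=set0 ->
  (forall s t, I s -> I t -> s < t -> ll (gamma s) (gamma t)) \/
  (forall s t, I s -> I t -> s < t -> ll (gamma t) (gamma s)) ->
  inextendible gamma I ->
  (exists2 s, I s & ll q (gamma s)) /\ (exists2 s, I s & ll (gamma s) q).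
Proof.
move=> hM cM H cS hS I0 mono ext.
have hS' x : exists t, S (phi (- t) x) by have [t] := hS x; exists (- t); rewrite opprK.
have H' := causal_flow_dual H.
have I0' : [set s | I (- s)] !=set0 by have [s Is] := I0; exists (- s); rewrite /= opprK.
have up p : ~ upper_endpoint gamma I p by case: (ext p).
have up' p : ~ upper_endpoint (gamma \o -%R) [set s | I (- s)] p.
  by move=> /opp_upper_endpoint; case: (ext p).
have opp (P : M -> Prop) : (exists2 s, I (- s) & P (gamma (- s))) -> exists2 s, I s & P (gamma s).
  by move=> [s Is Ps]; exists (- s).
case: mono => mono; split.
- exact: (inextendible_curve_absorbs hM cM H q cS hS I0 mono up).
- apply: (opp (fun x => ll x q)).
  apply: (inextendible_curve_absorbs hM cM H' q cS hS' I0' _ up') => s t Is It st.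
  by apply: mono => //; rewrite ltrN2.
- apply: (opp (fun x => ll q x)).
  apply: (inextendible_curve_absorbs hM cM H q cS hS I0' _ up') => s t Is It st.
  by apply: mono => //; rewrite ltrN2.
- exact: (inextendible_curve_absorbs hM cM H' q cS hS' I0 mono up).
Qed.

(** * From the spacetime to the abstract causal flow, and conclusion *)

Lemma causal_flow_of_complete (R : realType) (n : nat) (M : spacetime R n) (X : vector_field M)
    (phi : R -> M -> M) (sg : R) :
  globally_hyperbolic M -> timelike_field (metric M) X -> conformal_killing (metric M) X ->
  (forall p, phi 0 p = p) -> (forall p, integral_curve X (phi^~ p) setT) ->
  (forall p t, 0 < t -> chron p (phi (sg * t) p)) ->
  causal_flow (@chron R n M) (fun p q => p = q \/ strict_causal p q) (fun t => phi (sg * t)).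
Proof.
move=> [caus cpt] Xt Xc phi0 phiX cphi; split.
- exact: chron_trans.
- by move=> p /chron_strict_causal; exact: caus.
- by move=> p q; exact: chron_near_left.
- by move=> p q; exact: chron_near_right.
- by left.
- move=> p q r [->//|pq] [<-|qr]; right=> //; exact: strict_causal_trans pq qr.
- move=> p q [//|pq] [//|qp]; case: (caus p); exact: strict_causal_trans pq qp.
- by move=> p q /chron_strict_causal; right.
- move=> p q; have -> : [set z | (p = z \/ strict_causal p z) /\ (z = q \/ strict_causal z q)] =
     causal_future p `&` causal_past q by [].
  exact: cpt.
- by move=> p; rewrite mulr0; exact: phi0.
- by move=> s t p; rewrite mulrDr; exact: (flow_add _ _ _ phi0 phiX).
- move=> p; apply: (@continuous_comp _ _ _ (fun t : R => sg * t) (phi^~ p)).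
    by apply: cvgM; [exact: cvg_cst | exact: cvg_id].
  by have [_ _ _ /(_ (sg * 0) I) []] := phiX p.
- by move=> t p q; exact: (chron_flow Xt Xc phi0 phiX).
- exact: cphi.
Qed.

Theorem theorem1p3 (R : realType) (n : nat) (hn : (1 <= n)%N)
    (M : spacetime R n)
    (hGH : globally_hyperbolic M)
    (hCauchy : exists S : set M, cauchy_hypersurface S /\ compact S)
    (X : vector_field M)
    (hXtimelike : timelike_field (metric M) X)
    (hXconf : conformal_killing (metric M) X)
    (hXcomplete : complete_field X) :
  no_observer_horizon M.
Proof.
have [S [cauchyS cS]] := hCauchy.
have [phi [phi0 phiX]] := complete_flow hXcomplete.
(* The sign [sg] makes the reparametrised flow future-directed. *)
have [sg [F hitS]] : exists sg, causal_flow (@chron R n M) (fun p q => p = q \/ strict_causal p q)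
    (fun t => phi (sg * t)) /\ forall x, exists t, S (phi (sg * t) x).
  have [fX|pX] := timelike_field_orientation hXtimelike.
    have oX p := integral_curve_timelike hXtimelike (phiX p) fX.
    have F : causal_flow (@chron R n M) (fun p q => p = q \/ strict_causal p q)
        (fun t => phi (1 * t)).
      apply: (causal_flow_of_complete hGH hXtimelike hXconf phi0 phiX) => p t t0.
      by rewrite mul1r -{1}(phi0 p); exact: (future_curve_chron (oX p) I I t0).
    exists 1; split=> // x.
    have inex : inextendible (phi^~ x) [set: R].
      by move=> p; have := orbit_inextendible F x p; under eq_fun do rewrite mul1r.
    have [t [[_ St] _]] := cauchyS _ _ (or_introl (oX x)) inex.
    by exists t; rewrite mul1r.
  have oX p := integral_curve_timelike_past hXtimelike (phiX p) pX.
  have F : causal_flow (@chron R n M) (fun p q => p = q \/ strict_causal p q)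
      (fun t => phi (- 1 * t)).
    apply: (causal_flow_of_complete hGH hXtimelike hXconf phi0 phiX) => p t t0.
    have nt0 : - t < 0 by rewrite oppr_lt0.
    by rewrite mulN1r -{1}(phi0 p); exact: (past_curve_chron (oX p) I I nt0).
  exists (- 1); split=> // x.
  have inex : inextendible (phi^~ x) [set: R].
    (* Dualising undoes the sign and returns the orbits of X in their own parametrisation. *)
    move=> p; have := orbit_inextendible (causal_flow_dual F) x p.
    by under eq_fun do rewrite mulN1r opprK.
  have [t [[_ St] _]] := cauchyS _ _ (or_intror (oX x)) inex.
  by exists (- t); rewrite mulN1r opprK.
move=> gamma I tg ext.
have [s0 Is0] : I !=set0 by case: tg => -[_ [s [t [Is _ _]]] _]; exists s.
have mono : (forall s t, I s -> I t -> s < t -> chron (gamma s) (gamma t)) \/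
    (forall s t, I s -> I t -> s < t -> chron (gamma t) (gamma s)).
  case: tg => cg; [left|right] => s t Is It; first exact: future_curve_chron cg Is It.
  exact: past_curve_chron cg Is It.
have abs q := inextendible_absorbs q (@manifold_hausdorff _ _ M) (@spacetime_connected _ _ M)
  F cS hitS (ex_intro _ s0 Is0) mono ext.
split; apply/seteqP; split=> // q _; have [[s Is qs] [t It tq]] := abs q.
  by exists (gamma t) => //; exists t.
by exists (gamma s) => //; exists s.
Qed.
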